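(* Let $X$ be a complex surface and $Y$ an elliptic curve holomorphically embedded in $X$. Assume that there exist a non-singular holomorphic foliation $\mathcal{F}$, defined on a neighborhood of $Y$ in $X$, having $Y$ as a compact leaf, and a closed curve $c$ in $Y$ along which the holonomy of $\mathcal{F}$ is irrationally indifferent and non-linearizable. Then the pair $(Y,X)$ is of type $(\gamma)$.
   Context: Complex surface: complex manifold of dimension 2 (not assumed compact or Kähler). Elliptic curve: compact Riemann surface of genus 1. Holonomy. $\mathrm{Diff}(\mathbb{C},0)$ is the group of germs at $0$ of local holomorphic diffeomorphisms of $\mathbb{C}$ fixing $0$. For a closed smooth curve $c$ in $Y$ based at $p$ and a transversal $\tau$ (a holomorphically embedded open disk through $p$ transverse to the leaves, with a coordinate sending $p$ to $0$), cover $c$ by finitely many foliated charts $(W_j;(z_j,w_j))$ with $W_j\cap Y=\{w_j=0\}$; composing the transition maps of the transverse coordinates while going once around $c$ gives a germ in $\mathrm{Diff}(\mathbb{C},0)$ depending only on the class of $c$ in $\pi_1(Y,p)$. This is the holonomy of $\mathcal{F}$ along $c$; it gives a homomorphism $h_{\mathcal{F}}:\pi_1(Y,p)\to \mathrm{Diff}(\mathbb{C},0)$, well defined up to conjugation. A germ $f(z)=\lambda z+O(z^2)\in\mathrm{Diff}(\mathbb{C},0)$ is linearizable if $h\circ f\circ h^{-1}(z)=\lambda z$ for some $h\in\mathrm{Diff}(\mathbb{C},0)$, otherwise non-linearizable. It is rationally (resp. irrationally) indifferent if $|\lambda|=1$ and $\lambda$ is a root of unity (resp. not a root of unity). These properties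 are conjugation invariant. Ueda types. The existence of $\mathcal{F}$ implies that the normal bundle $N_{Y/X}$ is topologically trivial. For a compact smooth curve $Y\subset X$ with topologically trivial normal bundle, $N_{Y/X}$ is $\mathrm{U}(1)$-flat: for a suitable finite open cover $\{U_j\}$ of $Y$ it has constant transition functions $t_{jk}\in \mathrm{U}(1)=\{t\in\mathbb{C}:|t|=1\}$. Choose neighborhoods $V_j$ of $U_j$ in $X$ and holomorphic defining functions $w_j$ of $U_j$ in $V_j$ with $(w_j/w_k)|_{U_j\cap U_k}\equiv t_{jk}$. For $n\ge 1$, such a system is of type $n$ if $t_{jk}w_k=w_j+f^{(n+1)}_{jk}(z_j)\,w_j^{n+1}+O(w_j^{n+2})$ on $V_j\cap V_k$. Then $\{(U_j\cap U_k,f_{jk}^{(n+1)})\}$ is a 1-cocycle, and its class $u_n(Y,X)\in H^1(Y,N_{Y/X}^{-n})$ is the $n$-th Ueda class; it is the obstruction to refining the system to one of type $n+1$. - $(Y,X)$ is of type $(\alpha)$ (finite type) if there is $n\geq 1$ such that for every $m\le n$ there is a system of type $m$, with $u_m(Y,X)=0$ for $m<n$ and $u_n(Y,X)\ne0$. Otherwise it is of infinite type, i.e. for every $n\ge1$ there is a system of type $n$ with $u_n(Y,X)=0$. - $(Y,X)$ is of type $(\beta)$ if (after shrinking the $V_j$) there is a system $\{w_j\}$ with $t_{jk}w_k=w_j$ on $V_j\cap V_k$ for all $j,k$; equivalently, some neighborhood of $Y$ carries a non-singular holomorphic foliation having $Y$ as a leaf with $\mathrm{U}(1)$-linear holonomy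 along $Y$. - $(Y,X)$ is of type $(\gamma)$ if it is neither of type $(\alpha)$ nor of type $(\beta)$. *)

(* Defs.v *)
From HB Require Import structures.
From mathcomp Require Import all_boot all_order all_algebra.
From mathcomp Require Import all_classical all_reals all_analysis.
From mathcomp.real_closed Require Import complex.

Set Implicit Arguments.
Unset Strict Implicit.
Unset Printing Implicit Defensive.

Import Order.TTheory GRing.Theory Num.Theory.
Import numFieldNormedType.Exports.

Local Open Scope classical_set_scope.
Local Open Scope ring_scope.

(* The complex line and plane as normed modules over R[i]: [derivable] and
   [differentiable] on them are complex differentiability, so that a function
   is holomorphic on an open set when it is derivable (resp. differentiable)
   at each of its points. *)
Notation Cline R := (R[i]^o).
Notation Cplane R := (R[i]^o * R[i]^o)%type.

Section Surfaces.
Variable R : realType.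
Notation C := (Cline R).
Notation C2 := (Cplane R).

(* A homeomorphism from an open subset of X onto an open subset of C^2; the
   values of [cmap] and [cinv] outside [dom] and [cmap @` dom] are junk. *)
Record chart (X : topologicalType) := Chart {
  dom : set X;
  cmap : X -> C2;
  cinv : C2 -> X;
  dom_open : open dom;
  img_open : open (cmap @` dom);
  cmapK : forall p, dom p -> cinv (cmap p) = p;
  cmap_cont : forall p, dom p -> {for p, continuous cmap};
  cinv_cont : forall q, (cmap @` dom) q -> {for q, continuous cinv}
}.

Definition zcoord (X : topologicalType) (c : chart X) (x : X) : C :=
  (cmap c x).1.
Definition wcoord (X : topologicalType) (c : chart X) (x : X) : C :=
  (cmap c x).2.

Definition holomorphic_transition (X : topologicalType) (a b : chart X) :=
  forall p, dom a p -> dom b p ->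
    differentiable (cmap b \o cinv a : C2 -> C2) (cmap a p).

Record complexSurface := ComplexSurface {
  space :> topologicalType;
  surf_hausdorff : hausdorff_space space;
  surf_second_countable : @second_countable space;
  surf_atlas : set (chart space);
  surf_cover : forall p, exists2 a, surf_atlas a & dom a p;
  surf_compat : forall a b, surf_atlas a -> surf_atlas b ->
    holomorphic_transition a b
}.

Definition holomorphic_chart (X : complexSurface) (c : chart X) :=
  forall a, surf_atlas a ->
    holomorphic_transition a c /\ holomorphic_transition c a.

Definition adapted_chart (X : complexSurface) (Y : set X) (c : chart X) :=
  holomorphic_chart c /\ (forall x, dom c x -> (Y x <-> wcoord c x = 0)).

Definition embedded_curve (X : complexSurface) (Y : set X) :=
  forall p, Y p -> exists2 c : chart X, adapted_chart Y c & dom c p.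

Definition homeomorphic_sets (T U : topologicalType) (A : set T) (B : set U) :=
  exists (f : T -> U) (g : U -> T),
    [/\ {within A, continuous f}, {within B, continuous g},
        set_fun A B f, set_fun B A g &
        (forall x, A x -> g (f x) = x) /\ (forall y, B y -> f (g y) = y)].

Definition torus : set C2 := [set u | `|u.1| = 1 /\ `|u.2| = 1].

(* Y is the image of a holomorphic embedding of a compact Riemann surface;
   genus 1 means that the underlying topological surface is a torus. *)
Definition elliptic_curve (X : complexSurface) (Y : set X) :=
  [/\ embedded_curve Y, compact Y & homeomorphic_sets Y torus].

(* Near p, w_b is the holomorphic function h of w_a. *)
Definition transverse_transition (X : topologicalType) (a b : chart X) (p : X)
    (h : C -> C) :=
  (\forall z \near wcoord a p, derivable h z 1) /\
  (\forall x \near p, wcoord b x = h (wcoord a x)).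

(* A non-singular holomorphic foliation on the open set [fol_dom], given by an
   atlas of charts (z, w) whose plaques are the level sets of w. *)
Record foliation (X : complexSurface) := Foliation {
  fol_atlas : set (chart X);
  fol_holomorphic : forall a, fol_atlas a -> holomorphic_chart a;
  fol_transition : forall a b p, fol_atlas a -> fol_atlas b ->
    dom a p -> dom b p -> exists h, transverse_transition a b p h
}.

Definition fol_dom (X : complexSurface) (F : foliation X) : set X :=
  \bigcup_(a in fol_atlas F) dom a.

Definition foliated_chart (X : complexSurface) (F : foliation X)
    (c : chart X) :=
  [/\ holomorphic_chart c, dom c `<=` fol_dom F &
      forall a p, fol_atlas F a -> dom a p -> dom c p ->
        (exists h, transverse_transition a c p h) /\
        (exists h, transverse_transition c a p h)].

(* A path is continuous for the leaf topology iff it is continuous in X and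
   locally stays in a plaque. *)
Definition leaf_path (X : complexSurface) (F : foliation X) (gam : R -> X) :=
  {within `[0, 1], continuous gam} /\
  (forall s, s \in `[0, 1] -> exists a, [/\ fol_atlas F a, dom a (gam s) &
     \forall u \near s, u \in `[0, 1] ->
       dom a (gam u) /\ wcoord a (gam u) = wcoord a (gam s)]).

Definition is_leaf (X : complexSurface) (F : foliation X) (L : set X) :=
  exists2 p, fol_dom F p &
    L = [set q | exists gam, [/\ leaf_path F gam, gam 0 = p & gam 1 = q]].

Definition closed_curve (X : complexSurface) (Y : set X) (gam : R -> X) :=
  [/\ {within `[0, 1], continuous gam},
      forall s, s \in `[0, 1] -> Y (gam s) & gam 0 = gam 1].

(* Functions C -> C representing an element of Diff(C, 0). *)
Definition diff0 (f : C -> C) :=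
  [/\ f 0 = 0, (\forall z \near (0 : C), derivable f z 1) & 'D_1 f 0 != 0].

Definition linearizable (f : C -> C) :=
  exists h k : C -> C, [/\ diff0 h, diff0 k,
    (\forall z \near (0 : C), h (k z) = z),
    (\forall z \near (0 : C), k (h z) = z) &
    (\forall z \near (0 : C), h (f (k z)) = 'D_1 f 0 * z)].

Definition irrationally_indifferent (f : C -> C) :=
  `|'D_1 f 0| = 1 /\ (forall n : nat, (0 < n)%N -> ('D_1 f 0) ^+ n != 1).

(* [h] represents the holonomy of F along gam: the segments
   gam [s i, s (i+1)], i < n, lie in foliated charts W i with
   W i `&` Y = {w_i = 0}, and h is the composition g (n-1) \o ... \o g 0 of the
   germs of the transverse transition maps w_(i+1) = g i (w_i), going back to
   W 0 at the end. The transversal at gam 0 is {z_0 = const} with coordinate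
   w_0; another choice of transversal, coordinate or charts conjugates h in
   Diff(C, 0). *)
Definition holonomy_along (X : complexSurface) (F : foliation X) (Y : set X)
    (gam : R -> X) (h : C -> C) :=
  exists (n : nat) (s : nat -> R) (W : nat -> chart X) (g : nat -> C -> C),
  [/\ [/\ (0 < n)%N, s 0%N = 0, s n = 1 & W n = W 0%N],
      forall i, (i < n)%N -> foliated_chart F (W i) /\ adapted_chart Y (W i),
      forall i, (i < n)%N -> s i <= s i.+1 /\
        (forall u, u \in `[s i, s i.+1] -> dom (W i) (gam u)),
      forall i, (i < n)%N -> diff0 (g i) /\
        transverse_transition (W i) (W i.+1) (gam (s i.+1)) (g i) &
      (\forall z \near (0 : C), h z = iteri n g z)].

(* Finitely many coordinate charts (z_j, w_j) with domains V_j, such that the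
   U_j = V_j `&` Y = {w_j = 0} cover Y, w_j / w_k extends holomorphically to
   U_j `&` U_k, and this extension is there equal to the constant t_jk in
   U(1). *)
Record flat_system (X : complexSurface) (Y : set X) := FlatSystem {
  fs_size : nat;
  fs_chart : 'I_fs_size -> chart X;
  fs_trans : 'I_fs_size -> 'I_fs_size -> C;
  fs_adapted : forall j, adapted_chart Y (fs_chart j);
  fs_cover : forall p, Y p -> exists j, dom (fs_chart j) p;
  fs_unitary : forall j k, `|fs_trans j k| = 1;
  fs_quotient : forall j k p, Y p ->
    dom (fs_chart j) p -> dom (fs_chart k) p ->
    wcoord (fs_chart j) x / wcoord (fs_chart k) x
      @[x --> within (~` Y) (nbhs p)] --> fs_trans j k
}.

Section Ueda.
Variables (X : complexSurface) (Y : set X).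
Implicit Type S : flat_system Y.

Definition fs_z S (j : 'I_(fs_size S)) : X -> C := zcoord (fs_chart j).
Definition fs_w S (j : 'I_(fs_size S)) : X -> C := wcoord (fs_chart j).
Definition fs_U S (j : 'I_(fs_size S)) : set X := Y `&` dom (fs_chart j).

(* S is of type n with coefficients f_jk = f_jk^(n+1), functions of the
   coordinate z_j:
     t_jk w_k = w_j + f_jk(z_j) w_j^(n+1) + O(w_j^(n+2))
   near each point of U_j `&` U_k. *)
Definition system_of_type S (n : nat)
    (f : 'I_(fs_size S) -> 'I_(fs_size S) -> C -> C) :=
  forall j k p, fs_U j p -> fs_U k p ->
    derivable (f j k) (fs_z j p) 1 /\
    exists2 K : C, 0 <= K &
      \forall x \near p,
        `|fs_trans j k * fs_w k x
          - (fs_w j x + f j k (fs_z j x) * fs_w j x ^+ n.+1)|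
        <= K * `|fs_w j x| ^+ n.+2.

(* Vanishing of the class of (f_jk) in H^1(Y, N^-n): it is the coboundary of a
   cochain (g_j). Functions on U_j represent sections of N^-n in the frame
   (dw_j)^n, and dw_k = t_jk^-1 dw_j along Y. Vanishing on the cover (U_j) is
   vanishing in H^1(Y, N^-n), as Cech H^1 of a cover injects into the limit. *)
Definition coboundary S (n : nat)
    (f : 'I_(fs_size S) -> 'I_(fs_size S) -> C -> C) :=
  exists g : 'I_(fs_size S) -> C -> C,
    (forall j p, fs_U j p -> derivable (g j) (fs_z j p) 1) /\
    (forall j k p, fs_U j p -> fs_U k p ->
       f j k (fs_z j p) =
         (fs_trans j k ^+ n)^-1 * g k (fs_z k p) - g j (fs_z j p)).

(* u_n(Y, X) does not depend on the system of type n, up to a nonzero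
   factor. *)
Definition ueda_class_zero (n : nat) :=
  exists S f, @system_of_type S n f /\ coboundary n f.
Definition ueda_class_nonzero (n : nat) :=
  exists S f, @system_of_type S n f /\ ~ coboundary n f.

Definition type_alpha :=
  exists n : nat, [/\ (1 <= n)%N,
    forall m : nat, (1 <= m <= n)%N -> exists S f, @system_of_type S m f,
    forall m : nat, (1 <= m < n)%N -> ueda_class_zero m &
    ueda_class_nonzero n].

Definition type_beta :=
  exists S, forall j k x, dom (fs_chart j) x -> dom (fs_chart k) x ->
    @fs_trans _ _ S j k * fs_w k x = fs_w j x.

Definition type_gamma := ~ type_alpha /\ ~ type_beta.

End Ueda.
End Surfaces.

(* Main.v *)
Require Import Defs.
From mathcomp Require Import all_boot all_order all_algebra.
From mathcomp Require Import all_classical all_reals all_analysis.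
From mathcomp.real_closed Require Import complex.
From mathcomp Require Import ring lra.
Set Implicit Arguments.
Unset Strict Implicit.
Unset Printing Implicit Defensive.
Import Order.TTheory GRing.Theory Num.Theory.
Import numFieldNormedType.Exports.
Local Open Scope classical_set_scope.
Local Open Scope ring_scope.

(* The torus gives a covering of [Y] by the plane. A local first integral of [F]
   vanishing on [Y] continues analytically over the plane, and adding a period [e]
   composes it with a germ [h e]; the germs [h e] commute, and the holonomy along
   [c] is conjugate to the inverse of some [h e0]. If a multiplier of some [h e]
   had modulus different from 1, Koenigs' linearization of [h e] or its inverse
   would linearize [h e0]; so all the multipliers are unitary. That of [e0] is not
   a root of unity, so for every n the first integral can be chosen so that all
   the [h e] are linear up to order n + 1.

   Expand such a first integral in powers of the [w_j] of a system of type n. At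
   each order i <= n, once the previous coefficients vanish, the modulus of the
   coefficient is a function on [Y], so by the maximum principle the coefficient
   is locally constant; its quotient by the i-th power of the first coefficient
   is constant on the plane and gets multiplied by m(e0)^(1-i), so it vanishes if
   i > 1. The coefficients of order n + 1 then split the cocycle of the system,
   which is thus a coboundary, and [(Y, X)] is not of type alpha.

   If [t_jk w_k = w_j] exactly, this holds for every n: all the jets of the first
   integral along the transversals of a chart agree, so each [w_j] is itself a
   first integral. One that agrees with [w_j] near a point is then everywhere a
   constant multiple of the local [w_k], which linearizes [h e0]: [(Y, X)] is not
   of type beta. *)

(** * Derivatives *)

(** Genus 1 enters through the fundamental group: periods add commutatively, so every [h e] commutes
    with [h e0]. In a coordinate that makes a contraction linear, every germ commuting with it is
    linear too; this is how a multiplier off the unit circle would contradict the hypothesis on the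
    curve. Since [h e0] has no linearizing germ, only finitely many orders can be linearized for the
    purpose at hand: the correction at order N is determined at [e0], where irrationality makes
    m(e0)^N - m(e0) nonzero, and commutation makes it serve for all the other periods.

    The plane carries no complex structure: it only indexes germs, and holomorphy is always tested
    in charts of the surface. Functions on the plane that are invariant under periods come from the
    compact curve, which is what provides the maxima.

    For type alpha, the comparison of Ueda classes of different systems is bypassed: whatever its
    origin, a system of type n is shown to have a cocycle that is a coboundary. *)

Lemma is_derive_epsP (K : numFieldType) (f : K^o -> K^o) (x d : K^o) :
  is_derive x 1 f d <->
  forall e : K, 0 < e -> \forall y \near x,
    `|f y - f x - d * (y - x)| <= e * `|y - x|.
Proof.
have key (h : K) : h != 0 ->
    `|d - h^-1 *: ((f \o shift x) (h *: (1 : K^o)) - f x)| =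
    `|f (h + x) - f x - d * h| / `|h|.
  move=> h0; rewrite -normfV -normrM /= /shift /= distrC.
  congr (`| _ |); rewrite /GRing.scale /= mulr1; field.
  exact: h0.
have near0P (P : K -> Prop) : (\forall h \near (0 : K^o)^', P h) <->
    exists2 s : K, 0 < s & forall h, h != 0 -> `|h| < s -> P h.
  rewrite near_withinE; split=> [/(@nbhs_normP K K^o)[s s0 H]|[s s0 H]].
    by exists s => // h h0 hs; apply: H => //=; rewrite sub0r normrN.
  apply/(@nbhs_normP K K^o); exists s => //= h; rewrite /ball_/= sub0r normrN.
  by move=> hs h0; exact: H.
split=> [[df dfE] e e0|H].
  move: df; rewrite /derivable => /cvgrPdist_le/(_ e e0)/near0P.
  rewrite [lim _]dfE => -[s s0 sH].
  apply/(@nbhs_normP K K^o); exists s => //= y; rewrite /ball_/= distrC => ys.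
  have [->|yx] := eqVneq y x; first by rewrite !subrr mulr0 subrr !normr0 mulr0.
  have yx0 : y - x != 0 by rewrite subr_eq0.
  by have := sH _ yx0 ys; rewrite key // subrK ler_pdivrMr ?normr_gt0.
have lim : (h^-1 *: ((f \o shift x) (h *: (1 : K^o)) - f x) @[h --> 0^']) --> d.
  apply/cvgrPdist_le => e e0; apply/near0P.
  have /(@nbhs_normP K K^o)[s s0 sH] := H e e0.
  exists s => // h h0 hs; rewrite key // ler_pdivrMr ?normr_gt0//.
  have /= := sH (h + x); rewrite /ball_/= opprD addrC subrK normrN addrK.
  by apply.
split; first by apply/cvg_ex; exists d.
exact: cvg_lim.
Qed.

(** * The modulus as a real number *)

Section modulus.
Variable R : realType.
Implicit Types x y z : R[i].

(** The norm of [R[i]] takes its values in [R[i]]; as an element of the ordered field [R] the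
    modulus can be handled by [lra]. *)
Definition md z : R := Normc.normc z.

Lemma md_norm z : `|z| = (md z)%:C%C.
Proof. by rewrite /md; case: z. Qed.
Lemma md_ge0 z : 0 <= md z.
Proof. by case: z => a b; exact: sqrtr_ge0. Qed.
Lemma md0 : md 0 = 0.
Proof. by rewrite /md Normc.normc0. Qed.
Lemma md1 : md 1 = 1.
Proof. by rewrite /md Normc.normc1. Qed.
Lemma mdM x y : md (x * y) = md x * md y.
Proof. by rewrite /md Normc.normcM. Qed.
Lemma mdN x : md (- x) = md x.
Proof. exact: normcN. Qed.
Lemma mdV x : md x^-1 = (md x)^-1.
Proof. by rewrite /md Normc.normcV. Qed.
Lemma mdX x n : md (x ^+ n) = md x ^+ n.
Proof. by elim: n => [|n IH]; rewrite ?expr0 ?md1// !exprS mdM IH. Qed.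
Lemma mdD x y : md (x + y) <= md x + md y.
Proof. exact: le_normcD. Qed.
Lemma mdB x y : md (x - y) <= md x + md y.
Proof. by rewrite -[md y]mdN; exact: mdD. Qed.
Lemma mdBC x y : md (x - y) = md (y - x).
Proof. by rewrite -mdN opprB. Qed.
Lemma md_eq0 x : (md x == 0) = (x == 0).
Proof. by apply/eqP/eqP => [/Normc.eq0_normc|->] //; rewrite md0. Qed.
Lemma md_gt0 x : (0 < md x) = (x != 0).
Proof. by rewrite lt_def md_ge0 andbT md_eq0. Qed.
Lemma mdR (r : R) : md r%:C%C = `|r|.
Proof. by rewrite /md /= expr0n /= addr0 sqrtr_sqr. Qed.
Lemma md_tri z x y : md (x - y) <= md (x - z) + md (z - y).
Proof. by rewrite (_ : x - y = (x - z) + (z - y)) ?mdD//; ring. Qed.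
Lemma md_lB x y : md x - md y <= md (x - y).
Proof. by rewrite lerBlDr; have := mdD (x - y) y; rewrite subrK. Qed.
Lemma Re_md x : `|complex.Re x| <= md x.
Proof. by rewrite -lecR -md_norm; exact: normc_ge_Re. Qed.
Lemma Im_md x : `|complex.Im x| <= md x.
Proof. by case: x => a b; rewrite /md /= -sqrtr_sqr ler_sqrt ?addr_ge0 ?sqr_ge0// lerDr sqr_ge0. Qed.
Lemma md_ReIm x : md x <= `|complex.Re x| + `|complex.Im x|.
Proof.
rewrite {1}[x]complexE; apply: (le_trans (mdD _ _)); rewrite mdM !mdR.
by rewrite lerD2l /md /= expr0n expr1n add0r sqrtr1 mul1r.
Qed.
Lemma md_i : md 'i%C = 1.
Proof. by rewrite /md /= expr0n expr1n add0r sqrtr1. Qed.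

Lemma near_md (z : R[i]^o) (P : R[i] -> Prop) :
  (\forall y \near z, P y) <->
  exists2 s : R, 0 < s & forall y, md (y - z) < s -> P y.
Proof.
split=> [/nbhs_normP[e /= e0 H]|[s s0 H]].
  (* A positive element of [R[i]] is real, so its real part can serve as the radius. *)
  have er : complex.Re e%R > 0 by move: e0; rewrite ltcE => /andP[].
  exists (complex.Re e) => // y ys; apply: H => /=.
  move: e0; rewrite ltcE => /andP[/eqP /= ie _].
  by rewrite distrC md_norm ltcE /= ie eqxx.
apply/nbhs_normP; exists s%:C%C => /=; first by rewrite ltcR.
by move=> y /=; rewrite distrC md_norm ltcR => /H.
Qed.

End modulus.

(** * Derivatives and continuity in a complex or real variable *)

Section gder.
Variable R : realType.
Local Notation C := R[i].
Section generic.
Variables (T : Type) (io : T -> C).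
Implicit Types f g : T -> C.

(* Derivatives of C-valued maps of a complex variable ([io] the identity) and
   of a real variable ([io] the injection of R) are treated at once. *)
Definition gder f (x : T) (d : C) := forall e : R, 0 < e ->
  exists2 s : R, 0 < s & forall y, md (io y - io x) < s ->
    md (f y - f x - d * (io y - io x)) <= e * md (io y - io x).

Definition gcont f (x : T) := forall e : R, 0 < e ->
  exists2 s : R, 0 < s & forall y, md (io y - io x) < s -> md (f y - f x) < e.

Lemma gder_lip f x d : gder f x d -> exists2 s : R, 0 < s &
  forall y, md (io y - io x) < s ->
    md (f y - f x) <= (md d + 1) * md (io y - io x).
Proof.
move=> /(_ 1 ltr01)[s s0 H]; exists s => // y /H {}H.
have := mdD (f y - f x - d * (io y - io x)) (d * (io y - io x)).
by rewrite subrK mdM; move: H; lra.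
Qed.

Lemma gder_cont f x d : gder f x d -> gcont f x.
Proof.
move=> /gder_lip[s s0 H] e e0.
have d1 : 0 < md d + 1 by have := md_ge0 d; lra.
exists (Num.min s (e / (md d + 1))); first by rewrite lt_min s0 divr_gt0.
move=> y; rewrite lt_min => /andP[/H {}H]; rewrite ltr_pdivlMr// => ye.
by apply: le_lt_trans H _; rewrite mulrC.
Qed.

Lemma gder_cst c x : gder (fun=> c) x 0.
Proof. move=> e e0; exists 1 => // y _; rewrite subrr mul0r subr0 md0.
by rewrite mulr_ge0 ?md_ge0 ?ltW. Qed.

Lemma gder_id x : gder io x 1.
Proof. move=> e e0; exists 1 => // y _; rewrite mul1r subrr md0.
by rewrite mulr_ge0 ?md_ge0 ?ltW. Qed.

Lemma gder_eq f x d d' : d = d' -> gder f x d -> gder f x d'.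
Proof. by move=> ->. Qed.

Lemma gderD f g x a b : gder f x a -> gder g x b ->
  gder (fun y => f y + g y) x (a + b).
Proof.
move=> Hf Hg e e0; have e2 : 0 < e / 2 by rewrite divr_gt0.
have [s s0 Hs] := Hf _ e2; have [t t0 Ht] := Hg _ e2.
exists (Num.min s t); first by rewrite lt_min s0.
move=> y; rewrite lt_min => /andP[/Hs {}Hs /Ht {}Ht].
have := mdD (f y - f x - a * (io y - io x)) (g y - g x - b * (io y - io x)).
have -> : f y - f x - a * (io y - io x) + (g y - g x - b * (io y - io x)) =
  f y + g y - (f x + g x) - (a + b) * (io y - io x) by ring.
by move: Hs Ht; lra.
Qed.

Lemma gderZ f x a (c : C) : gder f x a -> gder (fun y => c * f y) x (c * a).
Proof.
move=> Hf e e0; have c1 : 0 < md c + 1 by have := md_ge0 c; lra.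
have [s s0 Hs] := Hf (e / (md c + 1)) (divr_gt0 e0 c1).
exists s => // y /Hs {}Hs.
rewrite -mulrA -!mulrBr mdM.
apply: le_trans (ler_wpM2l (md_ge0 c) Hs) _.
rewrite mulrA ler_wpM2r ?md_ge0// mulrA ler_pdivrMr// mulrC ler_wpM2l ?ltW//.
by lra.
Qed.

Lemma gderN f x a : gder f x a -> gder (fun y => - f y) x (- a).
Proof.
move=> /(gderZ (- 1)) H; move: H; rewrite mulN1r.
by under eq_fun do rewrite mulN1r.
Qed.

Lemma gderB f g x a b : gder f x a -> gder g x b ->
  gder (fun y => f y - g y) x (a - b).
Proof. by move=> Hf /gderN Hg; exact: gderD. Qed.

Lemma gder_near f g x a (s : R) : 0 < s ->
  (forall y, md (io y - io x) < s -> f y = g y) -> gder f x a -> gder g x a.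
Proof.
move=> s0 E Hf e e0; have [t t0 Ht] := Hf _ e0.
exists (Num.min s t); first by rewrite lt_min s0.
by move=> y; rewrite lt_min => /andP[ys /Ht]; rewrite !E// subrr md0.
Qed.

Lemma gcont_cst c x : gcont (fun=> c) x.
Proof. exact: gder_cont (gder_cst _ _). Qed.
Lemma gcont_id x : gcont io x.
Proof. exact: gder_cont (gder_id _). Qed.

Lemma gcontD f g x : gcont f x -> gcont g x -> gcont (fun y => f y + g y) x.
Proof.
move=> Hf Hg e e0; have e2 : 0 < e / 2 by rewrite divr_gt0.
have [s s0 Hs] := Hf _ e2; have [t t0 Ht] := Hg _ e2.
exists (Num.min s t); first by rewrite lt_min s0.
move=> y; rewrite lt_min => /andP[/Hs {}Hs /Ht {}Ht].
have := mdD (f y - f x) (g y - g x).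
have -> : f y - f x + (g y - g x) = f y + g y - (f x + g x) by ring.
by move: Hs Ht; lra.
Qed.

Lemma gcontN f x : gcont f x -> gcont (fun y => - f y) x.
Proof. move=> H e /H[s s0 Hs]; exists s => // y /Hs.
by rewrite -opprD mdN. Qed.

Lemma gcontM f g x : gcont f x -> gcont g x -> gcont (fun y => f y * g y) x.
Proof.
move=> Hf Hg e e0.
set A := md (f x) + 1; set B := md (g x) + 1.
have A0 : 0 < A by rewrite /A; have := md_ge0 (f x); lra.
have B0 : 0 < B by rewrite /B; have := md_ge0 (g x); lra.
have [s s0 Hs] := Hf (e / 2 / B) (divr_gt0 (divr_gt0 e0 (ltr0n _ 2)) B0).
have [|t t0 Ht] := Hg (Num.min 1 (e / 2 / A)).
  by rewrite lt_min ltr01 !divr_gt0.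
exists (Num.min s t); first by rewrite lt_min s0.
move=> y; rewrite lt_min => /andP[/Hs {}Hs /Ht]; rewrite lt_min => /andP[Ht1 Ht2].
rewrite (_ : _ - _ = (f y - f x) * g y + f x * (g y - g x)); last by ring.
apply: le_lt_trans (mdD _ _) _; rewrite !mdM.
have gy : md (g y) < B by have := mdD (g y - g x) (g x); rewrite subrK /B; lra.
have h1 : md (f y - f x) * md (g y) <= e / 2.
  by rewrite -(divfK (lt0r_neq0 B0) (e / 2)) ler_pM ?md_ge0 ?ltW.
have h2 : md (f x) * md (g y - g x) < e / 2.
  apply: (@le_lt_trans _ _ (A * md (g y - g x))).
    by rewrite ler_wpM2r ?md_ge0// /A; lra.
  by rewrite mulrC -ltr_pdivlMr.
by lra.
Qed.

Lemma gderM f g x a b : gder f x a -> gder g x b ->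
  gder (fun y => f y * g y) x (a * g x + f x * b).
Proof.
move=> Hf Hg.
have aux (u v : T -> C) c : gcont v x ->
    (forall e, 0 < e -> exists2 s : R, 0 < s & forall y, md (io y - io x) < s ->
      md (u y) <= e * md (io y - io x)) ->
    forall e, 0 < e -> exists2 s : R, 0 < s & forall y, md (io y - io x) < s ->
      md (c * u y) <= e * md (io y - io x).
  move=> _ Hu e e0; have c1 : 0 < md c + 1 by have := md_ge0 c; lra.
  have [s s0 Hs] := Hu (e / (md c + 1)) (divr_gt0 e0 c1).
  exists s => // y /Hs {}Hs; rewrite mdM.
  apply: le_trans (ler_wpM2l (md_ge0 c) Hs) _.
  rewrite mulrA ler_wpM2r ?md_ge0// mulrA ler_pdivrMr// mulrC ler_wpM2l ?ltW//.
  by lra.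
move=> e e0; have e3 : 0 < e / 3 by rewrite divr_gt0.
have [s s0 Hs] := aux _ g (g x) (gder_cont Hg) Hf _ e3.
have [t t0 Ht] := aux _ g (f x) (gder_cont Hg) Hg _ e3.
have [w w0 Hw] := gder_lip Hf.
have D0 : 0 < md a + 1 by have := md_ge0 a; lra.
have [u u0 Hu] := gder_cont Hg (divr_gt0 e3 D0).
exists (Num.min (Num.min s t) (Num.min w u)).
  by rewrite !lt_min s0 t0 w0.
move=> y; rewrite !lt_min => /andP[/andP[/Hs {}Hs /Ht {}Ht] /andP[/Hw {}Hw /Hu]].
rewrite ltr_pdivlMr// => {}Hu.
rewrite (_ : _ - _ = g x * (f y - f x - a * (io y - io x)) +
  f x * (g y - g x - b * (io y - io x)) + (f y - f x) * (g y - g x)); last by ring.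
apply: le_trans (mdD _ _) _; apply: le_trans (lerD (mdD _ _) (lexx _)) _.
have : md ((f y - f x) * (g y - g x)) <= e / 3 * md (io y - io x).
  rewrite mdM; apply: le_trans (ler_wpM2r (md_ge0 _) Hw) _.
  rewrite mulrAC ler_wpM2r ?md_ge0//; lra.
by move: Hs Ht; lra.
Qed.

Lemma gderX f x a n : gder f x a ->
  gder (fun y => f y ^+ n) x (n%:R * f x ^+ n.-1 * a).
Proof.
move=> Hf; elim: n => [|n IH].
  by under eq_fun do rewrite expr0; rewrite !mul0r; exact: gder_cst.
under eq_fun do rewrite exprS.
apply: gder_eq (gderM Hf IH); case: n {IH} => [|n] /=.
  by rewrite expr0 !mul0r mulr0 addr0 mulr1 !mul1r.
by rewrite exprS -(natr1 n.+1); ring.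
Qed.

Lemma gcontB f g x : gcont f x -> gcont g x -> gcont (fun y => f y - g y) x.
Proof. by move=> Hf /gcontN; exact: gcontD. Qed.

Lemma gcontV f x : f x != 0 -> gcont f x -> gcont (fun y => (f y)^-1) x.
Proof.
move=> fx0 Hf e e0; have m0 : 0 < md (f x) by rewrite md_gt0.
have [|s s0 Hs] := Hf (Num.min (md (f x) / 2) (e * (md (f x) * (md (f x) / 2)))).
  by rewrite lt_min !mulr_gt0 ?divr_gt0.
exists s => // y /Hs; rewrite lt_min => /andP[h1 h2].
have h3 : md (f x) / 2 < md (f y).
  by have := md_lB (f x) (f y); rewrite mdBC; lra.
have fy0 : f y != 0 by rewrite -md_gt0; lra.
have -> : (f y)^-1 - (f x)^-1 = (f x - f y) / (f x * f y).
  by field; rewrite fx0 fy0.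
rewrite mdM mdV mdM ltr_pdivrMr ?mulr_gt0 ?md_gt0// mdBC.
apply: lt_le_trans h2 _; rewrite ler_wpM2l ?(ltW e0)// ler_wpM2l ?md_ge0//.
exact: ltW.
Qed.

Lemma gderV f x a : f x != 0 -> gder f x a ->
  gder (fun y => (f y)^-1) x (- a / (f x) ^+ 2).
Proof.
move=> fx0 Hf e e0.
have Hc := gder_cont Hf.
have m0 : 0 < md (f x) by rewrite md_gt0.
have [w w0 Hw] := gder_lip Hf.
have D0 : 0 < md a + 1 by have := md_ge0 a; lra.
have e2 : 0 < e / 2 by rewrite divr_gt0.
have [s s0 Hs] := gcontV fx0 Hc
  (divr_gt0 (mulr_gt0 e2 m0) D0).
have [t t0 Ht] := Hf (e / 2 * md (f x) ^+ 2) (mulr_gt0 e2 (exprn_gt0 _ m0)).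
have [u u0 Hu] := Hc _ m0.
exists (Num.min (Num.min s t) (Num.min w u)).
  by rewrite !lt_min s0 t0 w0.
move=> y; rewrite !lt_min => /andP[/andP[/Hs {}Hs /Ht {}Ht] /andP[/Hw {}Hw /Hu {}Hu]].
have fy0 : f y != 0.
  by rewrite -md_gt0; have := md_lB (f x) (f y); rewrite mdBC; lra.
have -> : (f y)^-1 - (f x)^-1 - - a / f x ^+ 2 * (io y - io x) =
  - (f y - f x - a * (io y - io x)) / (f x) ^+ 2
  - (f y - f x) * ((f y)^-1 - (f x)^-1) / f x.
  by field; rewrite fx0 fy0.
apply: le_trans (mdB _ _) _; rewrite !mdM !mdV mdN mdX.
have h1 : md (f y - f x - a * (io y - io x)) / md (f x) ^+ 2 <=
    e / 2 * md (io y - io x).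
  by rewrite ler_pdivrMr ?exprn_gt0// mulrAC.
have h2 : md (f y - f x) * md ((f y)^-1 - (f x)^-1) / md (f x) <=
    e / 2 * md (io y - io x).
  rewrite ler_pdivrMr//; apply: le_trans (ler_wpM2r (md_ge0 _) Hw) _.
  move: Hs; rewrite ltr_pdivlMr// => Hs; rewrite mulrAC.
  rewrite [leRHS]mulrAC ler_wpM2r ?md_ge0//.
  by rewrite mulrC; exact: ltW.
by rewrite (splitr e) mulrDl lerD.
Qed.

Lemma gder_uniq f x a b :
  (forall s : R, 0 < s -> exists2 y, io y != io x & md (io y - io x) < s) ->
  gder f x a -> gder f x b -> a = b.
Proof.
move=> acc Ha Hb; apply/eqP; rewrite -subr_eq0 -md_eq0.
have [//|] := eqVneq (md (a - b)) 0; rewrite md_eq0 -md_gt0 => m0.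
have m3 : 0 < md (a - b) / 3 by rewrite divr_gt0.
have [s s0 Hs] := Ha _ m3; have [t t0 Ht] := Hb _ m3.
have [|y yx] := acc (Num.min s t); first by rewrite lt_min s0.
rewrite lt_min => /andP[/Hs {}Hs /Ht {}Ht].
have y0 : 0 < md (io y - io x) by rewrite md_gt0 subr_eq0.
have := mdB (f y - f x - b * (io y - io x)) (f y - f x - a * (io y - io x)).
rewrite (_ : _ - _ - _ = (a - b) * (io y - io x)); last by ring.
rewrite mdM.
have : md (a - b) * md (io y - io x) > 0 by rewrite mulr_gt0.
by move: Hs Ht; lra.
Qed.

End generic.

Definition cder (f : C -> C) := gder id f.
Definition rder (f : R -> C) := gder (real_complex R) f.
Definition ccont (f : C -> C) := gcont id f.
Definition rcont (f : R -> C) := gcont (real_complex R) f.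

Lemma gder_comp (T : Type) (io : T -> C) (g : T -> C) (f : C -> C) x a b :
  gder io g x a -> cder f (g x) b -> gder io (fun y => f (g y)) x (b * a).
Proof.
move=> Hg Hf e e0.
have [w w0 Hw] := gder_lip Hg.
have D0 : 0 < md a + 1 by have := md_ge0 a; lra.
have B0 : 0 < md b + 1 by have := md_ge0 b; lra.
have e2 : 0 < e / 2 by rewrite divr_gt0.
have [s s0 Hs] := Hf _ (divr_gt0 e2 D0).
have [t t0 Ht] := Hg _ (divr_gt0 e2 B0).
have [u u0 Hu] := gder_cont Hg s0.
exists (Num.min t (Num.min w u)); first by rewrite !lt_min w0 t0.
move=> y; rewrite !lt_min => /andP[/Ht {}Ht /andP[/Hw {}Hw /Hu /Hs {}Hs]].
rewrite (_ : _ - _ = (f (g y) - f (g x) - b * (g y - g x)) +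
  b * (g y - g x - a * (io y - io x))); last by ring.
apply: le_trans (mdD _ _) _; rewrite mdM (splitr e) mulrDl lerD//.
  apply: le_trans Hs _.
  have := ler_wpM2l (ltW (divr_gt0 e2 D0)) Hw.
  by rewrite [X in _ <= X -> _]mulrA divfK ?lt0r_neq0.
apply: le_trans (ler_wpM2l (md_ge0 b) Ht) _.
rewrite mulrA ler_wpM2r ?md_ge0// mulrA ler_pdivrMr// mulrC.
by rewrite ler_wpM2l ?(ltW e2)//; lra.
Qed.

Lemma gcont_comp (T : Type) (io : T -> C) (g : T -> C) (f : C -> C) x :
  gcont io g x -> ccont f (g x) -> gcont io (fun y => f (g y)) x.
Proof.
move=> Hg Hf e /Hf[s s0 Hs]; have [t t0 Ht] := Hg _ s0.
by exists t => // y /Ht/Hs.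
Qed.

Lemma cder_uniq f x a b : cder f x a -> cder f x b -> a = b.
Proof.
apply: gder_uniq => s s0; exists (x + (s / 2)%:C%C).
  rewrite -subr_eq0 addrC addKr -md_eq0 mdR normr_eq0.
  by rewrite mulf_neq0 ?invr_eq0 ?lt0r_neq0.
by rewrite [x + _]addrC addrK mdR ger0_norm ?divr_ge0 ?ltW//; lra.
Qed.

Lemma cderP (f : R[i]^o -> R[i]^o) (x d : R[i]^o) :
  is_derive x 1 f d <-> cder f x d.
Proof.
rewrite is_derive_epsP; split=> H e e0.
  have /near_md[s s0 Hs] := H e%:C%C (ltac:(by rewrite ltcR)).
  by exists s => // y /Hs; rewrite !md_norm -rmorphM lecR.
have er : complex.Re e%R > 0 by move: e0; rewrite ltcE => /andP[].
have [s s0 Hs] := H _ er.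
have ec : (complex.Re e)%:C%C = e by apply: RRe_real; exact: gtr0_real.
apply/near_md; exists s => // y /Hs; rewrite -lecR !md_norm.
by rewrite -{2}ec -rmorphM.
Qed.

Lemma near_R (t : R) (P : R -> Prop) :
  (\forall u \near t, P u) <->
  exists2 s : R, 0 < s & forall u, `|u - t| < s -> P u.
Proof.
split=> [/(@nbhs_normP R R^o)[s s0 H]|[s s0 H]].
  by exists s => // u us; apply: H; rewrite /= distrC.
apply/(@nbhs_normP R R^o); exists s => //= u; rewrite /ball_/= distrC; exact: H.
Qed.

Lemma rderP (f : R -> C) (t : R) (d : C) : rder f t d <->
  is_derive t 1 (fun u => complex.Re (f u)) (complex.Re d) /\
  is_derive t 1 (fun u => complex.Im (f u)) (complex.Im d).
Proof.
have E u : (f u - f t - d * (u%:C%C - t%:C%C)) =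
  ((complex.Re (f u) - complex.Re (f t) - complex.Re d * (u - t)) +i*
  (complex.Im (f u) - complex.Im (f t) - complex.Im d * (u - t)))%C.
  by case: (f u) (f t) d => [a b] [a' b'] [p q]; simpc.
split=> [H|[/is_derive_epsP Hr /is_derive_epsP Hi] e e0].
  split; apply/is_derive_epsP => e e0; have [s s0 Hs] := H _ e0;
  apply/near_R; exists s => // u us; move: (Hs u);
  rewrite -rmorphB mdR => /(_ us); rewrite rmorphB E; apply: le_trans.
    exact: (@Re_md R (_ +i* _)%C).
  exact: (@Im_md R (_ +i* _)%C).
have e2 : 0 < e / 2 by rewrite divr_gt0.
have /near_R[s s0 Hs] := Hr _ e2; have /near_R[w w0 Hw] := Hi _ e2.
exists (Num.min s w); first by rewrite lt_min s0.
move=> u; rewrite -rmorphB mdR lt_min => /andP[/Hs {}Hs /Hw {}Hw].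
rewrite rmorphB E; apply: le_trans (md_ReIm _) _ => /=.
by move: Hs Hw; lra.
Qed.

Lemma rcontP (f : R -> C) : (forall t, rcont f t) <->
  continuous (fun u => complex.Re (f u)) /\
  continuous (fun u => complex.Im (f u)).
Proof.
split=> [H|[Hr Hi] t e e0].
  have HR (P : C -> R) : (forall x, `|P x| <= md x) ->
      (forall x y, P (x - y) = P x - P y) -> continuous (fun u => P (f u)).
    move=> Hb HB t; apply/cvgrPdist_lt => e /(H t)[s s0 Hs].
    apply/near_R; exists s => // u us; rewrite distrC -HB.
    apply: le_lt_trans (Hb _) _; apply: Hs.
    by rewrite -rmorphB mdR.
  split; apply: HR; [exact: Re_md|by case=> ? ? []|exact: Im_md|by case=> ? ? []].
have e2 : 0 < e / 2 by rewrite divr_gt0.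
have /cvgrPdist_lt/(_ _ e2)/near_R[s s0 Hs] := Hr t.
have /cvgrPdist_lt/(_ _ e2)/near_R[w w0 Hw] := Hi t.
exists (Num.min s w); first by rewrite lt_min s0.
move=> u; rewrite -rmorphB mdR lt_min => /andP[/Hs {}Hs /Hw {}Hw].
apply: le_lt_trans (md_ReIm _) _.
move: Hs Hw; rewrite distrC => h1; rewrite distrC => h2.
by case: (f u) (f t) h1 h2 => [a b] [a' b'] /=; lra.
Qed.

End gder.

(** * Integration along segments *)

Section integral.
Variable R : realType.
Local Notation C := R[i].
Implicit Types (F G : R -> C) (f g : C -> C).

Lemma mdJ (z : C) : md z^*%C = md z.
Proof. by case: z => a b; rewrite /md /= sqrrN. Qed.

Lemma Re_conjM (z : C) : complex.Re (z^*%C * z) = md z ^+ 2.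
Proof.
case: z => a b; rewrite /md /= sqr_sqrtr ?addr_ge0 ?sqr_ge0//.
by rewrite mulNr opprK -!expr2.
Qed.

(** Projecting on the direction of [G 1 - G 0] reduces the bound to the mean value theorem for a
    real function: the increment of [phi] is the square of the modulus to be bounded. *)
Lemma mean_value_le F G (M : R) :
  (forall t : R, 0 <= t <= 1 -> rder G t (F t)) ->
  (forall t : R, 0 <= t <= 1 -> md (F t) <= M) -> md (G 1 - G 0) <= M.
Proof.
move=> HG HM; set d := G 1 - G 0.
pose phi (t : R) := complex.Re (d^*%C * G t).
pose psi (t : R) := complex.Re (d^*%C * F t).
have Hphi (t : R) : 0 <= t <= 1 -> is_derive t 1 phi (psi t).
  by move=> /HG/(gderZ d^*%C)/rderP[].
have [|||c] := @MVT R phi psi 0 1.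
- exact: ltr01.
- by move=> x; rewrite in_itv => /= /andP[/ltW ? /ltW ?]; apply: Hphi; lra.
- apply: derivable_within_continuous => x; rewrite in_itv /= => xI.
  by have [] := Hphi _ xI.
rewrite in_itv subr0 mulr1 => /= /andP[/ltW c0 /ltW c1].
have -> : phi 1 - phi 0 = md d ^+ 2.
  rewrite -Re_conjM /phi {3}/d mulrBr.
  by case: (d^*%C * G 1) (d^*%C * G 0) => ? ? [].
have [->|d0] := eqVneq (md d) 0.
  by move=> _; apply: le_trans (md_ge0 (F c)) (HM _ _); rewrite c0.
have dp : 0 < md d by rewrite lt_def d0 md_ge0.
move=> E; rewrite -(ler_pM2l dp) -expr2 E.
apply: le_trans (ler_norm _) _; apply: le_trans (Re_md _) _.
by rewrite mdM mdJ ler_wpM2l ?HM ?md_ge0// c0.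
Qed.

Lemma rder_const_eq G : (forall t : R, 0 <= t <= 1 -> rder G t 0) -> G 1 = G 0.
Proof.
move=> H; apply/eqP; rewrite -subr_eq0 -md_eq0 eq_le md_ge0 andbT.
by apply: (mean_value_le H) => t _; rewrite md0.
Qed.

Lemma real_primitive (f : R -> R) : continuous f ->
  exists g : R -> R, forall t : R, 0 <= t <= 1 -> is_derive t 1 g (f t).
Proof.
move=> cf; exists (fun x => \int[lebesgue_measure]_(t in `[-1, x]) f t) => t tI.
have cw : {within `[(-1 : R), 2], continuous f} by exact: continuous_subspaceT.
have [||||D E] := @continuous_FTC1_closed R f (-1) t 2.
- by lra.
- exact: (continuous_compact_integrable (@segment_compact _ _ _) cw).
- by lra.
- exact: cf.
by split => //; rewrite -derive1E.
Qed.

Lemma rcont_primitive F : (forall t, rcont F t) ->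
  exists G, forall t : R, 0 <= t <= 1 -> rder G t (F t).
Proof.
move=> /rcontP[/real_primitive[a Ha] /real_primitive[b Hb]].
exists (fun t => (a t +i* b t)%C) => t t01.
by apply/rderP; split; [exact: Ha | exact: Hb].
Qed.

(** The integral over [0, 1], as the increment of a chosen primitive: by [rder_const_eq] the choice
    is immaterial, and without a primitive the value is 0. *)
Definition intI F : C :=
  let G := xget (fun=> 0) [set G | forall t : R, 0 <= t <= 1 -> rder G t (F t)] in
  G 1 - G 0.

Lemma intI_eq F G : (forall t : R, 0 <= t <= 1 -> rder G t (F t)) ->
  intI F = G 1 - G 0.
Proof.
move=> HG; rewrite /intI; case: xgetP => [G' _ HG'|/(_ G) //].
apply/eqP; rewrite -subr_eq0; apply/eqP.
rewrite (_ : _ - _ = (G' 1 - G 1) - (G' 0 - G 0)); last by ring.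
apply/eqP; rewrite subr_eq0; apply/eqP.
apply: (@rder_const_eq (fun t => G' t - G t)) => t t01.
by apply: gder_eq (gderB (HG' _ t01) (HG _ t01)); rewrite subrr.
Qed.

Lemma intI_bound F M : (forall t, rcont F t) ->
  (forall t : R, 0 <= t <= 1 -> md (F t) <= M) -> md (intI F) <= M.
Proof.
by move=> /rcont_primitive[G HG] HM; rewrite (intI_eq HG) (mean_value_le HG).
Qed.

Lemma eq_intI F F' : (forall t, rcont F t) ->
  (forall t : R, 0 <= t <= 1 -> F t = F' t) -> intI F = intI F'.
Proof.
move=> /rcont_primitive[G HG] E; rewrite (intI_eq HG) (@intI_eq F' G)// => t t01.
by rewrite -E//; exact: HG.
Qed.

Lemma intID F F' : (forall t, rcont F t) -> (forall t, rcont F' t) ->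
  intI (fun t => F t + F' t) = intI F + intI F'.
Proof.
move=> /rcont_primitive[G HG] /rcont_primitive[G' HG'].
rewrite (intI_eq HG) (intI_eq HG') (@intI_eq _ (fun t => G t + G' t)).
  by ring.
by move=> t t01; exact: gderD (HG _ t01) (HG' _ t01).
Qed.

Lemma intIZ F c : (forall t, rcont F t) -> intI (fun t => c * F t) = c * intI F.
Proof.
move=> /rcont_primitive[G HG].
rewrite (intI_eq HG) (@intI_eq _ (fun t => c * G t)); first by ring.
by move=> t t01; exact: gderZ (HG _ t01).
Qed.

Lemma intIB F F' : (forall t, rcont F t) -> (forall t, rcont F' t) ->
  intI (fun t => F t - F' t) = intI F - intI F'.
Proof.
move=> /rcont_primitive[G HG] /rcont_primitive[G' HG'].
rewrite (intI_eq HG) (intI_eq HG') (@intI_eq _ (fun t => G t - G' t)).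
  by ring.
by move=> t t01; exact: gderB (HG _ t01) (HG' _ t01).
Qed.

Lemma intI_cst c : intI (fun=> c) = c.
Proof.
rewrite (@intI_eq _ (fun t => c * t%:C%C)); first by rewrite mulr0 mulr1 subr0.
by move=> t _; apply: gder_eq (gderZ c (gder_id _ _)); rewrite mulr1.
Qed.

Lemma rder_affine G (s c t : R) d : rder G (s * t + c) d ->
  rder (fun u => G (s * u + c)) t (s%:C%C * d).
Proof.
move=> HG e e0; have s1 : 0 < `|s| + 1 by have := normr_ge0 s; lra.
have [w w0 Hw] := HG _ (divr_gt0 e0 s1).
exists (w / (`|s| + 1)); first by rewrite divr_gt0.
move=> u; rewrite -rmorphB mdR ltr_pdivlMr// => us.
have E : (s * u + c)%:C%C - (s * t + c)%:C%C = s%:C%C * (u - t)%:C%C.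
  by rewrite -rmorphB -rmorphM; congr (_%:C%C); ring.
have hle : `|s| * `|u - t| <= `|u - t| * (`|s| + 1).
  by rewrite mulrDr mulr1 mulrC lerDl.
have := Hw (s * u + c); rewrite E mdM !mdR => /(_ (le_lt_trans hle us)).
rewrite mulrA [d * _]mulrC => /le_trans; apply.
by rewrite -mulrA ler_wpM2l ?(ltW e0)// ler_pdivrMl// [leRHS]mulrC.
Qed.

(** The retraction of the line onto [0, 1]: composing with it extends a continuous function on
    [0, 1] to one that is continuous on the whole line. *)
Definition clamp (t : R) : R := Num.max 0 (Num.min t 1).

Lemma clamp01 t : 0 <= clamp t <= 1.
Proof.
rewrite /clamp le_max lexx /= ge_max ler01 /=.
by rewrite ge_min lexx orbT.
Qed.

Lemma clamp_id t : 0 <= t <= 1 -> clamp t = t.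
Proof. by move=> /andP[t0 t1]; rewrite /clamp (min_idPl t1) (max_idPr t0). Qed.

Lemma clamp_cont t : rcont (fun u => (clamp u)%:C%C) t.
Proof.
move=> e e0; exists e => // u; rewrite -!rmorphB !mdR.
apply: le_lt_trans; rewrite /clamp /Num.max /Num.min ler_norml.
have [h|h] := lerP 0 (u - t); [rewrite (ger0_norm h)|rewrite (ltr0_norm h)];
by case: (ltP u 1) => ?; case: (ltP t 1) => ?; (do 2 case: ltP => ?);
  apply/andP; split; lra.
Qed.

Definition lint (a b : C) (t : R) : C := a + t%:C%C * (b - a).

(** The integral of f(z) dz along the segment from [a] to [b]. *)
Definition sg f (a b : C) : C :=
  (b - a) * intI (fun t => f (lint a b (clamp t))).

Lemma lint_der a b t : rder (lint a b) t (b - a).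
Proof.
apply: (@gder_eq _ _ _ _ _ (0 + (1 * (b - a) + t%:C%C * 0))).
  by rewrite mul1r mulr0 addr0 add0r.
apply: gderD; first exact: gder_cst.
by apply: gderM; [exact: gder_id | exact: gder_cst].
Qed.

Definition contseg f a b := forall t : R, 0 <= t <= 1 -> ccont f (lint a b t).

Lemma contseg_cont f a b : contseg f a b ->
  forall t, rcont (fun t => f (lint a b (clamp t))) t.
Proof.
move=> H t; apply: (@gcont_comp _ _ _ (fun t => lint a b (clamp t))).
  apply: gcontD; first exact: gcont_cst.
  by apply: gcontM; [exact: clamp_cont | exact: gcont_cst].
by apply: H; exact: clamp01.
Qed.

Lemma sg_bound f a b M : contseg f a b ->
  (forall t : R, 0 <= t <= 1 -> md (f (lint a b t)) <= M) ->
  md (sg f a b) <= M * md (b - a).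
Proof.
move=> H HM; rewrite /sg mdM mulrC ler_wpM2r ?md_ge0// intI_bound//.
  exact: contseg_cont.
by move=> t t01; rewrite clamp_id// HM.
Qed.

Lemma lint_rev a b t : lint b a (1 - t) = lint a b t.
Proof. by rewrite /lint rmorphB rmorph1; ring. Qed.

Lemma sg_prim f P a b : (forall t : R, 0 <= t <= 1 -> cder P (lint a b t) (f (lint a b t))) ->
  sg f a b = P b - P a.
Proof.
move=> H; have [->|ab] := eqVneq b a; first by rewrite /sg !subrr mul0r.
have ba0 : b - a != 0 by rewrite subr_eq0.
rewrite /sg (@intI_eq _ (fun t => (b - a)^-1 * P (lint a b t))).
  rewrite -mulrBr mulVKf// /lint rmorph1 rmorph0 mul1r mul0r addr0.
  by rewrite [a + _]addrC subrK.
move=> t t01; rewrite clamp_id//.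
apply: gder_eq (gderZ _ (gder_comp (lint_der a b t) (H _ t01))).
by rewrite mulrC mulfK.
Qed.

Lemma sg_primitive f a b : contseg f a b -> exists G : R -> C,
  (forall t : R, 0 <= t <= 1 -> rder G t (f (lint a b t))) /\
  sg f a b = (b - a) * (G 1 - G 0).
Proof.
move=> /contseg_cont/rcont_primitive[G HG]; exists G; split => [t t01|].
  by have := HG _ t01; rewrite clamp_id.
by rewrite /sg (intI_eq HG).
Qed.

Lemma sg_rev f a b : contseg f a b -> sg f b a = - sg f a b.
Proof.
move=> /sg_primitive[G [HG ->]].
rewrite /sg (@intI_eq _ (fun t => - G (-1 * t + 1))).
  by rewrite mulr1 mulr0 add0r addNr; ring.
move=> t t01; rewrite clamp_id//.
have t01' : 0 <= -1 * t + 1 <= 1 by lra.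
have := HG _ t01'; rewrite -lint_rev.
have -> : 1 - (-1 * t + 1) = t by ring.
move=> h; apply: gder_eq (gderN (rder_affine h)).
by rewrite rmorphN rmorph1 mulN1r opprK.
Qed.

Lemma conv01 (s s' t : R) : 0 <= s <= 1 -> 0 <= s' <= 1 -> 0 <= t <= 1 ->
  0 <= (s' - s) * t + s <= 1.
Proof.
move=> /andP[s0 s1] /andP[s'0 s'1] /andP[t0 t1].
have -> : (s' - s) * t + s = s * (1 - t) + s' * t by ring.
have h1 : s * (1 - t) <= 1 * (1 - t) by rewrite ler_wpM2r// subr_ge0.
have h2 : s' * t <= 1 * t by rewrite ler_wpM2r.
have h3 : 0 <= s * (1 - t) by rewrite mulr_ge0// subr_ge0.
have h4 : 0 <= s' * t by rewrite mulr_ge0.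
by apply/andP; split; lra.
Qed.

Lemma contseg_sub f a b s s' : 0 <= s <= 1 -> 0 <= s' <= 1 -> contseg f a b ->
  contseg f (lint a b s) (lint a b s').
Proof.
move=> s01 s01' H t t01.
have -> : lint (lint a b s) (lint a b s') t = lint a b ((s' - s) * t + s).
  by rewrite /lint !rmorphD !rmorphM rmorphB; ring.
by apply: H; exact: conv01.
Qed.

Lemma sg_sub f a b s s' : 0 <= s <= 1 -> 0 <= s' <= 1 -> contseg f a b ->
  forall G : R -> C, (forall t : R, 0 <= t <= 1 -> rder G t (f (lint a b t))) ->
  sg f (lint a b s) (lint a b s') = (b - a) * (G s' - G s).
Proof.
move=> s01 s01' H G HG.
rewrite /sg; have -> : lint a b s' - lint a b s = (b - a) * (s' - s)%:C%C.
  by rewrite /lint rmorphB; ring.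
rewrite -mulrA; congr (_ * _).
rewrite -intIZ; last exact: (contseg_cont (contseg_sub _ _ H)).
rewrite (@intI_eq _ (fun t => G ((s' - s) * t + s))).
  by rewrite mulr1 mulr0 add0r subrK.
move=> t t01; rewrite clamp_id//.
have -> : lint (lint a b s) (lint a b s') t = lint a b ((s' - s) * t + s).
  by rewrite /lint !rmorphD !rmorphM rmorphB; ring.
by apply: rder_affine; apply: HG; exact: conv01.
Qed.

Lemma lint0 a b : lint a b 0 = a.
Proof. by rewrite /lint rmorph0 mul0r addr0. Qed.
Lemma lint1 a b : lint a b 1 = b.
Proof. by rewrite /lint rmorph1 mul1r addrC subrK. Qed.

Lemma sg_split f a b s : 0 <= s <= 1 -> contseg f a b ->
  sg f a b = sg f a (lint a b s) + sg f (lint a b s) b.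
Proof.
move=> s01 H; have [G [HG ->]] := sg_primitive H.
have h0 : (0 : R) <= 0 <= (1 : R) by rewrite lexx ler01.
have h1 : (0 : R) <= 1 <= (1 : R) by rewrite lexx ler01.
have := sg_sub h0 s01 H HG; rewrite lint0 => ->.
have := sg_sub s01 h1 H HG; rewrite lint1 => ->.
by ring.
Qed.

Lemma sgB f g a b : contseg f a b -> contseg g a b ->
  sg (fun z => f z - g z) a b = sg f a b - sg g a b.
Proof.
by move=> Hf Hg; rewrite /sg intIB ?mulrBr//; exact: contseg_cont.
Qed.

(** With B = K / (1 - q), the intervals of radius B q^n around [u n] are nested, and [l] is the
    supremum of their left ends. *)
Lemma geometric_real (u : nat -> R) (K q : R) : 0 <= q < 1 ->
  (forall n, `|u n.+1 - u n| <= K * q ^+ n) ->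
  exists l, forall n, `|u n - l| <= K / (1 - q) * q ^+ n.
Proof.
move=> /andP[q0 q1] H; set B := K / (1 - q).
have BE : B = K + B * q by rewrite /B; field; lra.
have up n : u n.+1 + B * q ^+ n.+1 <= u n + B * q ^+ n.
  have := H n; rewrite ler_norml => /andP[_].
  by rewrite {2}BE exprS; lra.
have dn n : u n - B * q ^+ n <= u n.+1 - B * q ^+ n.+1.
  have := H n; rewrite ler_norml => /andP[+ _].
  by rewrite {1}BE exprS; lra.
have upm m n : (m <= n)%N -> u n + B * q ^+ n <= u m + B * q ^+ m.
  elim: n => [|n IH]; first by rewrite leqn0 => /eqP->.
  by rewrite leq_eqVlt => /orP[/eqP->//|/IH]; exact/le_trans/up.
have dnm m n : (m <= n)%N -> u m - B * q ^+ m <= u n - B * q ^+ n.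
  elim: n => [|n IH]; first by rewrite leqn0 => /eqP->.
  by rewrite leq_eqVlt => /orP[/eqP->//|/IH h]; exact/(le_trans h)/dn.
have K0 : 0 <= K by have := H 0%N; rewrite expr0 mulr1; apply: le_trans.
have B0 n : 0 <= B * q ^+ n.
  by rewrite mulr_ge0 ?exprn_ge0// divr_ge0//; lra.
have cross m n : u m - B * q ^+ m <= u n + B * q ^+ n.
  have := dnm m (maxn m n) (leq_maxl _ _).
  have := upm n (maxn m n) (leq_maxr _ _).
  by have := B0 (maxn m n); lra.
pose E := [set u m - B * q ^+ m | m in [set: nat]].
have Esup : has_sup E.
  split; first by exists (u 0%N - B * q ^+ 0), 0%N.
  by exists (u 0%N + B * q ^+ 0) => _ [m _ <-].
exists (sup E) => n.
rewrite ler_norml; apply/andP; split.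
  have : sup E <= u n + B * q ^+ n.
    by apply: sup_le_ub => [|_ [m _ <-]//]; case: Esup.
  by lra.
have : u n - B * q ^+ n <= sup E by apply: sup_upper_bound => //; exists n.
by lra.
Qed.

Lemma geometric_complex (u : nat -> C) (K q : R) : 0 <= q < 1 ->
  (forall n, md (u n.+1 - u n) <= K * q ^+ n) ->
  exists l, forall n, md (u n - l) <= 2 * (K / (1 - q)) * q ^+ n.
Proof.
move=> q01 H.
have [|a Ha] := @geometric_real (fun n => complex.Re (u n)) K q q01.
  move=> n; apply: le_trans (H n).
  by have := Re_md (u n.+1 - u n); case: (u n.+1) (u n) => ? ? [].
have [|b Hb] := @geometric_real (fun n => complex.Im (u n)) K q q01.
  move=> n; apply: le_trans (H n).
  by have := Im_md (u n.+1 - u n); case: (u n.+1) (u n) => ? ? [].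
exists (a +i* b)%C => n; apply: le_trans (md_ReIm _) _.
have := Ha n; have := Hb n; case: (u n) => x y /=; lra.
Qed.

Lemma small_geometric (K q e : R) : 0 <= q < 1 -> 0 < e ->
  exists n, K * q ^+ n < e.
Proof.
move=> /andP[q0 q1] e0; have K1 : 0 < `|K| + 1 by have := normr_ge0 K; lra.
have := @cvg_geometric R 1 q; rewrite ger0_norm//.
move=> /(_ q1)/cvgrPdist_lt/(_ (e / (`|K| + 1)) (divr_gt0 e0 K1)).
case=> n _ /(_ n (leqnn n)); rewrite sub0r normrN /geometric /= mul1r.
rewrite ger0_norm ?exprn_ge0// ltr_pdivlMr// => h; exists n; apply: le_lt_trans h.
by rewrite mulrC ler_wpM2l ?exprn_ge0//; have := ler_norm K; lra.
Qed.

End integral.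

(** * Goursat's theorem *)

Section cauchy.
Variable R : realType.
Local Notation C := R[i].
Implicit Types (f g P : C -> C) (D : C -> Prop).

Definition convexC D := forall a b (t : R), D a -> D b -> 0 <= t <= 1 ->
  D (lint a b t).
Definition closedC D := forall p,
  (forall e : R, 0 < e -> exists2 x, D x & md (x - p) < e) -> D p.

Definition tri f a b c := sg f a b + sg f b c + sg f c a.
Definition per (a b c : C) := md (b - a) + md (c - b) + md (a - c).

Lemma md_half (x : C) : md (x / 2) = md x / 2.
Proof.
rewrite mdM mdV; congr (_ / _).
by rewrite (_ : 2 = (2%:R : R)%:C%C) ?mdR ?ger0_norm// rmorph_nat.
Qed.

Lemma per_ge0 a b c : 0 <= per a b c.
Proof. by rewrite !addr_ge0 ?md_ge0. Qed.

Lemma half01 : (0 : R) <= 1 / 2 <= (1 : R). Proof. by lra. Qed.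

Lemma lint_half (a b : C) : lint a b (1 / 2) = (a + b) / 2.
Proof. by rewrite /lint rmorphM fmorphV rmorph1 rmorph_nat; field. Qed.

(** The inner edges of the subdivision at the midpoints are run through twice, in opposite
    directions. *)
Lemma tri_split f D a b c : convexC D -> (forall x, D x -> ccont f x) ->
  D a -> D b -> D c ->
  let m := (a + b) / 2 in let n := (b + c) / 2 in let k := (c + a) / 2 in
  tri f a b c = tri f a m k + tri f m b n + tri f n c k + tri f m n k.
Proof.
move=> cD cf Da Db Dc m n k.
have cs x y : D x -> D y -> contseg f x y by move=> Dx Dy t t01; apply/cf/cD.
have mD x y : D x -> D y -> D ((x + y) / 2).
  by move=> Dx Dy; rewrite -lint_half; exact: cD half01.
have [Dm Dn Dk] : [/\ D m, D n & D k] by split; exact: mD.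
have sp x y : D x -> D y -> sg f x y = sg f x ((x + y) / 2) + sg f ((x + y) / 2) y.
  by move=> Dx Dy; rewrite -lint_half; apply: sg_split half01 (cs _ _ Dx Dy).
rewrite /tri (sp a b)// (sp b c)// (sp c a)// -/m -/n -/k.
rewrite (sg_rev (cs k m Dk Dm)) (sg_rev (cs m n Dm Dn)) (sg_rev (cs n k Dn Dk)).
ring.
Qed.

Lemma tri_bound f a b c M :
  contseg f a b -> contseg f b c -> contseg f c a ->
  (forall t : R, 0 <= t <= 1 -> md (f (lint a b t)) <= M) ->
  (forall t : R, 0 <= t <= 1 -> md (f (lint b c t)) <= M) ->
  (forall t : R, 0 <= t <= 1 -> md (f (lint c a t)) <= M) ->
  md (tri f a b c) <= M * per a b c.
Proof.
move=> c1 c2 c3 h1 h2 h3; rewrite /tri /per !mulrDr.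
apply: le_trans (mdD _ _) _; apply: lerD; last exact: sg_bound.
by apply: le_trans (mdD _ _) _; apply: lerD; exact: sg_bound.
Qed.

Lemma lint_sub (a b : C) (t : R) : lint a b t - a = t%:C%C * (b - a).
Proof. by rewrite /lint addrC addKr. Qed.

Lemma md_lint_sub (a b : C) (t : R) : 0 <= t <= 1 -> md (lint a b t - a) <= md (b - a).
Proof.
move=> /andP[t0 t1]; rewrite lint_sub mdM mdR ger0_norm//.
by rewrite ler_piMl ?md_ge0.
Qed.

Lemma per_lint a b c (t : R) : 0 <= t <= 1 ->
  [/\ md (lint a b t - a) <= per a b c, md (lint b c t - a) <= per a b c &
      md (lint c a t - a) <= per a b c].
Proof.
move=> t01; have [p1 p2 p3] := And3 (md_ge0 (b - a)) (md_ge0 (c - b)) (md_ge0 (a - c)).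
split.
- by have := md_lint_sub a b t01; rewrite /per; lra.
- have := md_lint_sub b c t01; have := md_tri b (lint b c t) a.
  by rewrite /per; lra.
- have t01' : 0 <= 1 - t <= 1 by lra.
  rewrite -(lint_rev c a); have := md_lint_sub a c t01'.
  by rewrite (mdBC c a) /per; lra.
Qed.

Lemma tri_affine p u v a b c : tri (fun x => u + v * (x - p)) a b c = 0.
Proof.
have H x : cder (fun x => u * x + v / 2 * (x - p) ^+ 2) x (u + v * (x - p)).
  apply: gder_eq (gderD (gderZ u (gder_id _ _))
    (gderZ (v / 2) (gderX 2 (gderB (gder_id _ _) (gder_cst _ p x))))).
  by rewrite /=; field.
by rewrite /tri !(@sg_prim _ _ _ _ _ (fun t _ => H _)); ring.
Qed.

Lemma goursat f D a b c : convexC D -> closedC D ->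
  (forall x, D x -> exists d, cder f x d) -> D a -> D b -> D c ->
  tri f a b c = 0.
Proof.
move=> cD clD df Da Db Dc.
have cf x : D x -> ccont f x by move=> /df[d Hd]; exact: gder_cont Hd.
have cs x y : D x -> D y -> contseg f x y by move=> Dx Dy t t01; apply/cf/cD.
have mD x y : D x -> D y -> D ((x + y) / 2).
  by move=> Dx Dy; rewrite -lint_half; exact: cD half01.
pose inD (T : C * C * C) := [/\ D T.1.1, D T.1.2 & D T.2].
pose tr (T : C * C * C) := tri f T.1.1 T.1.2 T.2.
pose pe (T : C * C * C) := per T.1.1 T.1.2 T.2.
(* One of the four triangles of the midpoint subdivision carries at least a quarter of the
   integral. *)
have step T : exists T', inD T -> [/\ inD T', pe T' = pe T / 2,
    md (tr T) <= 4 * md (tr T') & md (T'.1.1 - T.1.1) <= pe T].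
  case: T => [[x y] z]; have [[Dx Dy Dz]|] := pselect (inD (x, y, z)); last first.
    by move=> nD; exists (x, y, z).
  rewrite /= in Dx Dy Dz.
  have := tri_split cD cf Dx Dy Dz => /=.
  set m := (x + y) / 2; set n := (y + z) / 2; set k := (z + x) / 2 => E.
  have [Dm Dn Dk] : [/\ D m, D n & D k] by split; exact: mD.
  have e1 : m - x = (y - x) / 2 by rewrite /m; field.
  have e2 : k - m = (z - y) / 2 by rewrite /k /m; field.
  have e3 : x - k = (x - z) / 2 by rewrite /k; field.
  have e4 : y - m = (y - x) / 2 by rewrite /m; field.
  have e5 : n - y = (z - y) / 2 by rewrite /n; field.
  have e6 : m - n = (x - z) / 2 by rewrite /n /m; field.
  have e7 : z - n = (z - y) / 2 by rewrite /n; field.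
  have e8 : k - z = (x - z) / 2 by rewrite /k; field.
  have e9 : n - k = (y - x) / 2 by rewrite /n /k; field.
  have p1 := md_ge0 (y - x); have p2 := md_ge0 (z - y); have p3 := md_ge0 (x - z).
  have : md (tri f x y z) <= md (tri f x m k) + md (tri f m y n) +
      md (tri f n z k) + md (tri f m n k).
    rewrite E; do 3 (apply: le_trans (mdD _ _) _; rewrite lerD2r).
    by [].
  have [h1|h1] := lerP (md (tri f x y z)) (4 * md (tri f x m k)).
    move=> _; exists (x, m, k) => _; split => //=.
    - by rewrite /pe /per /= e1 e2 e3 !md_half; lra.
    - by rewrite subrr md0 per_ge0.
  have [h2|h2] := lerP (md (tri f x y z)) (4 * md (tri f m y n)).
    move=> _; exists (m, y, n) => _; split => //=.
    - by rewrite /pe /per /= e4 e5 e6 !md_half; lra.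
    - by rewrite e1 md_half /pe /per /=; lra.
  have [h3|h3] := lerP (md (tri f x y z)) (4 * md (tri f n z k)).
    move=> _; exists (n, z, k) => _; split => //=.
    - by rewrite /pe /per /= e7 e8 e9 !md_half; lra.
    - rewrite (_ : n - x = (n - y) + (y - x)); last by ring.
      by apply: le_trans (mdD _ _) _; rewrite e5 md_half /pe /per /=; lra.
  move=> h; exists (m, n, k) => _; split => //=.
  - by rewrite /pe /per /= (mdBC n m) (mdBC k n) (mdBC m k) e6 e9 e2 !md_half; lra.
  - by lra.
  - by rewrite e1 md_half /pe /per /=; lra.
have [st Hst] := choice step.
pose u n := iter n st (a, b, c).
have uD n : inD (u n) by elim: n => [|n IH] //; case: (Hst _ IH).
have pu n : pe (u n) = pe (u 0%N) * (1 / 2) ^+ n.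
  elim: n => [|n IH]; first by rewrite expr0 mulr1.
  by case: (Hst _ (uD n)) => _ -> _ _; rewrite IH exprS; field.
have tu n : md (tr (u 0%N)) <= 4 ^+ n * md (tr (u n)).
  elim: n => [|n IH]; first by rewrite expr0 mul1r.
  apply: le_trans IH _; case: (Hst _ (uD n)) => _ _ h _.
  by rewrite exprSr -mulrA ler_wpM2l// exprn_ge0.
have q01 : (0 : R) <= 1 / 2 < (1 : R) by lra.
have [|p Hp] := @geometric_complex R (fun n => (u n).1.1) (pe (u 0%N)) _ q01.
  by move=> n; case: (Hst _ (uD n)) => _ _ _; rewrite pu.
set Q := pe (u 0%N) in pu Hp.
have Q0 : 0 <= Q by exact: per_ge0.
have Hp' n : md ((u n).1.1 - p) <= 4 * Q * (1 / 2) ^+ n.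
  by apply: le_trans (Hp n) _; rewrite (_ : 2 * (Q / (1 - 1 / 2)) = 4 * Q)//; field.
(* The first vertex of the n-th triangle is within 4 Q / 2^n of [p] and its perimeter is Q / 2^n, so
   all its points are within 5 Q / 2^n of [p]. *)
have small (e : R) : 0 < e -> exists n, 5 * Q * (1 / 2) ^+ n < e.
  exact: small_geometric.
have Dp : D p.
  apply: clD => e /small[n hn]; exists (u n).1.1; first by case: (uD n).
  apply: le_lt_trans (Hp' n) (le_lt_trans _ hn).
  by rewrite ler_wpM2r ?exprn_ge0//; lra.
have [d Hd] := df _ Dp.
have key (e : R) : 0 < e -> md (tr (u 0%N)) <= e * (5 * Q * Q).
  move=> e0; have [s s0 Hs] := Hd _ e0.
  have [n hn] := small _ s0.
  case: (uD n) => D1 D2 D3.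
  (* The affine part of [f] at [p] has integral 0 around a triangle, so [f] may be replaced by the
     remainder [g], at most e |x - p| near [p]. The factor 4^n of the subdivision is then absorbed
     by the perimeter and by the distance to [p], both of order 2^-n. *)
  pose g x := f x - (f p + d * (x - p)).
  have cg x : D x -> ccont g x.
    move=> Dx; apply: gcontB; first exact: cf.
    apply: gcontD; first exact: gcont_cst.
    apply: gcontM; first exact: gcont_cst.
    by apply: gcontB; [exact: gcont_id|exact: gcont_cst].
  have ca x y : contseg (fun x => f p + d * (x - p)) x y.
    move=> t _; apply: gcontD; first exact: gcont_cst.
    apply: gcontM; first exact: gcont_cst.
    by apply: gcontB; [exact: gcont_id|exact: gcont_cst].
  have csg x y : D x -> D y -> contseg g x y by move=> Dx Dy t t01; apply/cg/cD.
  have Eg : tr (u n) = tri g (u n).1.1 (u n).1.2 (u n).2.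
    rewrite /tri !sgB//; try exact: cs.
    rewrite /tr -[LHS]subr0 -(tri_affine p (f p) d (u n).1.1 (u n).1.2 (u n).2).
    by rewrite /tri; ring.
  have bd x : md (x - (u n).1.1) <= pe (u n) -> md (g x) <= e * (5 * Q * (1 / 2) ^+ n).
    move=> hx.
    have xp : md (x - p) <= 5 * Q * (1 / 2) ^+ n.
      apply: le_trans (md_tri (u n).1.1 _ _) _.
      by have := Hp' n; move: hx; rewrite pu; lra.
    rewrite /g (_ : _ - _ = f x - f p - d * (x - p)); last by ring.
    apply: le_trans (Hs x (le_lt_trans xp hn)) _.
    by rewrite ler_wpM2l// ltW.
  apply: le_trans (tu n) _; rewrite Eg.
  have : md (tri g (u n).1.1 (u n).1.2 (u n).2) <=
      e * (5 * Q * (1 / 2) ^+ n) * pe (u n).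
    apply: tri_bound; try exact: csg; move=> t /(per_lint (u n).1.1 (u n).1.2 (u n).2)[h1 h2 h3];
    exact: bd.
  rewrite pu => h.
  have := ler_wpM2l (exprn_ge0 n (ler0n R 4)) h.
  move=> /le_trans; apply.
  have -> : 4 ^+ n * (e * (5 * Q * (1 / 2) ^+ n) * (Q * (1 / 2) ^+ n)) =
    e * (5 * Q * Q) * (4 ^+ n * (1 / 2) ^+ n * (1 / 2) ^+ n) by ring.
  rewrite -!exprMn (_ : (4 * (1 / 2) * (1 / 2) : R) = 1); last by field.
  by rewrite expr1n mulr1.
have : md (tr (u 0%N)) <= 0.
  rewrite leNgt; apply/negP => pos.
  have K0 : 0 <= 5 * Q * Q by rewrite !mulr_ge0.
  have K1 : 0 < 5 * Q * Q + 1 by lra.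
  have := key _ (divr_gt0 (divr_gt0 pos (ltr0n _ 2)) K1).
  rewrite mulrAC ler_pdivlMr; last by lra.
  have : 0 <= md (tr (u 0%N)) * (5 * Q * Q) by rewrite mulr_ge0 ?md_ge0.
  by lra.
by move=> h; apply/eqP; rewrite -md_eq0 eq_le md_ge0 andbT; exact: h.
Qed.

Lemma md_lint (x y z : C) (t r : R) : 0 <= t <= 1 -> md (x - z) <= r ->
  md (y - z) <= r -> md (lint x y t - z) <= r.
Proof.
move=> /andP[t0 t1] hx hy.
have -> : lint x y t - z = (1 - t)%:C%C * (x - z) + t%:C%C * (y - z).
  by rewrite /lint rmorphB rmorph1; ring.
apply: le_trans (mdD _ _) _; rewrite !mdM !mdR !ger0_norm ?subr_ge0//.
have h1 : (1 - t) * md (x - z) <= (1 - t) * r by rewrite ler_wpM2l ?subr_ge0.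
have h2 : t * md (y - z) <= t * r by rewrite ler_wpM2l.
by lra.
Qed.

Lemma Re_lint (x y a k : C) (t : R) : complex.Re ((lint x y t - a) * k) =
  (1 - t) * complex.Re ((x - a) * k) + t * complex.Re ((y - a) * k).
Proof.
by rewrite /lint; case: x y a k => [? ?] [? ?] [? ?] [? ?] /=; ring.
Qed.

(* Away from the possibly exceptional point [a] the triangle [a z z'] is cut near
   its vertex [a], which leaves triangles in a half-plane avoiding [a]. *)
Lemma disc_primitive f z0 a r : md (a - z0) < r ->
  (forall z, md (z - z0) < r -> ccont f z) ->
  (forall z, md (z - z0) < r -> z != a -> exists d, cder f z d) ->
  forall z, md (z - z0) < r -> cder (sg f a) z (f z).
Proof.
move=> ar cf df z zr.
have cs x y : md (x - z0) < r -> md (y - z0) < r -> contseg f x y.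
  move=> xr yr t t01; apply: cf.
  apply: (@le_lt_trans _ _ (Num.max (md (x - z0)) (md (y - z0)))).
    by apply: md_lint => //; rewrite le_max lexx ?orbT.
  by rewrite gt_max xr yr.
suff tri0 : exists2 s : R, 0 < s & forall z', md (z' - z) < s ->
    md (z' - z0) < r /\ sg f a z' - sg f a z = sg f z z'.
  move: tri0 => [s s0 Hs] e e0.
  have [t t0 Ht] := cf _ zr _ e0.
  exists (Num.min s t); first by rewrite lt_min s0.
  move=> z'; rewrite lt_min => /andP[/Hs[z'r ->] z't].
  have E : f z * (z' - z) = sg (fun=> f z) z z'.
    by rewrite /sg intI_cst mulrC.
  rewrite E -sgB; last first.
  - by move=> u _; exact: gcont_cst.
  - exact: cs.
  apply: sg_bound.
    by move=> u u01; apply: gcontB; [exact: (cs _ _ zr z'r)|exact: gcont_cst].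
  move=> u u01; apply/ltW/Ht.
  by apply: le_lt_trans z't; exact: md_lint_sub.
have [->|za] := eqVneq z a.
  exists (r - md (a - z0)); first by rewrite subr_gt0.
  move=> z' h; split; first by have := md_tri a z' z0; lra.
  by rewrite {2}/sg subrr mul0r subr0.
have k0 : 0 < md (z - a) by rewrite md_gt0 subr_eq0.
exists (Num.min (r - md (z - z0)) (md (z - a) / 2)).
  by rewrite lt_min subr_gt0 zr divr_gt0.
move=> z'; rewrite lt_min => /andP[h1 h2].
have z'r : md (z' - z0) < r by have := md_tri z z' z0; lra.
split=> //; suff: tri f a z z' = 0.
  rewrite /tri (sg_rev (cs a z' ar z'r)) => h.
  by apply/eqP; rewrite -subr_eq0; apply/eqP; rewrite -[RHS]oppr0 -h; ring.
apply/eqP; rewrite -md_eq0 eq_le md_ge0 andbT; apply/ler_addgt0Pr => e e0.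
rewrite add0r.
have [w w0 Hw] := cf _ ar _ (@ltr01 R).
set M := md (f a) + 1.
have M0 : 0 < M by rewrite /M; have := md_ge0 (f a); lra.
set Q := per a z z'.
have Q0 : 0 <= Q by exact: per_ge0.
have Q1 : 0 < Q + 1 by lra.
(* The triangle cut off at [a] has perimeter s Q: it has to lie in the disc of radius [w], where |f|
   <= M, and to contribute at most [e]. *)
pose s := Num.min (1 / 2) (Num.min (w / (Q + 1)) (e / (M * (Q + 1)))).
have s0 : 0 < s by rewrite !lt_min !divr_gt0// mulr_gt0.
have s1 : s < 1 by rewrite gt_min; apply/orP; left; lra.
have sQ : s * Q < w.
  have : s <= w / (Q + 1) by rewrite /s !ge_min lexx orbT.
  by rewrite ler_pdivlMr//; have := mulr_gt0 s0 Q1; lra.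
have sMQ : M * (s * Q) <= e.
  have : s <= e / (M * (Q + 1)) by rewrite /s !ge_min lexx !orbT.
  rewrite ler_pdivlMr ?mulr_gt0// => h; apply: le_trans h.
  by rewrite mulrCA ler_wpM2l ?(ltW s0)// ler_wpM2l ?(ltW M0)//; lra.
have s01 : 0 <= s <= 1 by rewrite !ltW.
set b := lint a z s; set b' := lint a z' s.
(* [L] vanishes at [a] and is positive at [z] and [z']. A positive lower bound on [L], with a bound
   on the distance to [z0], cuts out a closed convex set [D] that avoids [a]. *)
pose L (x : C) := complex.Re ((x - a) * (z - a)^*%C).
have Llint x y (t : R) : L (lint x y t) = (1 - t) * L x + t * L y.
  exact: Re_lint.
have La : L a = 0 by rewrite /L subrr mul0r.
have Lz : L z = md (z - a) ^+ 2 by rewrite /L mulrC Re_conjM.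
have Lz' : md (z - a) ^+ 2 / 2 <= L z'.
  have -> : L z' = L z + complex.Re ((z' - z) * (z - a)^*%C).
    rewrite /L (_ : z' - a = (z - a) + (z' - z)); last by ring.
    by rewrite mulrDl; case: (_ * _) (_ * _) => ? ? [].
  have := Re_md ((z' - z) * (z - a)^*%C); rewrite mdM mdJ ler_norml Lz.
  have : md (z' - z) * md (z - a) <= md (z - a) / 2 * md (z - a).
    by rewrite ler_wpM2r ?ltW.
  by rewrite expr2; lra.
pose r1 := Num.max (md (a - z0)) (Num.max (md (z - z0)) (md (z' - z0))).
have r1r : r1 < r by rewrite !gt_max ar zr z'r.
pose D (x : C) := md (x - z0) <= r1 /\ s * (md (z - a) ^+ 2 / 2) <= L x.
have kk : 0 < md (z - a) ^+ 2 / 2 by rewrite divr_gt0// exprn_gt0.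
have cD : convexC D.
  move=> x y t [xr Lx] [yr Ly] t01; split; first exact: md_lint.
  rewrite Llint; move: t01 => /andP[t0 t1].
  have g1 := ler_wpM2l t0 Ly.
  have t1' : 0 <= 1 - t by lra.
  by have := ler_wpM2l t1' Lx; lra.
have clD : closedC D.
  move=> p Hp; split.
    apply/ler_addgt0Pr => e' /Hp[x [xr _] xp].
    by have := md_tri x p z0; rewrite (mdBC p x); lra.
  apply/ler_addgt0Pr => e' e'0.
  have [|x [_ Lx] xp] := Hp (e' / md (z - a)); first by rewrite divr_gt0.
  have : L x = L p + complex.Re ((x - p) * (z - a)^*%C).
    rewrite /L (_ : x - a = (p - a) + (x - p)); last by ring.
    by rewrite mulrDl; case: (_ * _) (_ * _) => ? ? [].
  have := Re_md ((x - p) * (z - a)^*%C); rewrite mdM mdJ ler_norml.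
  by move: xp; rewrite ltr_pdivlMr//; lra.
have Da : ~ D a by move=> [_]; rewrite La => h; have := mulr_gt0 s0 kk; lra.
have dD x : D x -> exists d, cder f x d.
  move=> Dx; apply: df; first by case: Dx => h _; exact: le_lt_trans r1r.
  by apply/eqP => xa; apply: Da; rewrite -xa.
have Dz : D z.
  split; first by rewrite !le_max lexx orbT.
  have := ler_wpM2r (ltW kk) (ltW s1); rewrite Lz.
  by move: kk; lra.
have Dz' : D z'.
  split; first by rewrite !le_max lexx !orbT.
  by have := ler_wpM2r (ltW kk) (ltW s1); rewrite mul1r => /le_trans; exact.
have Db : D b.
  split; first by apply: md_lint => //; rewrite !le_max lexx ?orbT.
  rewrite Llint La mulr0 add0r ler_wpM2l ?(ltW s0)// Lz.
  by move: kk; lra.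
have Db' : D b'.
  split; first by apply: md_lint => //; rewrite !le_max lexx ?orbT.
  by rewrite Llint La mulr0 add0r ler_wpM2l ?(ltW s0)// Lz.
have t1 := goursat cD clD dD Db Dz Dz'.
have t2 := goursat cD clD dD Db Dz' Db'.
have [br b'r] : md (b - z0) < r /\ md (b' - z0) < r.
  by split; [case: Db|case: Db'] => h _; exact: le_lt_trans r1r.
have -> : tri f a z z' = tri f a b b' + tri f b z z' + tri f b z' b'.
  rewrite /tri (sg_split s01 (cs a z ar zr)) (sg_rev (cs a z' ar z'r)).
  rewrite (sg_split s01 (cs a z' ar z'r)) -/b -/b'.
  rewrite (sg_rev (cs b' z' b'r z'r)) (sg_rev (cs a b' ar b'r)).
  by rewrite (sg_rev (cs b b' br b'r)) (sg_rev (cs b z' br z'r)); ring.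
rewrite t1 t2 !addr0.
have pb : per a b b' = s * Q.
  rewrite /Q /per /b /b' lint_sub.
  have -> : lint a z' s - lint a z s = s%:C%C * (z' - z) by rewrite /lint; ring.
  have -> : a - lint a z' s = s%:C%C * (a - z') by rewrite /lint; ring.
  by rewrite !mdM !mdR ger0_norm ?(ltW s0)//; ring.
apply: le_trans sMQ; rewrite -pb; apply: tri_bound; try exact: cs.
all: move=> t /(per_lint a b b')[g1 g2 g3].
all: have bd x : md (x - a) <= per a b b' -> md (f x) <= M
  by rewrite pb => g; have := Hw x (le_lt_trans g sQ);
     have := md_lB (f x) (f a); rewrite /M; lra.
all: exact: bd.
Qed.

End cauchy.

(** * Cauchy's formula *)

Section cauchy_formula.
Variable R : realType.
Local Notation C := R[i].
Implicit Types (f g P : C -> C).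

Definition ce (t : R) : C := (cos (2 * pi * t) +i* sin (2 * pi * t))%C.

Lemma ce0 : ce 0 = 1.
Proof. by rewrite /ce mulr0 cos0 sin0. Qed.
Lemma ceD s t : ce (s + t) = ce s * ce t.
Proof.
rewrite /ce mulrDr cosD sinD /GRing.mul /=.
by congr (_ +i* _)%C; rewrite addrC.
Qed.
Lemma ce1 : ce 1 = 1.
Proof. by rewrite /ce mulr1 mulr_natl cos2pi sin2pi. Qed.
Lemma md_ce t : md (ce t) = 1.
Proof. by rewrite /md /ce /= cos2Dsin2 sqrtr1. Qed.
Lemma ce_neq0 t : ce t != 0.
Proof. by rewrite -md_gt0 md_ce. Qed.

Definition tau : C := 'i%C * (2 * pi)%:C%C.

Lemma tau_neq0 : tau != 0.
Proof.
by rewrite -md_gt0 mdM md_i mul1r mdR normr_gt0 mulf_neq0 ?pnatr_eq0// lt0r_neq0 ?pi_gt0.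
Qed.

Lemma is_derive_2pi (t : R) :
  is_derive t 1 (fun u : R => 2 * pi * u) (2 * pi : R).
Proof.
apply/is_derive_epsP => e e0; near=> y.
by rewrite -mulrBr subrr normr0 mulr_ge0// ltW.
Unshelve. all: by end_near. Qed.

Lemma ce_der t : rder ce t (tau * ce t).
Proof.
apply/rderP; split.
  have -> : complex.Re (tau * ce t) = - sin (2 * pi * t) * (2 * pi).
    by rewrite /tau /ce /=; ring.
  exact: (is_derive1_comp (f := @cos R) (g := fun u : R => 2 * pi * u)
    (is_derive_cos _) (is_derive_2pi t)).
have -> : complex.Im (tau * ce t) = cos (2 * pi * t) * (2 * pi).
  by rewrite /tau /ce /=; ring.
exact: (is_derive1_comp (f := @sin R) (g := fun u : R => 2 * pi * u)
  (is_derive_sin _) (is_derive_2pi t)).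
Qed.

Definition cir (r : R) (t : R) : C := r%:C%C * ce t.

Lemma md_cir r t : 0 < r -> md (cir r t) = r.
Proof. by move=> r0; rewrite /cir mdM md_ce mulr1 mdR gtr0_norm. Qed.

Lemma cir_neq0 r t : 0 < r -> cir r t != 0.
Proof. by move=> r0; rewrite -md_gt0 md_cir. Qed.

Lemma cir_der r t : rder (cir r) t (tau * cir r t).
Proof. by apply: gder_eq (gderZ _ (ce_der t)); rewrite /cir; ring. Qed.

Lemma cir_cont r t : rcont (cir r) t.
Proof. exact: gder_cont (cir_der r t). Qed.

Lemma intI_circ r P g : 0 < r -> (forall t, cder P (cir r t) (g (cir r t))) ->
  intI (fun t => g (cir r t) * cir r t) = 0.
Proof.
move=> r0 HP.
rewrite (@intI_eq _ _ (fun t => tau^-1 * P (cir r t))).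
  by rewrite /cir ce0 ce1 subrr.
move=> t _; apply: gder_eq (gderZ _ (gder_comp (cir_der r t) (HP t))).
by field; exact: tau_neq0.
Qed.

Lemma intI_circX r n : 0 < r -> (0 < n)%N -> intI (fun t => (cir r t) ^- n) = 0.
Proof.
move=> r0 n0.
rewrite (@intI_eq _ _ (fun t => (- (n%:R * tau))^-1 * (cir r t) ^- n)).
  by rewrite /cir ce0 ce1 subrr.
move=> t _.
have H := @gderV _ _ _ (fun t => cir r t ^+ n) t _
  (expf_neq0 n (cir_neq0 t r0)) (gderX n (cir_der r t)).
apply: gder_eq (gderZ _ H).
have nz : (n%:R : C) != 0 by rewrite pnatr_eq0 -lt0n.
case: n n0 nz {H} => // n _ nz; rewrite /= expr2 exprS.
have := tau_neq0; have := cir_neq0 t r0; have := expf_neq0 n (cir_neq0 t r0).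
move: nz; move: (n.+1%:R : C) tau (cir r t) (cir r t ^+ n) => N T c p *.
by field; apply/and4P.
Qed.

Lemma cir_sub_neq0 r a t : 0 < r -> md a < r -> cir r t - a != 0.
Proof.
by move=> r0 ar; rewrite -md_gt0; have := md_lB (cir r t) a; rewrite md_cir//; lra.
Qed.

Lemma md_cir_sub r a t : 0 < r -> md a < r -> md (cir r t - a)^-1 <= (r - md a)^-1.
Proof.
move=> r0 ar; rewrite mdV lef_pV2 ?posrE ?subr_gt0// ?md_gt0 ?cir_sub_neq0//.
by have := md_lB (cir r t) a; rewrite md_cir.
Qed.

Lemma cir_ker_cont r a t : 0 < r -> md a < r ->
  rcont (fun t => (cir r t - a)^-1) t.
Proof.
move=> r0 ar; apply: gcontV; first exact: cir_sub_neq0.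
by apply: gcontB; [exact: cir_cont|exact: gcont_cst].
Qed.

Lemma cirX_cont r n t : 0 < r -> rcont (fun t => (cir r t) ^- n) t.
Proof.
move=> r0; apply: gcontV; first by rewrite expf_neq0// cir_neq0.
exact: gder_cont (gderX n (cir_der r t)).
Qed.

(** The geometric series of 1 / (1 - a / z): [J k] is the mean of its k-th remainder. Consecutive
    remainders differ by the mean of (a / z)^k, which is 1 for k = 0 and 0 otherwise, and the
    remainders tend to 0. *)
Lemma intI_kernel r a : 0 < r -> md a < r ->
  intI (fun t => cir r t / (cir r t - a)) = 1.
Proof.
move=> r0 ar.
pose J k := intI (fun t => a ^+ k * ((cir r t) ^- k * (cir r t / (cir r t - a)))).
have cJ k t : rcont (fun t => a ^+ k * ((cir r t) ^- k * (cir r t / (cir r t - a)))) t.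
  apply: gcontM; first exact: gcont_cst.
  apply: gcontM; first exact: cirX_cont.
  by apply: gcontM; [exact: cir_cont|exact: cir_ker_cont].
have JS k : J k - J k.+1 = intI (fun t => a ^+ k * (cir r t) ^- k).
  rewrite /J -intIB; try exact: cJ.
  apply: eq_intI.
    by move=> t; apply: gcontB; exact: cJ.
  move=> t _; rewrite !exprS.
  by field; rewrite cir_sub_neq0// expf_neq0// cir_neq0.
have J0 : J 0%N - J 1%N = 1.
  by rewrite JS -[RHS](@intI_cst R); apply: eq_intI => [t|t _];
    rewrite ?expr0 ?invr1 ?mulr1//; apply: gcontM;
    [exact: gcont_cst|exact: cirX_cont].
have Jn n : J n.+1 = J 1%N.
  elim: n => // n <-; apply/eqP; rewrite eq_sym -subr_eq0 JS intIZ.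
    by rewrite intI_circX// mulr0.
  by move=> t; exact: cirX_cont.
have J1 : J 1%N = 0.
  apply/eqP; rewrite -md_eq0 eq_le md_ge0 andbT; apply/ler_addgt0Pr => e e0.
  rewrite add0r.
  have q01 : 0 <= md a / r < 1.
    by rewrite divr_ge0 ?md_ge0 ?(ltW r0)//= ltr_pdivrMr// mul1r.
  have [n Hn] := small_geometric (r / (r - md a)) q01 e0.
  rewrite -(Jn n); apply: intI_bound; first exact: cJ.
  move=> t _; rewrite mulrA mdM (mdM (a ^+ _)) (mdM (cir r t)).
  rewrite mdX (mdV (_ ^+ _)) mdX md_cir//.
  apply: le_trans (ltW Hn).
  have -> : md a ^+ n.+1 / r ^+ n.+1 = (md a / r) ^+ n.+1.
    by rewrite expr_div_n.
  rewrite [leRHS]mulrC; apply: ler_pM.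
  - by rewrite exprn_ge0//; case/andP: q01.
  - by rewrite mulr_ge0 ?md_ge0 ?(ltW r0).
  - rewrite exprS ler_piMl ?exprn_ge0//; case/andP: q01 => // q0 q1; exact: ltW.
  - by rewrite ler_wpM2l ?(ltW r0)//; exact: md_cir_sub.
have -> : intI (fun t => cir r t / (cir r t - a)) = J 0%N.
  by rewrite /J; congr intI; apply/funext => t; rewrite !expr0 invr1 !mul1r.
by rewrite -J0 J1 subr0.
Qed.

Lemma circ_cont f r t : (forall z, md z = r -> ccont f z) -> 0 < r ->
  rcont (fun t => f (cir r t)) t.
Proof.
move=> cf r0; apply: (gcont_comp (cir_cont r t)); apply: cf.
exact: md_cir.
Qed.

(** The difference quotient at [a], extended by the derivative, is continuous, and differentiable
    away from [a]: the exceptional point allowed in [disc_primitive] is meant for it. Its integral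
    over the circle vanishes, and [intI_kernel] evaluates the remaining term. *)
Theorem cauchy_formula f rho r a : 0 < r -> r < rho ->
  (forall z, md z < rho -> exists d, cder f z d) -> md a < r ->
  intI (fun t => f (cir r t) * (cir r t / (cir r t - a))) = f a.
Proof.
move=> r0 rr df ar.
have cf z : md z < rho -> ccont f z.
  by move=> /df[d Hd]; exact: gder_cont Hd.
have arho : md a < rho by exact: lt_trans rr.
have [d Hd] := df a arho.
pose g z := if z == a then d else (f z - f a) / (z - a).
have dg z : md z < rho -> z != a -> exists d, cder g z d.
  move=> zr za; have [dz Hz] := df z zr.
  have za0 : z - a != 0 by rewrite subr_eq0.
  have H := gderM (gderB Hz (gder_cst id (f a) z))
    (@gderV _ _ _ (fun z => z - a) z _ za0 (gderB (gder_id id z) (gder_cst id a z))).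
  exists ((dz - 0) / (z - a) + (f z - f a) * (- (1 - 0) / (z - a) ^+ 2)).
  have m0 : 0 < md (z - a) by rewrite md_gt0.
  apply: gder_near m0 _ H => y yz; rewrite /g; case: eqP => // ya.
  by move: yz; rewrite ya mdBC ltxx.
have cg z : md z < rho -> ccont g z.
  move=> zr; have [->|za] := eqVneq z a; last first.
    by have [e He] := dg z zr za; exact: gder_cont He.
  move=> e e0; have e2 : 0 < e / 2 by rewrite divr_gt0.
  have [s s0 Hs] := Hd _ e2; exists s => // y ys.
  rewrite /g eqxx; case: eqP => [_|/eqP ya]; first by rewrite subrr md0.
  have ya0 : y - a != 0 by rewrite subr_eq0.
  rewrite (_ : _ - d = (f y - f a - d * (y - a)) / (y - a)); last by field.
  rewrite mdM mdV ltr_pdivrMr ?md_gt0//; apply: le_lt_trans (Hs y ys) _.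
  by rewrite ltr_pM2r ?md_gt0//; lra.
have rz t : md (cir r t) < rho by rewrite md_cir.
have az : md (a - 0) < rho by rewrite subr0.
have HP := @disc_primitive R g 0 a rho az.
have I0 : intI (fun t => g (cir r t) * cir r t) = 0.
  apply: (intI_circ (P := sg g a) r0) => t; apply: HP.
  - by move=> z; rewrite subr0; exact: cg.
  - by move=> z; rewrite subr0; exact: dg.
  - by rewrite subr0.
have ck t : rcont (fun t => cir r t / (cir r t - a)) t.
  by apply: gcontM; [exact: cir_cont|exact: cir_ker_cont].
have cfc t : rcont (fun t => f (cir r t)) t.
  by apply: circ_cont r0 => z zr; apply: cf; rewrite zr.
have c1 t : rcont (fun t => f (cir r t) * (cir r t / (cir r t - a))) t.
  exact: gcontM (cfc t) (ck t).
have c2 t : rcont (fun t => f a * (cir r t / (cir r t - a))) t.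
  exact: gcontM (gcont_cst _ _ _) (ck t).
apply/eqP; rewrite -subr_eq0 -[X in _ - X]mulr1 -(intI_kernel r0 ar) -intIZ//.
rewrite -intIB//; apply/eqP; rewrite -[RHS]I0; apply: eq_intI.
  by move=> t; exact: gcontB (c1 t) (c2 t).
move=> t _; rewrite /g; case: eqP => [E|_].
  by have := cir_sub_neq0 t r0 ar; rewrite E subrr eqxx.
by field; exact: cir_sub_neq0.
Qed.

End cauchy_formula.

(** * Holomorphic functions on a disc *)

Section disc.
Variable R : realType.
Local Notation C := R[i].
Implicit Types (f g : C -> C) (phi : R -> C).

Definition holD f (r : R) := forall z, md z < r -> exists d, cder f z d.

Definition bigO f n := exists K : R, exists2 s : R, 0 < s &
  forall z, md z < s -> md (f z) <= K * md z ^+ n.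

Lemma holD_le f r r' : r <= r' -> holD f r' -> holD f r.
Proof. by move=> rr H z zr; apply: H; exact: lt_le_trans rr. Qed.

Lemma holD_cont f r z : holD f r -> md z < r -> ccont f z.
Proof. by move=> H /H[d Hd]; exact: gder_cont Hd. Qed.

Lemma rcont_bounded phi : (forall t, rcont phi t) ->
  exists M, forall t : R, 0 <= t <= 1 -> md (phi t) <= M.
Proof.
move=> /rcontP[cr ci].
have key (u : R -> R) : continuous u ->
    exists M, forall t : R, 0 <= t <= 1 -> `|u t| <= M.
  move=> cu; have [|c _ Hc] := @EVT_max R (fun t => `|u t|) 0 1 ler01.
    by apply: continuous_subspaceT => t; apply: continuous_comp; [exact: cu|exact: norm_continuous].
  by exists `|u c| => t t01; apply: Hc; rewrite in_itv.
have [M HM] := key _ cr; have [N HN] := key _ ci.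
exists (M + N) => t t01; apply: le_trans (md_ReIm _) _.
by rewrite lerD ?HM ?HN.
Qed.

(** The Cauchy transform of a function on the circle of radius [r]. The lemmas assume only the
    continuity of [phi], so they apply to uniform limits and to the quotients f(z) / z^n. *)
Definition CT r phi (a : C) :=
  intI (fun t => phi t * (cir r t / (cir r t - a))).

Lemma CT_cont r phi a t : 0 < r -> md a < r -> (forall t, rcont phi t) ->
  rcont (fun t => phi t * (cir r t / (cir r t - a))) t.
Proof.
move=> r0 ar cp; apply: gcontM (cp t) _.
by apply: gcontM; [exact: cir_cont|exact: cir_ker_cont].
Qed.

Lemma CT_bound r phi a M : 0 < r -> md a < r -> (forall t, rcont phi t) ->
  (forall t : R, 0 <= t <= 1 -> md (phi t) <= M) ->
  md (CT r phi a) <= M * (r / (r - md a)).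
Proof.
move=> r0 ar cp HM; apply: intI_bound => [t|t t01]; first exact: CT_cont.
rewrite mdM ler_pM ?md_ge0 ?HM// mdM md_cir// ler_wpM2l ?(ltW r0)//.
exact: md_cir_sub.
Qed.

Lemma CT_sub r phi a b : 0 < r -> md a < r -> md b < r ->
  (forall t, rcont phi t) ->
  CT r phi b - CT r phi a =
  (b - a) * intI (fun t => phi t * (cir r t / (cir r t - a)) / (cir r t - b)).
Proof.
move=> r0 ar br cp.
have ca t := @CT_cont r phi a t r0 ar cp.
have cb t := @CT_cont r phi b t r0 br cp.
rewrite /CT -intIB// -intIZ; last first.
  by move=> t; apply: gcontM (ca t) _; exact: cir_ker_cont.
apply: eq_intI => [t|t _]; first exact: gcontB (cb t) (ca t).
by field; rewrite !cir_sub_neq0.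
Qed.

Lemma CT_lip r phi : 0 < r -> (forall t, rcont phi t) ->
  exists2 L, 0 <= L & forall a b, md a <= r / 2 -> md b <= r / 2 ->
    md (CT r phi a - CT r phi b) <= L * md (a - b).
Proof.
move=> r0 cp; have [M HM] := rcont_bounded cp.
have M0 : 0 <= M by apply: le_trans (md_ge0 _) (HM 0 _); rewrite lexx ler01.
have rg := ltW r0.
exists (M * (2 * (2 / r))); first by rewrite !mulr_ge0// ?invr_ge0.
move=> a b ha hb.
have ar : md a < r by lra.
have br : md b < r by lra.
have ker c t : md c <= r / 2 -> md (cir r t - c)^-1 <= 2 / r.
  move=> hc; have cr : md c < r by lra.
  apply: le_trans (md_cir_sub _ r0 cr) _.
  by rewrite -[2 / r]invf_div lef_pV2 ?posrE ?divr_gt0 ?subr_gt0//; lra.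
rewrite CT_sub// mdM mulrC ler_wpM2r ?md_ge0//.
apply: intI_bound => [t|t t01].
  by apply: gcontM; [exact: CT_cont|exact: cir_ker_cont].
rewrite mdM mdM mdM md_cir// -mulrA ler_pM ?md_ge0 ?HM//.
  by rewrite mulr_ge0 ?mulr_ge0 ?md_ge0 ?ltW.
rewrite ler_pM ?md_ge0 ?mulr_ge0 ?md_ge0 ?(ltW r0) ?ker//.
by have := ler_wpM2l (ltW r0) (ker b t hb); rewrite mulrCA divff ?mulr1// lt0r_neq0.
Qed.

Lemma CT_der r phi a : 0 < r -> md a < r -> (forall t, rcont phi t) ->
  exists d, cder (CT r phi) a d.
Proof.
move=> r0 ar cp; have [M HM] := rcont_bounded cp.
have M0 : 0 <= M by apply: le_trans (md_ge0 _) (HM 0 _); rewrite lexx ler01.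
(* [k] is half the distance from [a] to the circle, so the kernel is at most 1 / k on the disc of
   radius [k] around [a]. *)
set k := (r - md a) / 2.
have k0 : 0 < k by rewrite divr_gt0// subr_gt0.
set phi' := fun t => phi t * (cir r t - a)^-1.
have cp' t : rcont phi' t by apply: gcontM (cp t) _; exact: cir_ker_cont.
exists (CT r (fun t => phi' t) a / 1).
have Ed : CT r (fun t => phi' t) a / 1 =
    intI (fun t => phi t * (cir r t / (cir r t - a)) / (cir r t - a)).
  by rewrite divr1 /CT /phi'; congr intI; apply/funext => t; ring.
rewrite Ed => e e0.
set L := M * (r / k / k / k).
have [rg kg] := (ltW r0, ltW k0).
have L0 : 0 <= L.
  by apply: mulr_ge0 => //; do 3 (apply: divr_ge0; last exact: kg).
exists (Num.min k (e / (L + 1))).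
  by rewrite lt_min k0 divr_gt0//; lra.
move=> b; rewrite lt_min => /andP[bk be].
have br : md b < r by have := md_tri b b 0; have := md_lB b a; rewrite /k in bk *; lra.
rewrite CT_sub//.
have c1 t : rcont (fun t => phi t * (cir r t / (cir r t - a)) / (cir r t - b)) t.
  by apply: gcontM; [exact: CT_cont|exact: cir_ker_cont].
have c2 t : rcont (fun t => phi t * (cir r t / (cir r t - a)) / (cir r t - a)) t.
  by apply: gcontM; [exact: CT_cont|exact: cir_ker_cont].
rewrite [X in md (_ - X)]mulrC -mulrBr -intIB// mdM mulrC.
rewrite ler_wpM2r ?md_ge0//.
apply: (@le_trans _ _ (L * md (b - a))); last first.
  move: be; rewrite ltr_pdivlMr; last by lra.
  by have := md_ge0 (b - a); have := md_ge0 (b - a); lra.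
have kerk c t : md (c - a) < k -> md (cir r t - c)^-1 <= k^-1.
  move=> hc; have := md_lB c a => h; have cr : md c < r by rewrite /k in hc; lra.
  apply: le_trans (md_cir_sub _ r0 cr) _.
  by rewrite lef_pV2 ?posrE ?subr_gt0// /k in hc *; rewrite /k; lra.
apply: intI_bound => [t|t t01]; first exact: gcontB (c1 t) (c2 t).
have -> : phi t * (cir r t / (cir r t - a)) / (cir r t - b) -
    phi t * (cir r t / (cir r t - a)) / (cir r t - a) =
    phi t * (cir r t / (cir r t - a) / (cir r t - a) / (cir r t - b)) * (b - a).
  by field; rewrite !cir_sub_neq0.
rewrite mdM ler_wpM2r ?md_ge0// mdM ler_pM ?md_ge0 ?HM//.
have ka : md (a - a) < k by rewrite subrr md0.
by do 3 (rewrite mdM; apply: ler_pM; rewrite ?md_ge0 ?kerk//); rewrite md_cir.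
Qed.

(** The n-th Taylor quotient: f(z) is the sum of its Taylor polynomial of degree less than n and of
    z^n times this function, whose value at 0 is the n-th Taylor coefficient. *)
Definition dv f r n (a : C) := CT r (fun t => f (cir r t) / (cir r t) ^+ n) a.

Section dv.
Variables (f : C -> C) (rho r : R).
Hypotheses (r0 : 0 < r) (rr : r < rho) (hf : holD f rho).

Lemma dv_cont n t : rcont (fun t => f (cir r t) / (cir r t) ^+ n) t.
Proof.
apply: gcontM; last exact: cirX_cont.
by apply: circ_cont r0 => z zr; apply: holD_cont hf _; rewrite zr.
Qed.

Lemma dv0 a : md a < r -> dv f r 0 a = f a.
Proof.
move=> ar; rewrite -(cauchy_formula r0 rr hf ar) /dv /CT.
by congr intI; apply/funext => t; rewrite expr0 divr1.
Qed.

Lemma dv_step n a : md a < r -> dv f r n a = dv f r n 0 + a * dv f r n.+1 a.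
Proof.
move=> ar; have r00 : md (0 : C) < r by rewrite md0.
rewrite /dv /CT -intIZ; last by move=> t; apply: CT_cont => //; exact: dv_cont.
rewrite -intID; first apply: eq_intI.
- by move=> t; apply: CT_cont => //; exact: dv_cont.
- move=> t _; rewrite subr0 exprS.
  by field; rewrite cir_sub_neq0// cir_neq0// expf_neq0// cir_neq0.
- by move=> t; apply: CT_cont => //; exact: dv_cont.
- by move=> t; apply: gcontM (gcont_cst _ _ _) _; apply: CT_cont => //; exact: dv_cont.
Qed.

Lemma dv_hol n : holD (dv f r n) r.
Proof. by move=> a ar; apply: CT_der => //; exact: dv_cont. Qed.

Lemma dv_bound n a M : (forall z, md z = r -> md (f z) <= M) -> md a < r ->
  md (dv f r n a) <= M / r ^+ n * (r / (r - md a)).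
Proof.
move=> HM ar; apply: CT_bound => //; first exact: dv_cont.
move=> t _; rewrite mdM mdV mdX md_cir//.
by rewrite ler_wpM2r ?HM ?md_cir// invr_ge0 exprn_ge0// ltW.
Qed.

(** By [dv_step] it remains at each order to see that the Taylor coefficient is 0, which follows
    from the growth bound by letting z tend to 0 along the positive reals. *)
Lemma bigO_dv n : bigO f n -> forall z, md z < r -> f z = z ^+ n * dv f r n z.
Proof.
elim: n => [|n IH] [K [s s0 Hs]] z zr; first by rewrite expr0 mul1r dv0.
have On : bigO f n.
  exists `|K|, (Num.min s 1); first by rewrite lt_min s0 ltr01.
  move=> y; rewrite lt_min => /andP[/Hs h y1]; apply: le_trans h _.
  apply: (@le_trans _ _ (`|K| * md y ^+ n.+1)).
    by rewrite ler_wpM2r ?exprn_ge0 ?md_ge0// ler_norm.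
  rewrite ler_wpM2l// exprS ler_piMl ?exprn_ge0 ?md_ge0//; exact: ltW.
rewrite IH// dv_step//.
suff -> : dv f r n 0 = 0 by rewrite add0r exprSr mulrA.
apply/eqP; rewrite -md_eq0 eq_le md_ge0 andbT; apply/ler_addgt0Pr => e e0.
rewrite add0r.
have r00 : md (0 : C) < r by rewrite md0.
have e2 : 0 < e / 2 by rewrite divr_gt0.
have [w w0 Hw] := holD_cont (dv_hol n) r00 e2.
have K1 : 0 < `|K| + 1 by have := normr_ge0 K; lra.
set y : R := Num.min (Num.min s r) (Num.min w (e / 2 / (`|K| + 1))) / 2.
have m0 : 0 < Num.min (Num.min s r) (Num.min w (e / 2 / (`|K| + 1))).
  by rewrite !lt_min s0 r0 w0 divr_gt0.
have y0 : 0 < y by rewrite divr_gt0.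
have : y < Num.min (Num.min s r) (Num.min w (e / 2 / (`|K| + 1))).
  by rewrite /y; lra.
rewrite !lt_min => /andP[/andP[ys yr] /andP[yw ye]].
have mdy : md (y%:C%C : C) = y by rewrite mdR gtr0_norm.
have h1 : md (dv f r n y%:C%C - dv f r n 0) < e / 2 by apply: Hw; rewrite subr0 mdy.
have h2 : md (dv f r n y%:C%C) <= K * y.
  have := Hs y%:C%C; rewrite mdy => /(_ ys); rewrite IH ?mdy// mdM mdX mdy.
  by rewrite exprSr mulrA [K * _]mulrC -mulrA ler_pM2l// exprn_gt0.
have := md_lB (dv f r n 0) (dv f r n y%:C%C); rewrite mdBC.
have : K * y <= `|K| * y by rewrite ler_wpM2r ?(ltW y0)// ler_norm.
by move: ye; rewrite ltr_pdivlMr//; lra.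
Qed.

Lemma dv_taylor n : bigO f n -> exists b, exists2 K : R, 0 <= K &
  forall z, md z <= r / 2 -> md (f z - b * z ^+ n) <= K * md z ^+ n.+1.
Proof.
move=> On; have [L L0 HL] := @CT_lip r _ r0 (dv_cont n).
exists (dv f r n 0), L => // z zr.
have zr' : md z < r by move: r0; lra.
rewrite (bigO_dv On zr') mulrC -mulrBl mdM mdX exprS mulrA.
rewrite ler_wpM2r ?exprn_ge0 ?md_ge0// -{2}[z]subr0; apply: HL => //.
by rewrite md0 divr_ge0// ltW.
Qed.

End dv.

(** Flatness gives f(z) = z^n [dv f r n z] for every n, and Cauchy's estimate bounds this by a
    constant times (|z| / r)^n. *)
Lemma holD_flat f rho z : holD f rho -> (forall n, bigO f n) -> md z < rho ->
  f z = 0.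
Proof.
move=> hf On zr.
have rho0 : 0 < rho by apply: le_lt_trans zr; exact: md_ge0.
set r := (md z + rho) / 2.
have r0 : 0 < r by rewrite divr_gt0// ltr_wpDl ?md_ge0.
have rr : r < rho by rewrite /r; lra.
have zr' : md z < r by rewrite /r; lra.
have cf t : rcont (fun t => f (cir r t)) t.
  by apply: circ_cont r0 => y yr; apply: holD_cont hf _; rewrite yr.
have [M HM] := rcont_bounded cf.
have M0 : 0 <= M by apply: le_trans (md_ge0 _) (HM 0 _); rewrite lexx ler01.
apply/eqP; rewrite -md_eq0 eq_le md_ge0 andbT; apply/ler_addgt0Pr => e e0.
rewrite add0r.
have q01 : 0 <= md z / r < 1.
  by rewrite divr_ge0 ?md_ge0 ?(ltW r0)//= ltr_pdivrMr// mul1r.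
have [n Hn] := small_geometric (M * (r / (r - md z))) q01 e0.
apply: le_trans (ltW Hn).
rewrite (bigO_dv r0 rr hf (On n) zr') mdM mdX.
have -> : M * (r / (r - md z)) * (md z / r) ^+ n =
    md z ^+ n * (M / r ^+ n * (r / (r - md z))).
  by rewrite expr_div_n; ring.
rewrite ler_wpM2l ?exprn_ge0 ?md_ge0//.
apply: CT_bound => //; first exact: dv_cont hf _.
move=> t t01; rewrite mdM mdV mdX md_cir//.
by rewrite ler_wpM2r ?HM// invr_ge0 exprn_ge0// ltW.
Qed.

(** Cauchy's formula passes to uniform limits, so near each point [f] is the Cauchy transform of its
    own values on a circle, and such transforms are differentiable. *)
Lemma weierstrass f rho : (forall e : R, 0 < e -> exists2 g, holD g rho &
    forall z, md z < rho -> md (f z - g z) <= e) -> holD f rho.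
Proof.
move=> H a ar.
have rho0 : 0 < rho by apply: le_lt_trans ar; exact: md_ge0.
have cf z : md z < rho -> ccont f z.
  move=> zr e e0; have e4 : 0 < e / 4 by rewrite divr_gt0.
  have [g hg Hg] := H _ e4.
  have [s s0 Hs] := holD_cont hg zr e4.
  exists (Num.min s (rho - md z)); first by rewrite lt_min s0 subr_gt0.
  move=> y; rewrite lt_min => /andP[/Hs ys yz].
  have yr : md y < rho by have := md_lB y z; lra.
  rewrite (_ : f y - f z = (f y - g y) + (g y - g z) - (f z - g z)); last by ring.
  apply: le_lt_trans (mdB _ _) _; apply: le_lt_trans (lerD (mdD _ _) (lexx _)) _.
  by have := Hg _ yr; have := Hg _ zr; lra.
set r := (md a + rho) / 2.
have r0 : 0 < r by rewrite divr_gt0// ltr_wpDl ?md_ge0.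
have rr : r < rho by rewrite /r; lra.
have arr : md a < r by rewrite /r; lra.
have cfc t : rcont (fun t => f (cir r t)) t.
  by apply: circ_cont r0 => y yr; apply: cf; rewrite yr.
have E b : md b < r -> f b = CT r (fun t => f (cir r t)) b.
  move=> br; apply/eqP; rewrite -subr_eq0 -md_eq0 eq_le md_ge0 andbT.
  apply/ler_addgt0Pr => e e0; rewrite add0r.
  set N := 1 + r / (r - md b).
  have N1 : 0 < N by rewrite ltr_wpDr// divr_ge0 ?(ltW r0)// subr_ge0 ltW.
  have [g hg Hg] := H _ (divr_gt0 e0 N1).
  have cgc t : rcont (fun t => g (cir r t)) t.
    by apply: circ_cont r0 => y yr; apply: holD_cont hg _; rewrite yr.
  have Eg := cauchy_formula r0 rr hg br.
  have -> : f b - CT r (fun t => f (cir r t)) b =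
      (f b - g b) - CT r (fun t => f (cir r t) - g (cir r t)) b.
    rewrite -[X in _ = f b - X - _]Eg /CT.
    have -> : intI (fun t => (f (cir r t) - g (cir r t)) * (cir r t / (cir r t - b))) =
        intI (fun t => f (cir r t) * (cir r t / (cir r t - b))) -
        intI (fun t => g (cir r t) * (cir r t / (cir r t - b))).
      rewrite -intIB; try by move=> t; exact: CT_cont.
      by congr intI; apply/funext => t; ring.
    ring.
  apply: le_trans (mdB _ _) _.
  have brho : md b < rho by exact: lt_trans rr.
  have h1 := Hg b brho.
  have h2 : md (CT r (fun t => f (cir r t) - g (cir r t)) b) <= e / N * (r / (r - md b)).
    apply: CT_bound => // [t|t _]; first exact: gcontB (cfc t) (cgc t).
    by apply: Hg; rewrite md_cir.
  have : e / N * N = e by rewrite divfK// lt0r_neq0.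
  by rewrite {2}/N mulrDr mulr1; lra.
have [d Hd] := CT_der r0 arr cfc; exists d.
have k0 : 0 < r - md a by rewrite subr_gt0.
apply: gder_near k0 _ Hd => y /= ya; rewrite E//.
by have := md_lB y a; lra.
Qed.

Lemma cder_shift f z0 z d : cder f (z0 + z) d <-> cder (fun y => f (z0 + y)) z d.
Proof.
have E y : (z0 + y) - (z0 + z) = y - z by ring.
split=> H e /H[s s0 Hs]; exists s => // y.
  by rewrite -(E y) => /Hs.
by have := Hs (y - z0); rewrite /= -(E (y - z0)) (_ : z0 + (y - z0) = y)//; ring.
Qed.

(** On the circle through [z] the real part of [k] is nonpositive and has mean 0. The real part of
    its primitive along the circle is thus monotone with equal values at the ends, hence constant,
    so the real part of [k] vanishes at the parameter 1 / 2. *)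
Lemma max_principle f rho : holD f rho ->
  (forall z, md z < rho -> md (f z) <= md (f 0)) ->
  forall z, md z < rho -> f z = f 0.
Proof.
move=> hf HM z zr.
have [->//|z0] := eqVneq z 0.
have [f00|f00] := eqVneq (f 0) 0.
  by apply/eqP; rewrite f00 -md_eq0 eq_le md_ge0 andbT -(md0 R) -f00 HM.
set r := md z; have r0 : 0 < r by rewrite md_gt0.
(* The rotation by [c] puts [z] at the parameter 1 / 2, which is interior to [0, 1]. *)
set c : C := - (z / r%:C%C).
have rC0 : (r%:C%C : C) != 0 by rewrite -md_gt0 mdR gtr0_norm.
have mdc : md c = 1 by rewrite mdN mdM mdV mdR gtr0_norm// divff// lt0r_neq0.
pose k y := (f 0)^*%C * f (c * y) - (f 0)^*%C * f 0.
have Hc y : md (c * y) = md y by rewrite mdM mdc mul1r.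
have kh : holD k rho.
  move=> y yr; have [|d Hd] := hf (c * y); first by rewrite Hc.
  exists ((f 0)^*%C * (d * (c * 1)) - 0); apply: gderB (gder_cst _ _ _).
  apply: gderZ; apply: (@gder_comp _ _ id (fun y => c * y)) Hd.
  exact: gderZ (gder_id _ _).
set m := md (f 0).
have Rek y : md y < rho -> complex.Re (k y) <= 0.
  move=> yr; rewrite /k.
  have -> : complex.Re ((f 0)^*%C * f (c * y) - (f 0)^*%C * f 0) =
      complex.Re ((f 0)^*%C * f (c * y)) - m ^+ 2.
    by rewrite /m -Re_conjM; case: (_ * f (c * y)) (_ * f 0) => ? ? [].
  rewrite subr_le0; apply: le_trans (ler_norm _) _; apply: le_trans (Re_md _) _.
  by rewrite mdM mdJ expr2 ler_wpM2l ?md_ge0// HM// Hc.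
have kc t : rcont (fun t => k (cir r t)) t.
  by apply: circ_cont r0 => y yr; apply: holD_cont kh _; rewrite yr.
have k0 : k 0 = 0 by rewrite /k mulr0 subrr.
have mv : intI (fun t => k (cir r t)) = 0.
  rewrite -k0 -(cauchy_formula r0 zr kh); last by rewrite md0.
  congr intI; apply/funext => t; rewrite subr0 divff ?mulr1//.
  exact: cir_neq0.
have [G HG] := rcont_primitive kc; rewrite (intI_eq HG) in mv.
have HRG (t : R) : 0 <= t <= 1 -> is_derive t 1 (fun u => complex.Re (G u))
    (complex.Re (k (cir r t))) by move=> /HG/rderP[].
have mono (a b : R) : 0 <= a -> a < b -> b <= 1 -> complex.Re (G b) <= complex.Re (G a).
  move=> a0 ab b1.
  have [||x xab E] := @MVT R (fun u => complex.Re (G u))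
      (fun t => complex.Re (k (cir r t))) a b ab.
  - by move=> x; rewrite in_itv => /= /andP[/ltW ? /ltW ?]; apply: HRG; lra.
  - apply: derivable_within_continuous => x; rewrite in_itv /= => /andP[? ?].
    by have [] := HRG x ltac:(lra).
  rewrite -subr_le0 E mulr_le0_ge0 ?subr_ge0 ?(ltW ab)//.
  by apply: Rek; rewrite md_cir.
have G01 : complex.Re (G 1) = complex.Re (G 0).
  by move: mv => /eqP; rewrite subr_eq0 => /eqP->.
have Gc (t : R) : 0 < t -> t < 1 -> complex.Re (G t) = complex.Re (G 0).
  move=> t0 t1; apply/eqP; rewrite eq_le mono// ?(ltW t1)//=.
  by rewrite -G01 mono// ltW.
have Re0 : complex.Re (k (cir r (1 / 2))) = 0.
  have h12 : (0 : R) <= 1 / 2 <= (1 : R) by lra.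
  have := HRG _ h12 => /is_derive_epsP H.
  apply/eqP; rewrite -normr_eq0 eq_le normr_ge0 andbT; apply/ler_addgt0Pr => e e0.
  rewrite add0r; have /near_R[s s0 Hs] := H e e0.
  set u : R := Num.min (s / 2) (1 / 4).
  have u0 : 0 < u by rewrite lt_min !divr_gt0.
  have us : u < s by rewrite gt_min; apply/orP; left; lra.
  have u4 : u <= 1 / 4 by rewrite ge_min lexx orbT.
  have := Hs (1 / 2 + u); rewrite [1 / 2 + u]addrC addrK gtr0_norm// => /(_ us).
  rewrite !Gc//; try lra.
  by rewrite subrr sub0r normrN normrM (gtr0_norm u0) ler_pM2r.
have cz : c * cir r (1 / 2) = z.
  rewrite /cir /ce.
  have -> : (2 * pi * (1 / 2) : R) = pi by field.
  rewrite cospi sinpi (_ : (-1 +i* 0)%C = -1 :> C); last by apply/eqP; rewrite eq_complex /= oppr0 !eqxx.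
  by rewrite /c; field.
(* [v] has real part m^2 and modulus at most m^2, so it is equal to m^2. *)
set v := (f 0)^*%C * f z.
have vE : k (cir r (1 / 2)) = v - (f 0)^*%C * f 0 by rewrite /k cz.
have mv2 : complex.Re v = m ^+ 2.
  have := Re0; rewrite vE /m -Re_conjM.
  by case: v {vE} (_ * f 0) => ? ? [? ?] /= /eqP; rewrite subr_eq0 => /eqP.
have mdv : md v <= m ^+ 2.
  by rewrite /v mdM mdJ expr2 ler_wpM2l ?md_ge0// HM.
have Imv : complex.Im v = 0.
  move: mdv mv2; case: v {vE} => p q; rewrite /md /= => h pE.
  have m20 : 0 <= m ^+ 2 by rewrite sqr_ge0.
  have : (Num.sqrt (p ^+ 2 + q ^+ 2)) ^+ 2 <= (m ^+ 2) ^+ 2.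
    by rewrite ler_sqr ?nnegrE ?sqrtr_ge0.
  rewrite sqr_sqrtr ?addr_ge0 ?sqr_ge0// -pE gerDl => q0.
  by apply/eqP; rewrite -sqrf_eq0 eq_le q0 sqr_ge0.
have f0E : (f 0)^*%C * f 0 = v.
  apply/eqP; rewrite eq_complex Re_conjM -/m mv2 eqxx Imv /=.
  by case: (f 0) => p q /=; apply/eqP; ring.
have fc0 : (f 0)^*%C != 0 by rewrite conjc_eq0.
by apply: (mulfI fc0); rewrite f0E.
Qed.

Lemma holD_const f rho z : (forall y, md y < rho -> cder f y 0) -> md z < rho ->
  f z = f 0.
Proof.
move=> H zr.
have : f (1%:C%C * z) = f (0%:C%C * z).
  apply: (@rder_const_eq R (fun t => f (t%:C%C * z))) => t /andP[t0 t1].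
  have D : rder (fun t => t%:C%C * z) t (1 * z + t%:C%C * 0).
    exact: gderM (gder_id _ _) (gder_cst _ _ _).
  apply: gder_eq (gder_comp D (H _ _)); first by rewrite mul0r.
  apply: le_lt_trans zr; rewrite mdM mdR ger0_norm// ler_piMl ?md_ge0//.
by rewrite rmorph1 rmorph0 mul1r mul0r.
Qed.

(** Strict differentiability at 0, uniform over pairs of points, because the first Taylor quotient
    is Lipschitz. Injectivity near 0 comes from it. *)
Lemma strict_der f rho d : 0 < rho -> holD f rho -> cder f 0 d ->
  forall e : R, 0 < e -> exists2 s : R, 0 < s & s <= rho /\
  forall a b, md a < s -> md b < s -> md (f a - f b - d * (a - b)) <= e * md (a - b).
Proof.
move=> rho0 hf fd e e0.
set r := rho / 2; have r0 : 0 < r by rewrite divr_gt0.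
have rr : r < rho by rewrite /r; lra.
have [L L0 HL] := @CT_lip r _ r0 (dv_cont r0 rr hf 1).
have E z : md z < r -> f z = f 0 + z * dv f r 1 z.
  move=> zr; rewrite -(dv0 r0 rr hf zr) (dv_step r0 rr hf _ zr).
  by rewrite (dv0 r0 rr hf) ?md0.
have dE : d = dv f r 1 0.
  apply: cder_uniq fd _.
  have r00 : md (0 : C) < r by rewrite md0.
  have [dd Hdd] := dv_hol r0 rr hf 1 r00.
  apply: (@gder_near _ _ _ (fun z => f 0 + z * dv f r 1 z) _ _ _ _ r0).
    by move=> y /=; rewrite subr0 => yr; rewrite -E.
  apply: gder_eq (gderD (gder_cst id (f 0) 0) (gderM (gder_id id 0) Hdd)).
  by rewrite add0r mul1r mul0r addr0.
have L1 : 0 < 2 * L + 1 by lra.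
exists (Num.min (r / 2) (e / (2 * L + 1))); first by rewrite lt_min !divr_gt0.
split; first by rewrite ge_min; apply/orP; left; rewrite /r; lra.
move=> a b; rewrite !lt_min => /andP[ar ae] /andP[br be].
rewrite (E a) ?(E b); try lra.
have -> : f 0 + a * dv f r 1 a - (f 0 + b * dv f r 1 b) - d * (a - b) =
  (a - b) * (dv f r 1 a - d) + b * (dv f r 1 a - dv f r 1 b) by ring.
apply: le_trans (mdD _ _) _; rewrite !mdM dE.
have zr : md (0 : C) <= r / 2 by rewrite md0; lra.
have h1 := HL a 0 (ltW ar) zr; rewrite subr0 in h1.
have h2 := HL a b (ltW ar) (ltW br).
have g1 := ler_wpM2l (md_ge0 (a - b)) h1.
have g2 := ler_wpM2l (md_ge0 b) h2.
move: ae be; rewrite !ltr_pdivlMr// => ae be.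
have g3 : md (a - b) * (L * md a + md b * L) <= md (a - b) * e.
  rewrite ler_wpM2l ?md_ge0//.
  by have := md_ge0 a; have := md_ge0 b; lra.
by move: g1 g2 g3; rewrite /dv; lra.
Qed.

End disc.

(** * Germs of diffeomorphisms *)

Section germs.
Variable R : realType.
Local Notation C := R[i].
Implicit Types (f g h : C -> C).

Lemma sqr_le (x y : R) : 0 <= x -> x <= y -> x ^+ 2 <= y ^+ 2.
Proof. by move=> x0 xy; rewrite !expr2 ler_pM. Qed.

Definition near0 (P : C -> Prop) := exists2 s : R, 0 < s & forall z, md z < s -> P z.

Lemma near0_and P Q : near0 P -> near0 Q -> near0 (fun z => P z /\ Q z).
Proof.
move=> [s s0 Hs] [t t0 Ht]; exists (Num.min s t); first by rewrite lt_min s0.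
by move=> z; rewrite lt_min => /andP[/Hs ? /Ht ?].
Qed.

Lemma near0_sub P Q : near0 P -> (forall z, P z -> Q z) -> near0 Q.
Proof. by move=> [s s0 Hs] PQ; exists s => // z /Hs/PQ. Qed.

Lemma near0_true P : (forall z, P z) -> near0 P.
Proof. by move=> H; exists 1. Qed.

Lemma near0_at0 P : near0 P -> P 0.
Proof. by move=> [s s0 Hs]; apply: Hs; rewrite md0. Qed.

(** [f] represents an element of Diff(C, 0) with multiplier [d]. *)
Definition germ f d :=
  [/\ f 0 = 0, exists2 r : R, 0 < r & holD f r, cder f 0 d & d != 0].

Lemma germ_id : germ id 1.
Proof.
split; [by []| |exact: gder_id|exact: oner_neq0].
by exists 1 => // z _; exists 1; exact: gder_id.
Qed.

Lemma germ_cont f d e : germ f d -> 0 < e -> near0 (fun z => md (f z) < e).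
Proof.
move=> [f0 _ fd _] e0; have [s s0 Hs] := gder_cont fd e0.
by exists s => // z zs; have := Hs z; rewrite f0 !subr0; apply.
Qed.

Lemma germ_near f d P : germ f d -> near0 P -> near0 (fun z => P (f z)).
Proof.
move=> fd [s s0 Hs]; have [t t0 Ht] := germ_cont fd s0.
by exists t => // z /Ht/Hs.
Qed.

Lemma germ_eq f g d : germ f d -> near0 (fun z => f z = g z) -> germ g d.
Proof.
move=> [f0 [r r0 fr] fd d0] E; have g0 := near0_at0 E; case: E => s s0 E.
have s0' : 0 < Num.min s r by rewrite lt_min s0.
split => //; first by rewrite -g0.
  exists (Num.min s r) => // z; rewrite lt_min => /andP[zs /fr[dz Hz]].
  exists dz; have k0 : 0 < s - md z by rewrite subr_gt0.
  by apply: gder_near k0 _ Hz => y /= yz; apply: E; have := md_lB y z; lra.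
by apply: gder_near s0 _ fd => y /=; rewrite subr0; exact: E.
Qed.

Lemma germ_comp f g a b : germ f a -> germ g b -> germ (fun z => f (g z)) (a * b).
Proof.
move=> fa gb; have [f0 [r r0 fr] fd a0] := fa; have [g0 [t t0 gt] gd b0] := gb.
have [u u0 Hu] := germ_cont gb r0.
split; first by rewrite g0.
- exists (Num.min t u); first by rewrite lt_min t0.
  move=> z; rewrite lt_min => /andP[/gt[dz Hz] /Hu/fr[df Hf]].
  by exists (df * dz); exact: (gder_comp Hz Hf).
- by apply: (gder_comp gd); rewrite g0.
- by rewrite mulf_neq0.
Qed.

(** The inverse function theorem: for small [y] the map z - (f z - y) / d contracts by 1 / 2 thanks
    to [strict_der], and its fixed point is the preimage of [y]. *)
Lemma germ_inv f d : germ f d -> exists g,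
  [/\ germ g d^-1, near0 (fun y => f (g y) = y) & near0 (fun z => g (f z) = z)].
Proof.
move=> fd; have [f0 [r r0 fr] fdd d0] := fd.
have D0 : 0 < md d by rewrite md_gt0.
have D2 : 0 < md d / 2 by rewrite divr_gt0.
have [s s0 [sr Hs]] := strict_der r0 fr fdd D2.
have inj a b : md a < s -> md b < s -> md d / 2 * md (a - b) <= md (f a - f b).
  move=> ha hb; have := Hs a b ha hb.
  have := md_lB (d * (a - b)) (f a - f b).
  by rewrite (mdBC (d * (a - b))) mdM; lra.
(* The first iterate has modulus k < s / 4, and [geometric_complex] puts the limit within 4 k of 0,
   so still in the disc of radius [s]. *)
have ex y : md y < md d * s / 4 -> exists2 z, md z < s & f z = y.
  move=> ys.
  pose T z := z - (f z - y) / d.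
  have TT a b : md a < s -> md b < s -> md (T a - T b) <= md (a - b) * (1 / 2).
    move=> ha hb; rewrite /T.
    have -> : a - (f a - y) / d - (b - (f b - y) / d) =
      - ((f a - f b - d * (a - b)) / d) by field.
    rewrite mdN mdM mdV ler_pdivrMr//; apply: le_trans (Hs _ _ ha hb) _; lra.
  pose k := md y / md d.
  have k0 : 0 <= k by rewrite divr_ge0 ?md_ge0.
  have ks : k < s / 4 by rewrite ltr_pdivrMr//; lra.
  pose u n := iter n T 0.
  have T0 : md (T 0) = k by rewrite /T f0 !sub0r mulNr opprK mdM mdV.
  have pw n : 0 < (1 / 2 : R) ^+ n by rewrite exprn_gt0//; lra.
  have lt2k x (p : R) : 0 < p -> x <= 2 * k * (1 - p) -> x < s.
    by move=> p0; have := mulr_ge0 k0 (ltW p0); lra.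
  have key n : md (u n) <= 2 * k * (1 - (1 / 2) ^+ n) /\
      md (u n.+1 - u n) <= k * (1 / 2) ^+ n.
    elim: n => [|n [IH1 IH2]].
      have [u0 u1] : u 0%N = 0 /\ u 1%N = T 0 by [].
      by rewrite u1 u0 subr0 T0 expr0 md0; lra.
    have h1 : md (u n.+1) <= 2 * k * (1 - (1 / 2) ^+ n.+1).
      by have := mdD (u n.+1 - u n) (u n); rewrite subrK exprS; lra.
    split=> //; rewrite exprSr mulrA.
    apply: (@le_trans _ _ (md (u n.+1 - u n) * (1 / 2))).
      by apply: TT; [exact: lt2k h1|exact: lt2k IH1].
    by lra.
  have q01 : (0 : R) <= 1 / 2 < (1 : R) by lra.
  have [l Hl] := @geometric_complex R u k _ q01 (fun n => (key n).2).
  have ls : md l < s.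
    have := Hl 0%N; rewrite /u /= expr0 sub0r mdN mulr1.
    by rewrite (_ : 2 * (k / (1 - 1 / 2)) = 4 * k); [lra|field].
  exists l => //.
  have Tl : T l = l.
    apply/eqP; rewrite -subr_eq0 -md_eq0 eq_le md_ge0 andbT.
    apply/ler_addgt0Pr => e e0; rewrite add0r.
    have [n Hn] := small_geometric (2 * (2 * (k / (1 - 1 / 2)))) q01 e0.
    apply: le_trans (ltW Hn).
    have us : md (u n) < s by exact: lt2k (key n).1.
    have h1 := TT _ _ us ls.
    have h2 := Hl n; have h3 := Hl n.+1.
    have := mdB (u n.+1 - l) (u n.+1 - T l).
    rewrite (_ : u n.+1 - l - _ = T l - l); last by ring.
    have -> : u n.+1 - T l = T (u n) - T l by [].
    by move: h3; rewrite exprS; have := md_ge0 (u n - l); lra.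
  move: Tl => /eqP; rewrite /T -subr_eq0 addrC addKr oppr_eq0 mulf_eq0 invr_eq0.
  by rewrite (negbTE d0) orbF subr_eq0 => /eqP.
pose g y := xget 0 [set z | md z < s /\ f z = y].
have gP y : md y < md d * s / 4 -> md (g y) < s /\ f (g y) = y.
  by move=> /ex[z zs fz]; rewrite /g; case: xgetP => [x _ //|/(_ z)[]].
have gf z : md z < s -> md (f z) < md d * s / 4 -> g (f z) = z.
  move=> zs /gP[h1 h2]; apply/eqP; rewrite -subr_eq0 -md_eq0.
  have := inj _ _ h1 zs; rewrite h2 subrr md0 pmulr_rle0// => h.
  by rewrite eq_le h md_ge0.
have t0 : 0 < md d * s / 4 by rewrite divr_gt0// mulr_gt0.
have g0 : g 0 = 0 by rewrite -{1}f0 gf ?md0 ?f0 ?md0.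
have gder y dy : md y < md d * s / 4 -> cder f (g y) dy -> dy != 0 ->
    cder g y dy^-1.
  move=> yt Hdy dy0 e e0; have [gys fgy] := gP y yt.
  have m0 : 0 < md dy by rewrite md_gt0.
  have [w w0 Hw] := Hdy (e * md dy * (md d / 2)) ltac:(by rewrite !mulr_gt0).
  exists (Num.min (md d * s / 4 - md y) (w * (md d / 2))).
    by rewrite lt_min subr_gt0 yt mulr_gt0.
  move=> y'; rewrite lt_min => /andP[/= h1 h2].
  have y't : md y' < md d * s / 4 by have := md_lB y' y; lra.
  have [gys' fgy'] := gP y' y't.
  have lip := inj _ _ gys' gys; rewrite fgy fgy' in lip.
  have gw : md (g y' - g y) < w.
    by rewrite -(ltr_pM2l D2) [ltRHS]mulrC; exact: le_lt_trans h2.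
  have := Hw _ gw; rewrite fgy fgy' /= => h3.
  have -> : g y' - g y - dy^-1 * (y' - y) =
    - ((y' - y - dy * (g y' - g y)) / dy) by field.
  rewrite mdN mdM mdV ler_pdivrMr//; apply: le_trans h3 _.
  have := ler_wpM2l (ltW (mulr_gt0 e0 m0)) lip.
  by rewrite !mulrA; lra.
(* A zero derivative at [a] would contradict the lower Lipschitz bound [inj]. *)
have nz a da : md a < s -> cder f a da -> da != 0.
  move=> ha Hda; apply/eqP => da0; rewrite da0 in Hda.
  have [w w0 Hw] := Hda (md d / 4) ltac:(by rewrite divr_gt0).
  pose h : R := Num.min w (s - md a) / 2.
  have h0 : 0 < Num.min w (s - md a) by rewrite lt_min w0 subr_gt0.
  have hp : 0 < h by rewrite divr_gt0.
  have : h < Num.min w (s - md a) by rewrite /h; lra.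
  rewrite lt_min => /andP[hw hs].
  have E : md (a + h%:C%C - a) = h by rewrite addrC addKr mdR gtr0_norm.
  have ah : md (a + h%:C%C) < s.
    by have := mdD a h%:C%C; rewrite mdR gtr0_norm//; lra.
  have := Hw (a + h%:C%C); rewrite /= E => /(_ hw); rewrite mul0r subr0.
  have := inj _ _ ah ha; rewrite E.
  by have := mulr_gt0 D0 hp; lra.
exists g; split.
- split=> //; last by rewrite invr_eq0.
  + exists (md d * s / 4) => // y yt; have [gys _] := gP y yt.
    have [da Hda] := fr _ (lt_le_trans gys sr).
    by exists da^-1; apply: gder => //; exact: nz Hda.
  + by apply: gder => //; rewrite ?md0 ?g0.
- by exists (md d * s / 4) => // y /gP[].
- have [t tp Ht] := germ_cont fd t0; exists (Num.min s t).
    by rewrite lt_min s0.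
  by move=> z; rewrite lt_min => /andP[zs /Ht zt]; exact: gf.
Qed.

Lemma germ_deriv_uniq f a b : germ f a -> germ f b -> a = b.
Proof. by move=> [_ _ fa _] [_ _ fb _]; exact: cder_uniq fa fb. Qed.

Lemma germ_deriv_eq f g a b : germ f a -> germ g b ->
  near0 (fun z => f z = g z) -> a = b.
Proof. by move=> fa gb E; apply: germ_deriv_uniq gb; exact: germ_eq E. Qed.

Lemma bigO_pos f n : bigO f n -> exists2 K : R, 0 <= K &
  near0 (fun z => md (f z) <= K * md z ^+ n).
Proof.
move=> [K [s s0 Hs]]; exists `|K| => //; exists s => // z /Hs /le_trans; apply.
by rewrite ler_wpM2r ?exprn_ge0 ?md_ge0// ler_norm.
Qed.

Lemma bigO_eq f g n : bigO f n -> near0 (fun z => f z = g z) -> bigO g n.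
Proof.
move=> [K [s s0 Hs]] [t t0 Ht]; exists K, (Num.min s t).
  by rewrite lt_min s0.
by move=> z; rewrite lt_min => /andP[/Hs h /Ht <-].
Qed.

Lemma bigOD f g n : bigO f n -> bigO g n -> bigO (fun z => f z + g z) n.
Proof.
move=> [K [s s0 Hs]] [L [t t0 Ht]]; exists (K + L), (Num.min s t).
  by rewrite lt_min s0.
move=> z; rewrite lt_min => /andP[/Hs h /Ht h'].
by apply: le_trans (mdD _ _) _; rewrite mulrDl lerD.
Qed.

Lemma bigOZ f n c : bigO f n -> bigO (fun z => c * f z) n.
Proof.
move=> [K [s s0 Hs]]; exists (md c * K), s => // z /Hs h.
by rewrite mdM -mulrA ler_wpM2l ?md_ge0.
Qed.

Lemma bigOB f g n : bigO f n -> bigO g n -> bigO (fun z => f z - g z) n.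
Proof.
move=> hf /(bigOZ (- 1)) hg; apply: bigO_eq (bigOD hf hg) _.
by apply: near0_true => z; rewrite mulN1r.
Qed.

Lemma bigOM f g n m : bigO f n -> bigO g m -> bigO (fun z => f z * g z) (n + m).
Proof.
move=> /bigO_pos[K K0 [s s0 Hs]] /bigO_pos[L L0 [t t0 Ht]].
exists (K * L), (Num.min s t); first by rewrite lt_min s0.
move=> z; rewrite lt_min => /andP[/Hs h /Ht h'].
by rewrite mdM exprD mulrACA ler_pM ?md_ge0.
Qed.

Lemma bigO_le f n m : (m <= n)%N -> bigO f n -> bigO f m.
Proof.
move=> mn /bigO_pos[K K0 [s s0 Hs]]; exists K, (Num.min s 1).
  by rewrite lt_min s0 ltr01.
move=> z; rewrite lt_min => /andP[/Hs h z1]; apply: le_trans h _.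
by rewrite ler_wpM2l// ler_wiXn2l ?md_ge0// ltW.
Qed.

Lemma bigOX n : bigO (fun z : C => z ^+ n) n.
Proof. by exists 1, 1 => // z _; rewrite mul1r mdX. Qed.

Lemma bigO_comp f g d n : germ g d -> bigO f n -> bigO (fun z => f (g z)) n.
Proof.
move=> gd /bigO_pos[K K0 Hf].
have [_ _ gdd _] := gd; have [s s0 Hs] := gder_lip gdd.
have [t t0 Ht] := germ_near gd Hf.
have [g0 _ _ _] := gd.
exists (K * (md d + 1) ^+ n), (Num.min s t); first by rewrite lt_min s0.
move=> z; rewrite lt_min => /andP[zs /Ht h]; apply: le_trans h _.
rewrite -mulrA -exprMn ler_wpM2l// lerXn2r ?nnegrE ?md_ge0 ?mulr_ge0 ?addr_ge0 ?md_ge0//.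
by have := Hs z; rewrite /= g0 !subr0; apply.
Qed.

Lemma bigO_uniq (c : C) n : bigO (fun z => c * z ^+ n) n.+1 -> c = 0.
Proof.
move=> /bigO_pos[K K0 [s s0 Hs]]; apply/eqP; rewrite -md_eq0 eq_le md_ge0 andbT.
apply/ler_addgt0Pr => e e0; rewrite add0r.
have K1 : 0 < K + 1 by lra.
pose y : R := Num.min (s / 2) (e / (K + 1)).
have y0 : 0 < y by rewrite lt_min !divr_gt0.
have ys : y < s by rewrite gt_min; apply/orP; left; lra.
have ye : y * (K + 1) <= e by rewrite -ler_pdivlMr// ge_min lexx orbT.
have := Hs y%:C%C; rewrite mdM mdX mdR gtr0_norm// => /(_ ys).
rewrite exprS mulrA ler_pM2r ?exprn_gt0//; lra.
Qed.

Lemma germ_bigO1 f d : germ f d -> bigO f 1.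
Proof.
move=> [f0 _ fdd _]; have [s s0 Hs] := gder_lip fdd; exists (md d + 1), s => // z zs.
by have := Hs z; rewrite f0 /= !subr0 expr1; apply.
Qed.

Lemma germ_bigO2 f d : germ f d -> bigO (fun z => f z - d * z) 2.
Proof.
move=> fd; have [f0 [r r0 fr] fdd d0] := fd.
have r2 : 0 < r / 2 by rewrite divr_gt0.
have rr : r / 2 < r by lra.
have [b [K K0 HK]] := dv_taylor r2 rr fr (germ_bigO1 fd).
suff bd : b = d.
  exists K, (r / 4); first by rewrite divr_gt0.
  by move=> z zr; have := HK z; rewrite expr1 bd; apply; lra.
apply: cder_uniq fdd => e e0.
have K1 : 0 < K + 1 by lra.
exists (Num.min (r / 4) (e / (K + 1))); first by rewrite lt_min !divr_gt0.
move=> z /=; rewrite !subr0 f0 subr0 lt_min => /andP[zr].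
rewrite ltr_pdivlMr// => ze.
have := HK z; rewrite expr1 => /(_ ltac:(lra)) /le_trans; apply.
rewrite expr2 mulrA ler_wpM2r ?md_ge0//.
by have := md_ge0 z; lra.
Qed.

Lemma bigOX_sub f d n : germ f d -> bigO (fun z => f z ^+ n - d ^+ n * z ^+ n) n.+1.
Proof.
move=> fd; elim: n => [|n IH].
  by exists 0, 1 => // z _; rewrite !expr0 mulr1 subrr md0 mul0r.
have h1 : bigO (fun z => f z ^+ n * (f z - d * z)) (n + 2).
  apply: bigOM (germ_bigO2 fd); exact: bigO_comp fd (bigOX n).
have h2 := bigOZ d (bigOM (bigOX 1) IH).
rewrite addn2 in h1; rewrite add1n in h2.
apply: bigO_eq (bigOD h1 h2) _; apply: near0_true => z.
by rewrite expr1 !exprS; ring.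
Qed.

(* Koenigs: [psi] is the limit of [mu^-n h^n]. *)
Lemma koenigs h hc mu lam : germ h mu -> germ hc lam ->
  near0 (fun z => h (hc z) = hc (h z)) -> md mu < 1 ->
  exists2 psi, germ psi 1 & near0 (fun z => psi (hc z) = lam * psi z).
Proof.
move=> hmu hlam [sc sc0 Hsc] mu1.
have [h0 [rh rh0 hh] hd mu0] := hmu.
have [K K0 [s s0 Hs]] := bigO_pos (germ_bigO2 hmu).
have [K' K'0 [s' s'0 Hs']] := bigO_pos (germ_bigO2 hlam).
have m0 : 0 < md mu by rewrite md_gt0.
(* The contraction rate [ro] of [h] is taken strictly between |mu| and its square root. Then q =
   ro^2 / |mu| is less than 1, so the quadratic error at h^n z, once divided by mu^n, is
   summable. *)
pose sig := Num.sqrt (md mu).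
have sigE : sig ^+ 2 = md mu by rewrite sqr_sqrtr// ltW.
have sig0 : 0 < sig by rewrite sqrtr_gt0.
have sig1 : sig < 1 by rewrite -(sqrtr1 R) ltr_sqrt.
have sig2 : sig ^+ 2 < sig by rewrite expr2 gtr_pMr.
pose ro := (sig ^+ 2 + sig) / 2.
have ro_s : ro < sig by rewrite /ro; lra.
have ro_s2 : sig ^+ 2 < ro by rewrite /ro; lra.
have ro0 : 0 < ro by apply: lt_trans ro_s2; rewrite exprn_gt0.
have ro1 : ro < 1 by lra.
have K1 : 0 < K + 1 by lra.
pose r1 := Num.min (Num.min (Num.min s rh) (Num.min s' sc)) ((ro - sig ^+ 2) / (K + 1)).
have r10 : 0 < r1 by rewrite !lt_min s0 rh0 s'0 sc0 divr_gt0// subr_gt0.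
have r1P z : md z < r1 -> [/\ md z < s, md z < rh, md z < s', md z < sc &
    K * md z <= ro - sig ^+ 2].
  rewrite !lt_min => /andP[/andP[/andP[? ?] /andP[? ?]]].
  by rewrite ltr_pdivlMr// => ?; split => //; have := md_ge0 z; lra.
have hro z : md z < r1 -> md (h z) <= ro * md z.
  move=> /r1P[zs _ _ _ zK].
  have := mdD (h z - mu * z) (mu * z); rewrite subrK mdM -sigE.
  have := Hs z zs; rewrite expr2 mulrA.
  by have := ler_wpM2r (md_ge0 z) zK; lra.
have orb n z : md z < r1 -> md (iter n h z) <= ro ^+ n * md z /\ md (iter n h z) < r1.
  move=> zr; elim: n => [|n [IH1 IH2]]; first by rewrite expr0 mul1r.
  have h1 : md (iter n.+1 h z) <= ro ^+ n.+1 * md z.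
    rewrite iterS exprS -mulrA; apply: le_trans (hro _ IH2) _.
    by rewrite ler_wpM2l// ltW.
  split=> //; apply: le_lt_trans h1 (le_lt_trans _ zr).
  by rewrite ler_piMl ?md_ge0// exprn_ile1 ?ltW.
pose u n z := mu ^- n * iter n h z.
pose q := (ro / sig) ^+ 2.
have q01 : 0 <= q < 1.
  have rs : 0 <= ro / sig by rewrite divr_ge0 ?(ltW ro0) ?(ltW sig0).
  by rewrite /q exprn_ge0//= expr_lt1// ltr_pdivrMr// mul1r.
have qE n : ro ^+ n * ro ^+ n / md mu ^+ n = q ^+ n.
  by rewrite /q -sigE -exprMn -expr2 -expr_div_n -expr_div_n.
have ustep n z : md z < r1 ->
    md (u n.+1 z - u n z) <= K * md z ^+ 2 / md mu * q ^+ n.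
  move=> zr; have [w1 w2] := orb n z zr; have [ws _ _ _ _] := r1P _ w2.
  have mun : mu ^+ n != 0 by rewrite expf_neq0.
  have -> : u n.+1 z - u n z = (h (iter n h z) - mu * iter n h z) / (mu * mu ^+ n).
    by rewrite /u iterS exprS; field; rewrite mu0 mun.
  rewrite mdM mdV mdM mdX ler_pdivrMr ?mulr_gt0 ?exprn_gt0//.
  apply: le_trans (Hs _ ws) _.
  have -> : K * md z ^+ 2 / md mu * q ^+ n * (md mu * md mu ^+ n) =
      K * ((ro ^+ n * md z) ^+ 2).
    have mn0 : md mu ^+ n != 0 by rewrite expf_neq0// lt0r_neq0.
    by rewrite -qE; field; rewrite mn0 lt0r_neq0.
  by rewrite ler_wpM2l// sqr_le ?md_ge0.
pose B := 2 * (K / md mu / (1 - q)).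
have psi_ex z : exists l, md z < r1 -> forall n, md (u n z - l) <= B * md z ^+ 2 * q ^+ n.
  have [zr|zr] := ltrP (md z) r1; last by exists 0.
  have [l Hl] := geometric_complex q01 (fun n => ustep n z zr).
  exists l => _ n; apply: le_trans (Hl n) _; rewrite /B le_eqVlt; apply/orP; left.
  by apply/eqP; ring.
have [psi Hpsi] := choice psi_ex.
have q1' : 0 < 1 - q by case/andP: q01 => _ q1; rewrite subr_gt0.
have B0 : 0 <= B by rewrite /B !mulr_ge0// ?invr_ge0 ?(ltW m0) ?(ltW q1').
have psi0 : psi 0 = 0.
  have := Hpsi 0; rewrite md0 => /(_ r10 0%N).
  rewrite /u /= expr0 invr1 mul1r sub0r mdN expr2 mulr0 mulr0 mul0r => le0.
  by apply/eqP; rewrite -md_eq0 eq_le le0 md_ge0.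
have psih : holD psi r1.
  apply: weierstrass => e e0.
  have [n Hn] := small_geometric (B * r1 ^+ 2) q01 e0.
  exists (u n).
    move=> z zr; suff [d Hd] : exists d, cder (iter n h) z d.
      by exists (mu ^- n * d); exact: gderZ.
    elim: n {Hn} => [|n [d Hd]]; first by exists 1; exact: gder_id.
    have [_ w2] := orb n z zr; have [_ wrh _ _ _] := r1P _ w2.
    have [d' Hd'] := hh _ wrh.
    by exists (d' * d); exact: (gder_comp Hd Hd').
  move=> z zr; rewrite mdBC; apply: le_trans (Hpsi z zr n) _; apply: le_trans (ltW Hn).
  have q0 : 0 <= q by case/andP: q01.
  apply: ler_wpM2r; first exact: exprn_ge0.
  by rewrite ler_wpM2l// sqr_le ?md_ge0// ltW.
exists psi.
  split => //; first by exists r1.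
  move=> e e0; have B1 : 0 < B + 1 by lra.
  exists (Num.min r1 (e / (B + 1))); first by rewrite lt_min r10 divr_gt0.
  move=> z /=; rewrite psi0 !subr0 mul1r lt_min ltr_pdivlMr// => /andP[zr ze].
  have := Hpsi z zr 0%N; rewrite /u /= !expr0 invr1 mul1r mulr1 mdBC.
  move=> /le_trans; apply; rewrite expr2 mulrA ler_wpM2r ?md_ge0//.
  by have := md_ge0 z; lra.
have [t t0 Ht] := germ_cont hlam r10.
exists (Num.min r1 t); first by rewrite lt_min r10.
move=> z; rewrite lt_min => /andP[zr /Ht hcr].
have comm n : iter n h (hc z) = hc (iter n h z).
  elim: n => // n IH; rewrite !iterS IH; apply: Hsc.
  by have [_ w2] := orb n z zr; have [] := r1P _ w2.
apply/eqP; rewrite -subr_eq0 -md_eq0 eq_le md_ge0 andbT; apply/ler_addgt0Pr => e e0.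
rewrite add0r.
(* By commutation the defect at stage n is that of [hc] at the point h^n z, quadratically small
   there, divided by mu^n. With the errors of approximation of [psi] at [z] and at [hc z], the total
   is at most A q^n. *)
pose A := B * md (hc z) ^+ 2 + K' * md z ^+ 2 + md lam * (B * md z ^+ 2).
have [n Hn] := small_geometric A q01 e0.
apply: le_trans (ltW Hn).
have [w1 w2] := orb n z zr; have [_ _ ws' _ _] := r1P _ w2.
have -> : psi (hc z) - lam * psi z = (u n (hc z) - lam * u n z)
  - (u n (hc z) - psi (hc z)) + lam * (u n z - psi z) by ring.
apply: le_trans (mdD _ _) _; apply: le_trans (lerD (mdB _ _) (lexx _)) _.
rewrite (mdM lam (u n z - psi z)).
have g1 := Hpsi _ hcr n.
have g2 := ler_wpM2l (md_ge0 lam) (Hpsi _ zr n).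
have g3 : md (u n (hc z) - lam * u n z) <= K' * md z ^+ 2 * q ^+ n.
  have -> : u n (hc z) - lam * u n z = (hc (iter n h z) - lam * iter n h z) / mu ^+ n.
    by rewrite /u comm; ring.
  rewrite mdM mdV mdX ler_pdivrMr ?exprn_gt0//; apply: le_trans (Hs' _ ws') _.
  have -> : K' * md z ^+ 2 * q ^+ n * md mu ^+ n = K' * (ro ^+ n * md z) ^+ 2.
    have mn0 : md mu ^+ n != 0 by rewrite expf_neq0// lt0r_neq0.
    by rewrite -qE; field.
  by rewrite ler_wpM2l// sqr_le ?md_ge0.
by rewrite /A !mulrDl; move: g1 g2 g3; rewrite -!mulrA; lra.
Qed.

Lemma holD_sub f g r : holD f r -> holD g r -> holD (fun z => f z - g z) r.
Proof.
move=> hf hg z zr; have [a Ha] := hf z zr; have [b Hb] := hg z zr.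
by exists (a - b); exact: gderB.
Qed.

Lemma germ_taylor f g a b n c : germ f a -> germ g b ->
  bigO (fun z => f z - c * g z) n ->
  exists d, bigO (fun z => f z - c * g z - d * z ^+ n) n.+1.
Proof.
move=> [_ [r r0 fr] _ _] [_ [s s0 gs] _ _] On.
pose t := Num.min r s.
have t0 : 0 < t by rewrite lt_min r0.
have H : holD (fun z => f z - c * g z) t.
  apply: holD_sub; first by apply: holD_le fr; rewrite ge_min lexx.
  move=> z; rewrite lt_min => /andP[_ /gs[d Hd]]; exists (c * d); exact: gderZ.
have t2 : 0 < t / 2 by rewrite divr_gt0.
have tt : t / 2 < t by lra.
have [d [K K0 HK]] := dv_taylor t2 tt H On.
exists d, K, (t / 4); first by rewrite divr_gt0.
by move=> z zt; apply: HK; lra.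
Qed.

Lemma germ_addX f d a n : germ f d -> germ (fun z => f z + a * z ^+ n.+2) d.
Proof.
move=> [f0 [r r0 fr] fd d0].
have D z : cder (fun z => a * z ^+ n.+2) z (a * (n.+2%:R * z ^+ n.+1 * 1)).
  exact: gderZ (gderX n.+2 (gder_id id z)).
split => //; first by rewrite f0 add0r expr0n mulr0.
  exists r => // z /fr[e He]; exists (e + a * (n.+2%:R * z ^+ n.+1 * 1)).
  exact: gderD He (D z).
by apply: gder_eq (gderD fd (D 0)); rewrite expr0n /= mulr0 mul0r mulr0 addr0.
Qed.

(** Adding a z^N to [psi] changes the defect of order N at [i] by a (m_i^N - m_i). The number a is
    chosen to cancel the defect at [c], where this factor is nonzero; commutation with [h c] then
    forces the defects at all [i] to vanish. *)
Lemma commuting_jets (I : Type) (h : I -> C -> C) (m : I -> C) (c : I) :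
  (forall i, germ (h i) (m i)) ->
  (forall i j, near0 (fun z => h i (h j z) = h j (h i z))) ->
  (forall n, (0 < n)%N -> m c ^+ n != 1) ->
  forall n, exists2 psi, germ psi 1 &
    forall i, bigO (fun z => psi (h i z) - m i * psi z) n.+2.
Proof.
move=> hg hc irr; elim=> [|n [psi pg IH]].
  by exists id; [exact: germ_id|move=> i; exact: germ_bigO2].
have hm i := germ_comp pg (hg i).
have /choice[d Hd] i := germ_taylor (hm i) pg (IH i).
set N := n.+2 in IH Hd *.
have mc0 : m c != 0 by case: (hg c).
have irr' : m c ^+ N - m c != 0.
  have -> : m c ^+ N - m c = m c * (m c ^+ n.+1 - 1) by rewrite /N exprS; ring.
  rewrite mulf_neq0// subr_eq0.
  exact: irr.
pose a := - d c / (m c ^+ N - m c).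
pose psi' z := psi z + a * z ^+ N.
have pg' : germ psi' 1 by exact: germ_addX.
have F i : bigO (fun z => psi' (h i z) - m i * psi' z -
    (d i + a * (m i ^+ N - m i)) * z ^+ N) N.+1.
  apply: bigO_eq (bigOD (Hd i) (bigOZ a (bigOX_sub N (hg i)))) _.
  by apply: near0_true => z; rewrite /psi'; ring.
set d' := fun i => d i + a * (m i ^+ N - m i).
have d'c : d' c = 0 by rewrite /d' /a divfK// addrN.
have Fc : bigO (fun z => psi' (h c z) - m c * psi' z) N.+1.
  apply: bigO_eq (F c) _; apply: near0_true => z.
  by rewrite -/(d' c) d'c mul0r subr0.
exists psi' => // i; have := F i; rewrite -/(d' i) => Fi.
suff d'i : d' i = 0.
  apply: bigO_eq Fi _; apply: near0_true => z.
  by rewrite d'i mul0r subr0.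
(* The terms of order N in psi' after h_i after h_c and in psi' after h_c after h_i are compared:
   [d' i] gets the factor m_c^N in the first and m_c in the second. *)
have key : bigO (fun z => d' i * (m c ^+ N - m c) * z ^+ N) N.+1.
  have e1 := bigOZ (m i) Fc.
  have e2 := bigO_comp (hg c) Fi.
  have e3 := bigOZ (d' i) (bigOX_sub N (hg c)).
  have e4 := bigOZ (m c) Fi.
  have e5 := bigO_comp (hg i) Fc.
  apply: bigO_eq (bigOB (bigOD e4 e5) (bigOD (bigOD e1 e2) e3)) _.
  by apply: near0_sub (hc i c) _ => z E; rewrite E; ring.
have := bigO_uniq key => /eqP; rewrite mulf_eq0 (negbTE irr') orbF.
by move/eqP.
Qed.

(** The coefficient b(z) is the limit of w^-i V(z, w) as w tends to 0, uniformly in z, hence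
    holomorphic by [weierstrass]. *)
Lemma two_variable_taylor (V : C -> C -> C) (rho M K : R) i : 0 < rho -> 0 <= K ->
  (forall z w, md z < rho -> md w < rho -> md (V z w) <= M) ->
  (forall w, md w < rho -> holD (V^~ w) rho) ->
  (forall z, md z < rho -> holD (V z) rho) ->
  (forall z w, md z < rho -> md w < rho -> md (V z w) <= K * md w ^+ i) ->
  exists2 b, holD b rho & exists2 K' : R, 0 <= K' &
    forall z w, md z < rho -> md w <= rho / 4 ->
      md (V z w - b z * w ^+ i) <= K' * md w ^+ i.+1.
Proof.
move=> rho0 K0 HM hz hw HO.
set r := rho / 2.
have r0 : 0 < r by rewrite divr_gt0.
have rr : r < rho by rewrite /r; lra.
pose b z := dv (V z) r i 0.
have O z : md z < rho -> bigO (V z) i.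
  by move=> zr; exists K, rho => // w wr; exact: HO.
have M0 : 0 <= M.
  by apply: le_trans (md_ge0 _) (HM 0 0 _ _); rewrite md0.
set K' := M / r ^+ i.+1 * (r / (r / 2)).
have K'0 : 0 <= K'.
  have rg := ltW r0; have r2 : 0 <= r / 2 by rewrite divr_ge0.
  by apply: mulr_ge0; apply: divr_ge0 => //; rewrite exprn_ge0.
have E z w : md z < rho -> md w < r ->
    V z w = b z * w ^+ i + w ^+ i.+1 * dv (V z) r i.+1 w.
  move=> zr wr; rewrite (bigO_dv r0 rr (hw z zr) (O z zr) wr).
  by rewrite (dv_step r0 rr (hw z zr) _ wr) /b exprSr; ring.
have bd z w : md z < rho -> md w <= rho / 4 -> md (dv (V z) r i.+1 w) <= K'.
  move=> zr wr; have wr' : md w < r by rewrite /r; lra.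
  apply: le_trans (dv_bound r0 rr (hw z zr) _ _ wr') _.
    by move=> y yr; apply: HM => //; rewrite yr.
  have ri : 0 < r ^+ i.+1 by rewrite exprn_gt0.
  rewrite ler_wpM2l ?divr_ge0 ?(ltW ri)// ler_wpM2l ?(ltW r0)//.
  by rewrite lef_pV2 ?posrE ?divr_gt0 ?subr_gt0//; rewrite /r; lra.
have main z w : md z < rho -> md w <= rho / 4 ->
    md (V z w - b z * w ^+ i) <= K' * md w ^+ i.+1.
  move=> zr wr; have wr' : md w < r by rewrite /r; lra.
  rewrite (E z w zr wr') addrC addKr mdM mdX mulrC ler_wpM2r ?exprn_ge0 ?md_ge0//.
  exact: bd.
exists b; last by exists K'.
apply: weierstrass => e e0.
have K1 : 0 < K' + 1 by lra.
pose t : R := Num.min (rho / 4) (e / (K' + 1)).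
have t0 : 0 < t by rewrite lt_min !divr_gt0.
have t4 : t <= rho / 4 by rewrite ge_min lexx.
have te : t * (K' + 1) <= e by rewrite -ler_pdivlMr// ge_min lexx orbT.
pose w : C := t%:C%C.
have wt : md w = t by rewrite mdR gtr0_norm.
have w0 : w != 0 by rewrite -md_gt0 wt.
have wr : md w < rho by rewrite wt; lra.
exists (fun z => w ^- i * V z w).
  by move=> z zr; have [d Hd] := hz w wr z zr; exists (w ^- i * d); exact: gderZ.
move=> z zr; have wi : w ^+ i != 0 by rewrite expf_neq0.
have -> : b z - w ^- i * V z w = - ((V z w - b z * w ^+ i) / w ^+ i) by field.
rewrite mdN mdM mdV mdX ler_pdivrMr ?exprn_gt0 ?wt//.
have := main z w zr; rewrite wt => /(_ t4) /le_trans; apply.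
by rewrite exprS mulrA ler_wpM2r ?exprn_ge0 ?(ltW t0)//; lra.
Qed.

End germs.

(** * Charts of the surface *)

Section charts.
Variable R : realType.
Local Notation C := R[i].

Lemma near_pair (q : Cplane R) (P : Cplane R -> Prop) :
  (\forall y \near q, P y) <-> exists2 s : R, 0 < s &
    forall z w, md (z - q.1) < s -> md (w - q.2) < s -> P (z, w).
Proof.
split=> [[[A B] /= [/near_md[s s0 Hs] /near_md[t t0 Ht]] AB]|[s s0 Hs]].
  exists (Num.min s t); first by rewrite lt_min s0.
  move=> z w; rewrite !lt_min => /andP[zs _] /andP[_ wt].
  by apply: AB; split; [exact: Hs|exact: Ht].
exists ([set z | md (z - q.1) < s], [set w | md (w - q.2) < s]).
  by split; apply/near_md; exists s.
by move=> [z w] [/= ? ?]; exact: Hs.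
Qed.

Lemma nearI (T : topologicalType) (p : T) (P Q : T -> Prop) :
  (\forall x \near p, P x) -> (\forall x \near p, Q x) ->
  \forall x \near p, P x /\ Q x.
Proof. by move=> nP nQ; apply: filterI. Qed.

Variable X : complexSurface R.
Implicit Types (a b c : chart R X) (p q x y : X) (f : X -> C) (P : X -> Prop).

Lemma near_near p P : (\forall x \near p, P x) ->
  \forall x \near p, \forall y \near x, P y.
Proof. by move=> /nbhs_interior. Qed.

Lemma near_self p P : (\forall x \near p, P x) -> P p.
Proof. exact: nbhs_singleton. Qed.

Lemma near_dom a p : dom a p -> \forall x \near p, dom a x.
Proof. by move=> ap; apply: open_nbhs_nbhs; split => //; exact: dom_open. Qed.

Definition pt a (z w : C) : X := cinv a (z, w).

Lemma pt_coord a p : dom a p -> pt a (zcoord a p) (wcoord a p) = p.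
Proof.
by move=> ap; rewrite /pt /zcoord /wcoord -surjective_pairing cmapK.
Qed.

Lemma cmap_near a p (P : Cplane R -> Prop) : dom a p ->
  (\forall y \near cmap a p, P y) -> \forall x \near p, P (cmap a x).
Proof.
move=> ap nP; have c : cmap a @ p --> cmap a p := cmap_cont ap.
by apply: c.
Qed.

Lemma near_zw a p (e : R) : dom a p -> 0 < e -> \forall x \near p,
  md (zcoord a x - zcoord a p) < e /\ md (wcoord a x - wcoord a p) < e.
Proof.
move=> ap e0.
have H : \forall y \near cmap a p,
    md (y.1 - (cmap a p).1) < e /\ md (y.2 - (cmap a p).2) < e.
  by apply/near_pair; exists e.
exact: cmap_near H.
Qed.

Lemma near_chart a p P : dom a p -> (\forall x \near p, P x) <->
  exists2 s : R, 0 < s & forall z w,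
    md (z - zcoord a p) < s -> md (w - wcoord a p) < s ->
    [/\ dom a (pt a z w), zcoord a (pt a z w) = z, wcoord a (pt a z w) = w &
        P (pt a z w)].
Proof.
move=> ap; split.
  move=> nP; have nd := near_dom ap.
  have img : (cmap a @` dom a) (cmap a p) by exists p.
  have ci := cinv_cont img.
  have n1 : \forall y \near cmap a p, P (cinv a y).
    by apply: ci; rewrite /= cmapK.
  have n2 : \forall y \near cmap a p, (cmap a @` dom a) y.
    by apply: open_nbhs_nbhs; split => //; exact: img_open.
  have /near_pair[s s0 Hs] := nearI n1 n2.
  exists s => // z w zs ws; have [Pz [x ax xE]] := Hs z w zs ws.
  have -> : pt a z w = x by rewrite /pt -xE cmapK.
  by split; rewrite /zcoord /wcoord ?xE//; rewrite -(cmapK ax) xE.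
move=> [s s0 Hs].
have nc := near_zw ap s0.
apply: filterS2 nc (near_dom ap) => x [zx wx] ax.
by have [_ _ _] := Hs _ _ zx wx; rewrite pt_coord.
Qed.

(** [u] and [v] are the partial derivatives of [f] at [p] in the coordinates of [a]. *)
Definition cdiff a f p (u v : C) := forall e : R, 0 < e -> \forall x \near p,
  md (f x - f p - u * (zcoord a x - zcoord a p) - v * (wcoord a x - wcoord a p))
  <= e * (md (zcoord a x - zcoord a p) + md (wcoord a x - wcoord a p)).

Lemma cdiff_lip a f p u v : cdiff a f p u v -> exists2 K : R, 0 <= K &
  \forall x \near p, md (f x - f p) <=
    K * (md (zcoord a x - zcoord a p) + md (wcoord a x - wcoord a p)).
Proof.
move=> /(_ 1 ltr01) H; exists (md u + md v + 1).
  by rewrite !addr_ge0 ?md_ge0.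
apply: filterS H => x; rewrite mul1r.
set dz := _ - zcoord a p; set dw := _ - wcoord a p => H.
have := mdD (f x - f p - u * dz - v * dw) (u * dz + v * dw).
rewrite (_ : _ - _ - _ - _ + _ = f x - f p); last by ring.
have := mdD (u * dz) (v * dw); rewrite !mdM.
have := mulr_ge0 (md_ge0 u) (md_ge0 dw); have := mulr_ge0 (md_ge0 v) (md_ge0 dz).
lra.
Qed.

Lemma cdiff_cont a f p u v (e : R) : dom a p -> cdiff a f p u v -> 0 < e ->
  \forall x \near p, md (f x - f p) < e.
Proof.
move=> ap /cdiff_lip[K K0 HK] e0.
have K1 : 0 < K + 1 by lra.
have e1 : 0 < e / (K + 1) / 2 by rewrite !divr_gt0.
apply: filterS2 HK (near_zw ap e1) => x H [h1 h2].
apply: le_lt_trans H _.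
have : (K + 1) * (md (zcoord a x - zcoord a p) + md (wcoord a x - wcoord a p)) < e.
  rewrite mulrC -ltr_pdivlMr//; lra.
have := md_ge0 (zcoord a x - zcoord a p); have := md_ge0 (wcoord a x - wcoord a p).
lra.
Qed.

Lemma cdiff_z a p : cdiff a (zcoord a) p 1 0.
Proof.
move=> e e0; apply: nearW => x.
by rewrite mul1r mul0r subrr subr0 md0 mulr_ge0 ?addr_ge0 ?md_ge0// ltW.
Qed.

Lemma cdiff_w a p : cdiff a (wcoord a) p 0 1.
Proof.
move=> e e0; apply: nearW => x.
by rewrite mul1r mul0r subr0 subrr md0 mulr_ge0 ?addr_ge0 ?md_ge0// ltW.
Qed.

Lemma cdiff_near a f g p u v : (\forall x \near p, f x = g x) ->
  cdiff a f p u v -> cdiff a g p u v.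
Proof.
move=> E H e /H; have Ep := near_self E.
by apply: filterS2 E => x <-; rewrite Ep.
Qed.

Lemma cdiff_comp a f p u v phi d : dom a p -> cdiff a f p u v ->
  cder phi (f p) d -> cdiff a (fun x => phi (f x)) p (d * u) (d * v).
Proof.
move=> ap Hf Hphi e e0.
have [K K0 HK] := cdiff_lip Hf.
have K1 : 0 < K + 1 by lra.
have D1 : 0 < md d + 1 by have := md_ge0 d; lra.
have e2 : 0 < e / 2 by rewrite divr_gt0.
have [s s0 Hs] := Hphi _ (divr_gt0 e2 K1).
have H1 := Hf _ (divr_gt0 e2 D1).
apply: filterS3 HK H1 (cdiff_cont ap Hf s0) => x.
set dz := zcoord a x - _; set dw := wcoord a x - _ => h1 h2 /Hs h3.
rewrite (_ : _ - _ - _ - _ = (phi (f x) - phi (f p) - d * (f x - f p)) +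
  d * (f x - f p - u * dz - v * dw)); last by ring.
apply: le_trans (mdD _ _) _; rewrite mdM.
have N0 : 0 <= md dz + md dw by rewrite addr_ge0 ?md_ge0.
rewrite (splitr e) mulrDl; apply: lerD.
  apply: le_trans h3 _; rewrite -mulrA ler_wpM2l ?(ltW e2)// ler_pdivrMl//.
  by apply: le_trans h1 _; lra.
apply: le_trans (ler_wpM2l (md_ge0 d) h2) _.
rewrite mulrA ler_wpM2r// mulrA ler_pdivrMr// mulrC.
by rewrite ler_wpM2l ?(ltW e2)//; lra.
Qed.

Lemma cdiff_chart a b f p u v z1 z2 w1 w2 : dom a p -> dom b p ->
  cdiff b f p u v -> cdiff a (zcoord b) p z1 z2 -> cdiff a (wcoord b) p w1 w2 ->
  cdiff a f p (u * z1 + v * w1) (u * z2 + v * w2).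
Proof.
move=> ap bp Hf Hz Hw e e0.
have [K K0 HK] := cdiff_lip Hz; have [L L0 HL] := cdiff_lip Hw.
have K1 : 0 < K + L + 1 by lra.
have U1 : 0 < md u + md v + 1 by have := md_ge0 u; have := md_ge0 v; lra.
have e2 : 0 < e / 2 by rewrite divr_gt0.
have h1 := Hf _ (divr_gt0 e2 K1).
have h2 := nearI (Hz _ (divr_gt0 e2 U1)) (Hw _ (divr_gt0 e2 U1)).
apply: filterS3 h1 h2 (nearI HK HL) => x.
set dz := zcoord a x - _; set dw := wcoord a x - _.
set bz := zcoord b x - _; set bw := wcoord b x - _ => g1 [g2 g3] [g4 g5].
set N := md dz + md dw in g2 g3 g4 g5 *.
have N0 : 0 <= N by rewrite addr_ge0 ?md_ge0.
rewrite (_ : _ - _ - _ - _ = (f x - f p - u * bz - v * bw) +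
  (u * (bz - z1 * dz - z2 * dw) + v * (bw - w1 * dz - w2 * dw))); last by ring.
apply: le_trans (mdD _ _) _; rewrite (splitr e) mulrDl; apply: lerD.
  apply: le_trans g1 _; rewrite -mulrA ler_wpM2l ?(ltW e2)// ler_pdivrMl//.
  by lra.
apply: le_trans (mdD _ _) _; rewrite !mdM.
have k1 := ler_wpM2l (md_ge0 u) g2; have k2 := ler_wpM2l (md_ge0 v) g3.
apply: le_trans (lerD k1 k2) _.
rewrite -mulrDl mulrA ler_wpM2r// mulrA ler_pdivrMr// mulrC.
by rewrite ler_wpM2l ?(ltW e2)//; lra.
Qed.

Lemma cdiff_cder_z a f p u v : dom a p -> cdiff a f p u v ->
  cder (fun z => f (pt a z (wcoord a p))) (zcoord a p) u.
Proof.
move=> ap H e e0; have /(near_chart _ ap)[s s0 Hs] := H e e0.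
exists s => // z /= zs; rewrite pt_coord//.
have [|_ -> -> h] := Hs z (wcoord a p) zs; first by rewrite subrr md0.
by move: h; rewrite subrr mulr0 subr0 md0 addr0.
Qed.

Lemma cdiff_cder_w a f p u v : dom a p -> cdiff a f p u v ->
  cder (fun w => f (pt a (zcoord a p) w)) (wcoord a p) v.
Proof.
move=> ap H e e0; have /(near_chart _ ap)[s s0 Hs] := H e e0.
exists s => // w /= ws; rewrite pt_coord//.
have [||_ -> -> h] := Hs (zcoord a p) w; rewrite ?subrr ?md0//.
by move: h; rewrite subrr mulr0 subr0 md0 add0r.
Qed.

Lemma cdiff_uniq a f p u v u' v' : dom a p -> cdiff a f p u v ->
  cdiff a f p u' v' -> u = u' /\ v = v'.
Proof.
move=> ap H H'; split.
  exact: cder_uniq (cdiff_cder_z ap H) (cdiff_cder_z ap H').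
exact: cder_uniq (cdiff_cder_w ap H) (cdiff_cder_w ap H').
Qed.

Lemma md_norm_lt (x : R[i]) (e : R) : (`|x| <= e%:C%C) = (md x <= e).
Proof. by rewrite md_norm lecR. Qed.

Lemma transition_cdiff a b p : dom a p -> dom b p ->
  holomorphic_transition a b ->
  (exists u v, cdiff a (zcoord b) p u v) /\ (exists u v, cdiff a (wcoord b) p u v).
Proof.
move=> ap bp /(_ p ap bp) H.
set Phi := cmap b \o cinv a in H; set q := cmap a p in H.
pose L := 'd Phi q.
have lin (u v : C) : L (u, v) = u *: L (1, 0) + v *: L (0, 1).
  rewrite -!linearZ -linearD; congr (L _).
  rewrite [RHS]surjective_pairing; congr (_, _).
    by rewrite /= /GRing.scale /= mulr1 mulr0 addr0.
  by rewrite /= /GRing.scale /= mulr1 mulr0 add0r.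
have key (e : R) : 0 < e -> \forall x \near p,
    md (zcoord b x - zcoord b p - (L (cmap a x - cmap a p)).1) <=
      e * (md (zcoord a x - zcoord a p) + md (wcoord a x - wcoord a p)) /\
    md (wcoord b x - wcoord b p - (L (cmap a x - cmap a p)).2) <=
      e * (md (zcoord a x - zcoord a p) + md (wcoord a x - wcoord a p)).
  move=> e0; have eC : (0 : R[i]) < e%:C%C by rewrite ltcR.
  have /eqaddoP/(_ _ eC) h0 := diff_locally H.
  have h1 : \forall y \near q, `|Phi y - Phi q - L (y - q)| <= e%:C%C * `|y - q|.
    move: h0 => /near_pair[s s0 Hs]; apply/near_pair; exists s => // z w zs ws.
    have := Hs (z - q.1) (w - q.2); rewrite !subr0 => /(_ zs ws) /=.
    have -> : (z - q.1, w - q.2) = (z, w) - q by rewrite {3}[q]surjective_pairing.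
    move=> h; have {}h : `|Phi (((z, w) - q) + q) - (Phi q + L ((z, w) - q))| <=
      e%:C%C * `|(z, w) - q| by exact: h.
    by move: h; rewrite subrK opprD addrA.
  have h2 : \forall x \near p, `|Phi (cmap a x) - Phi q - L (cmap a x - q)| <=
      e%:C%C * `|cmap a x - q| by exact: cmap_near h1.
  apply: filterS2 h2 (near_dom ap) => x hx ax; move: hx.
  rewrite /Phi /= !cmapK// => hx.
  have nle (y : Cplane R) : `|y| <= (md y.1 + md y.2)%:C%C.
    rewrite prod_normE /Num.max !md_norm ltcR.
    by case: ifP => _; rewrite lecR ?lerDl ?lerDr md_ge0.
  have hb (y : Cplane R) : (md y.1)%:C%C <= `|y| /\ (md y.2)%:C%C <= `|y|.
    rewrite prod_normE /Num.max !md_norm ltcR.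
    by case: ltP => h; rewrite !lecR lexx ?(ltW h).
  have := hb (cmap b x - cmap b p - L (cmap a x - q)).
  have eC0 : (0 : R[i]) <= e%:C%C by rewrite ltW.
  have := ler_wpM2l eC0 (nle (cmap a x - q)).
  rewrite -rmorphM => g1 [g2 g3].
  split; rewrite -lecR.
    exact: le_trans g2 (le_trans hx g1).
  exact: le_trans g3 (le_trans hx g1).
have LE x : L (cmap a x - cmap a p) = (zcoord a x - zcoord a p) *: L (1, 0) +
    (wcoord a x - wcoord a p) *: L (0, 1).
  by rewrite -lin.
split; [exists (L (1, 0)).1, (L (0, 1)).1 | exists (L (1, 0)).2, (L (0, 1)).2];
  move=> e /key; apply: filterS => x [h1 h2].
  move: h1; rewrite LE.
  rewrite [((_ : Cplane R) + _).1]/= /GRing.scale /= /GRing.scale /=.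
  by rewrite opprD addrA ![_ * (L _).1]mulrC.
move: h2; rewrite LE.
rewrite [((_ : Cplane R) + _).2]/= /GRing.scale /= /GRing.scale /=.
by rewrite opprD addrA ![_ * (L _).2]mulrC.
Qed.

(** A holomorphic chart is compared by definition with charts of the atlas only, so the chain rule
    goes through an atlas chart at [p]. *)
Lemma cdiff_holomorphic a b p : holomorphic_chart a -> holomorphic_chart b ->
  dom a p -> dom b p ->
  (exists u v, cdiff a (zcoord b) p u v) /\ (exists u v, cdiff a (wcoord b) p u v).
Proof.
move=> ha hb ap bp; have [c cA cp] := surf_cover p.
have [ca ac] := ha c cA; have [cb bc] := hb c cA.
have [[z1 [z2 Hz]] [w1 [w2 Hw]]] := transition_cdiff ap cp ac.
have [[u [v Hu]] [u' [v' Hu']]] := transition_cdiff cp bp cb.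
split.
  by do 2 eexists; exact: (cdiff_chart ap cp Hu Hz Hw).
by do 2 eexists; exact: (cdiff_chart ap cp Hu' Hz Hw).
Qed.

End charts.

(** * First integrals of the foliation *)

Section leaf.
Variable R : realType.
Local Notation C := R[i].

Lemma clamp_lip (t u : R) : `|clamp u - clamp t| <= `|u - t|.
Proof.
rewrite /clamp /Num.max /Num.min ler_norml.
have [h|h] := lerP 0 (u - t); [rewrite (ger0_norm h)|rewrite (ltr0_norm h)];
by case: (ltP u 1) => ?; case: (ltP t 1) => ?; (do 2 case: ltP => ?);
  apply/andP; split; lra.
Qed.

Lemma within_clamp (T : topologicalType) (g : R -> T) :
  {within `[(0 : R), 1], continuous g} -> continuous (fun u => g (clamp u)).
Proof.
move=> /subspace_continuousP H u P nP.
have c01 : `[(0 : R), 1]%classic (clamp u).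
  by rewrite /= in_itv /=; exact: clamp01.
have := H _ c01 P nP; rewrite /within => /near_R[s s0 Hs].
apply/near_R; exists s => // u' us; apply: Hs.
  exact: le_lt_trans (clamp_lip _ _) us.
by rewrite /= in_itv /=; exact: clamp01.
Qed.

Lemma glue_continuous (T : topologicalType) (f g : R -> T) (m : R) :
  continuous f -> continuous g -> f m = g m ->
  continuous (fun u => if u <= m then f u else g u).
Proof.
move=> cf cg fg u P /=; have [um|um|um] := ltgtP u m => nP.
- have /near_R[s s0 Hs] := cf u P nP.
  apply/near_R; exists (Num.min s (m - u)); first by rewrite lt_min s0 subr_gt0.
  move=> u'; rewrite lt_min => /andP[/Hs h us].
  rewrite /preimage /= ifT//.
  by have := ler_norm (u' - u); lra.
- have /near_R[s s0 Hs] := cg u P nP.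
  apply/near_R; exists (Num.min s (u - m)); first by rewrite lt_min s0 subr_gt0.
  move=> u'; rewrite lt_min => /andP[/Hs h us].
  rewrite /preimage /= ifF//; apply/negbTE.
  by rewrite -ltNge; have := ler_norm (u - u'); rewrite distrC; lra.
- have /near_R[s s0 Hs] := cf u P nP.
  have nP' : nbhs (g u) P by rewrite um -fg -um.
  have /near_R[t t0 Ht] := cg u P nP'.
  apply/near_R; exists (Num.min s t); first by rewrite lt_min s0.
  by move=> u'; rewrite lt_min => /andP[/Hs h /Ht h']; rewrite /preimage /=; case: ifP.
Qed.

Lemma derivable_cder (f : R[i]^o -> R[i]^o) z : derivable f z 1 ->
  exists d, cder f z d.
Proof. by move=> H; exists ('D_1 f z); apply/cderP; exact: derivableP. Qed.

Lemma cder_derivable (f : R[i]^o -> R[i]^o) z d : cder f z d -> derivable f z 1.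
Proof. by move=> /cderP[]. Qed.

Variables (X : complexSurface R) (F : foliation X).
Implicit Types (a b c : chart R X) (p q x y : X) (v : X -> C).

(** A transverse transition is only required to be holomorphic; that its derivative is nonzero
    follows from the transition in the other direction, since the composite of the two is the
    identity. *)
Lemma transverse_germ a b p : dom a p ->
  (exists h, transverse_transition a b p h) ->
  (exists k, transverse_transition b a p k) ->
  exists g d, germ g d /\
    \forall x \near p, wcoord b x - wcoord b p = g (wcoord a x - wcoord a p).
Proof.
move=> ap [h [h1 h2]] [k [k1 k2]].
pose g t := h (wcoord a p + t) - wcoord b p.
pose l t := k (wcoord b p + t) - wcoord a p.
have g0 : g 0 = 0 by rewrite /g addr0 -(near_self h2) subrr.
have l0 : l 0 = 0 by rewrite /l addr0 -(near_self k2) subrr.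
have hol (f : C -> C) z z' : (\forall y \near (z : R[i]^o), derivable (f : R[i]^o -> R[i]^o) y 1) ->
    exists2 r : R, 0 < r & holD (fun t => f (z + t) - z') r.
  move=> /near_md[r r0 Hr]; exists r => // t tr.
  have [|d Hd] := derivable_cder (Hr (z + t) _); first by rewrite addrC addKr.
  exists (d - 0); apply: gderB (gder_cst _ _ _); exact/cder_shift.
have [r r0 gr] := hol h _ (wcoord b p) h1; have [s s0 ls] := hol k _ (wcoord a p) k1.
have [|d gd] := gr 0; first by rewrite md0.
have [|e le] := ls 0; first by rewrite md0.
have E : near0 (fun t => l (g t) = t).
  have /(near_chart _ ap)[u u0 Hu] := nearI h2 k2.
  exists u => // t tu; have [||_ _ wE [hE kE]] := Hu (zcoord a p) (wcoord a p + t).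
  - by rewrite subrr md0.
  - by rewrite addrC addKr.
  move: hE kE; rewrite wE => hE kE.
  by rewrite /l /g -hE (addrC (wcoord b p)) subrK -kE addrC addKr.
have ed : e * d = 1.
  have le' : cder l (g 0) e by rewrite g0.
  have D : cder (fun t => l (g t)) 0 (e * d) by exact: gder_comp gd le'.
  apply: cder_uniq D _; case: E => u u0 Hu.
  apply: (@gder_near _ _ _ id _ _ _ _ u0) (gder_id _ _) => y /=.
  by rewrite subr0 => /Hu ->.
exists g, d; split.
  split => //; first by exists r.
  by apply/eqP => d0; move: ed; rewrite d0 mulr0 => /esym/eqP; rewrite oner_eq0.
by apply: filterS h2 => x hx; rewrite /g (addrC (wcoord a p)) subrK -hx.
Qed.

Lemma fol_germ a b p : fol_atlas F a -> fol_atlas F b -> dom a p -> dom b p ->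
  exists g d, germ g d /\
    \forall x \near p, wcoord b x - wcoord b p = g (wcoord a x - wcoord a p).
Proof.
move=> aF bF ap bp; apply: transverse_germ => //.
  exact: (fol_transition aF bF ap bp).
exact: (fol_transition bF aF bp ap).
Qed.

(** A leaf path ending at [q] is run through in half the time and prolonged by a segment of the
    plaque of [q]. *)
Lemma plaque_in_leaf (L : set X) a q : is_leaf F L -> L q -> fol_atlas F a ->
  dom a q -> exists2 s : R, 0 < s &
  forall t, md t < s -> L (pt a (zcoord a q + t) (wcoord a q)).
Proof.
move=> [p0 _ ->] [g [[gc gl] g0 g1]] aF aq.
have /(near_chart _ aq)[s s0 Hs] : \forall x \near q, True by exact: nearW.
exists s => // t ts.
pose de (u : R) := pt a (zcoord a q + (clamp u)%:C%C * t) (wcoord a q).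
have ct u : md ((clamp u)%:C%C * t) < s.
  apply: le_lt_trans ts; rewrite mdM mdR; have /andP[c0 c1] := clamp01 u.
  by rewrite ger0_norm// ler_piMl ?md_ge0.
have deP u : [/\ dom a (de u), zcoord a (de u) = zcoord a q + (clamp u)%:C%C * t &
    wcoord a (de u) = wcoord a q].
  have [||? ? ? _] := Hs (zcoord a q + (clamp u)%:C%C * t) (wcoord a q); last by split.
    by rewrite addrC addKr.
  by rewrite subrr md0.
have dec : continuous (fun u : R => de (2 * u - 1)).
  move=> u P nP; have [d1 d2 d3] := deP (2 * u - 1).
  have /(near_chart _ d1)[r r0 Hr] := nP.
  have t1 : 0 < md t + 1 by have := md_ge0 t; lra.
  apply/near_R; exists (r / (md t + 1) / 2); first by rewrite !divr_gt0.
  move=> u'; rewrite ltr_pdivlMr// ltr_pdivlMr// => ur.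
  have [||_ _ _] := Hr (zcoord a q + (clamp (2 * u' - 1))%:C%C * t) (wcoord a q).
  - rewrite d2 opprD addrACA subrr add0r -mulrBl -rmorphB mdM mdR.
    apply: le_lt_trans ur; rewrite ler_pM ?normr_ge0 ?md_ge0//; last by lra.
    apply: le_trans (clamp_lip _ _) _.
    by rewrite (_ : 2 * u' - 1 - (2 * u - 1) = (u' - u) * 2) ?normrM ?(ger0_norm (ler0n R 2))//; ring.
  - by rewrite d3 subrr md0.
  - by [].
pose gc2 (u : R) := g (clamp (2 * u)).
have gcc := within_clamp gc.
have gc2c : continuous gc2.
  move=> u P nP; have /near_R[r r0 Hr] := gcc (2 * u) P nP.
  apply/near_R; exists (r / 2); first by rewrite divr_gt0.
  move=> u'; rewrite ltr_pdivlMr// => ur; apply: Hr.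
  by rewrite -mulrBr normrM (ger0_norm (ler0n R 2)) mulrC.
have c1 : clamp 1 = 1 :> R by apply: clamp_id; rewrite ler01 lexx.
have c0 : clamp 0 = 0 :> R by apply: clamp_id; rewrite ler01 lexx.
have de0 : de 0 = q by rewrite /de c0 rmorph0 mul0r addr0 pt_coord.
have h12 : 2 * (1 / 2) = 1 :> R by field.
have mid : gc2 (1 / 2) = de (2 * (1 / 2) - 1).
  by rewrite /gc2 h12 c1 subrr de0.
pose G (u : R) := if u <= 1 / 2 then gc2 u else de (2 * u - 1).
have Gc : continuous G by exact: glue_continuous.
exists G; split; last first.
- rewrite /G ifF; last by apply/negbTE; rewrite -ltNge; lra.
  by rewrite /de (_ : 2 * 1 - 1 = 1 :> R) ?c1 ?rmorph1 ?mul1r//; ring.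
- by rewrite /G ifT ?divr_ge0// /gc2 mulr0 c0.
split; first exact: continuous_subspaceT.
move=> u; rewrite in_itv /= => /andP[u0 u1].
have [um|um|um] := ltgtP u (1 / 2).
- have [|a1 [a1F a1d a1n]] := gl (2 * u).
    by rewrite in_itv /=; apply/andP; split; lra.
  have cu : clamp (2 * u) = 2 * u by apply: clamp_id; lra.
  exists a1; split => //; first by rewrite /G ifT ?(ltW um)// /gc2 cu.
  have /near_R[r r0 Hr] := a1n.
  apply/near_R; exists (Num.min (r / 2) (1 / 2 - u)).
    by rewrite lt_min divr_gt0//= subr_gt0.
  move=> u'; rewrite lt_min ltr_pdivlMr// => /andP[ur um'].
  rewrite in_itv /= => /andP[u'0 u'1].
  have um2 : u' < 1 / 2 by have := ler_norm (u' - u); lra.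
  have cu' : clamp (2 * u') = 2 * u' by apply: clamp_id; lra.
  rewrite /G !ifT ?(ltW um) ?(ltW um2)// /gc2 cu cu'; apply: Hr.
    by rewrite -mulrBr normrM (ger0_norm (ler0n R 2)) mulrC.
  by rewrite in_itv /=; apply/andP; split; lra.
- exists a; have [d1 d2 d3] := deP (2 * u - 1).
  have GE u' : 1 / 2 < u' -> G u' = de (2 * u' - 1).
    by move=> h; rewrite /G ifF//; apply/negbTE; rewrite -ltNge.
  split => //; first by rewrite GE.
  apply/near_R; exists (u - 1 / 2); first by rewrite subr_gt0.
  move=> u' ur _; have um' : 1 / 2 < u'.
    by have := ler_norm (u - u'); rewrite distrC; lra.
  by rewrite !GE// d3; have [e1 _ e3] := deP (2 * u' - 1).
(* At the junction the first half stays in a plaque of a chart [a1] that may differ from [a]; the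
   transition germ carries this plaque into one of [a]. *)
- exists a; have GE : G u = q by rewrite um /G lexx mid h12 subrr.
  have [|a1 [a1F a1d a1n]] := gl 1; first by rewrite in_itv /= ler01 lexx.
  rewrite g1 in a1d a1n.
  have [k [d [[k0 _ _ _] kE]]] := fol_germ a1F aF a1d aq.
  have n1 : \forall u' \near (1 : R), dom a (g (clamp u')) /\
      wcoord a (g (clamp u')) - wcoord a q = k (wcoord a1 (g (clamp u')) - wcoord a1 q).
    have N : nbhs (g (clamp 1)) (fun x => dom a x /\
        wcoord a x - wcoord a q = k (wcoord a1 x - wcoord a1 q)).
      by rewrite c1 g1; exact: nearI (near_dom aq) kE.
    exact: (gcc 1 _ N).
  have /near_R[r r0 Hr] := nearI n1 a1n.
  split => //; first by rewrite GE.
  apply/near_R; exists (r / 2); first by rewrite divr_gt0.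
  move=> u'; rewrite um ltr_pdivlMr// => ur; rewrite in_itv /= => /andP[u'0 u'1].
  rewrite -um GE /G; case: ifPn => [um'|]; last first.
    by move=> _; have [e1 _ e3] := deP (2 * u' - 1); rewrite e3.
  have cu' : clamp (2 * u') = 2 * u' by apply: clamp_id; lra.
  have [|[ga gk] gw] := Hr (2 * u').
    have -> : 2 * u' - 1 = (u' - 1 / 2) * 2 by field.
    by rewrite normrM (ger0_norm (ler0n R 2)).
  rewrite /gc2; split => //; apply/eqP; rewrite -subr_eq0 gk.
  have [|_] := gw; first by rewrite in_itv /=; apply/andP; split; lra.
  by rewrite cu' => ->; rewrite subrr k0.
Qed.

(** Near [p], [v] is a first integral of [F] that vanishes at [p] and has nonzero differential, that
    is, a local coordinate of the space of plaques. *)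
Definition good v p := exists a phi d,
  [/\ fol_atlas F a, dom a p, germ phi d &
      \forall x \near p, v x = phi (wcoord a x - wcoord a p)].

Lemma good_eq v v' p : good v p -> (\forall x \near p, v x = v' x) -> good v' p.
Proof.
move=> [a [phi [d [aF ap pd E]]]] E'; exists a, phi, d; split => //.
by apply: filterS2 E E' => x <-.
Qed.

Lemma good_germ v p phi d : good v p -> germ phi d -> good (fun x => phi (v x)) p.
Proof.
move=> [a [psi [e [aF ap pe E]]]] pd; exists a, (fun t => phi (psi t)), (d * e).
by split => //; [exact: germ_comp|apply: filterS E => x ->].
Qed.

Lemma good0 v p : good v p -> v p = 0.
Proof.
by move=> [a [phi [d [_ _ [p0 _ _ _] E]]]]; rewrite (near_self E) subrr.
Qed.

Lemma near_w a p P : dom a p -> near0 P ->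
  \forall x \near p, P (wcoord a x - wcoord a p).
Proof.
move=> ap [s s0 Hs]; have := near_zw ap s0.
by apply: filterS => x [_ /Hs].
Qed.

Lemma near_w_inv a p P : dom a p ->
  (\forall x \near p, P (wcoord a x - wcoord a p)) -> near0 P.
Proof.
move=> ap /(near_chart _ ap)[s s0 Hs]; exists s => // t ts.
have [||_ _ ->] := Hs (zcoord a p) (wcoord a p + t); rewrite ?subrr ?md0//;
  by rewrite addrC addKr.
Qed.

Lemma good_near v p P : good v p -> near0 P -> \forall x \near p, P (v x).
Proof.
move=> [a [phi [d [aF ap pd E]]]] nP.
have := near_w ap (germ_near pd nP).
by apply: filterS2 E => x ->.
Qed.

(** [v] takes all small values arbitrarily near [p]. Equalities between first integrals on the
    surface thus become equalities of germs at 0. *)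
Lemma good_near_inv v p P : good v p -> (\forall x \near p, P (v x)) -> near0 P.
Proof.
move=> [a [phi [d [aF ap pd E]]]] nP.
have [psi [pg E1 E2]] := germ_inv pd.
have n1 : near0 (fun t => P (phi t)).
  by apply: (near_w_inv ap); apply: filterS2 E nP => x ->.
have := near0_and (germ_near pg n1) E1.
by move=> h; apply: near0_sub h _ => y [hP hE]; rewrite -hE.
Qed.

Lemma good_trans v v' p : good v p -> good v' p -> exists phi d,
  germ phi d /\ \forall x \near p, v' x = phi (v x).
Proof.
move=> [a [phi [d [aF ap pd E]]]] [b [psi [e [bF bp pe E']]]].
have [g [c [gc gE]]] := fol_germ aF bF ap bp.
have [phi' [pg E1 E2]] := germ_inv pd.
exists (fun t => psi (g (phi' t))), (e * (c * d^-1)).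
split; first exact: germ_comp pe (germ_comp gc pg).
have n2 := near_w ap E2.
have := nearI E E'; apply: filterS3 gE n2 => x gx nx [-> ->].
by rewrite gx nx.
Qed.

Variable Y : set X.
Hypotheses (embY : embedded_curve Y) (Y_in_F : Y `<=` fol_dom F)
  (Y_leaf : is_leaf F Y).

(** In an adapted chart, neighborhoods of [p] in [Y] are described by discs of the coordinate z;
    functions on [Y] become functions of one complex variable. *)
Lemma near_adapted b p (P : X -> Prop) : adapted_chart Y b -> dom b p -> Y p ->
  (\forall x \near p, Y x -> P x) <-> exists2 s : R, 0 < s &
  forall z, md (z - zcoord b p) < s ->
    [/\ dom b (pt b z 0), zcoord b (pt b z 0) = z, wcoord b (pt b z 0) = 0,
        Y (pt b z 0) & P (pt b z 0)].
Proof.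
move=> [bh bY] bp Yp; have wp : wcoord b p = 0 by apply/bY.
split=> [/(near_chart _ bp)[s s0 Hs]|[s s0 Hs]].
  exists s => // z zs; have [|d1 d2 d3 d4] := Hs z 0 zs.
    by rewrite wp subrr md0.
  have Yz : Y (pt b z 0) by apply/bY.
  by split => //; exact: d4.
apply: filterS2 (near_zw bp s0) (near_dom bp) => x [zx _] bx Yx.
have wx : wcoord b x = 0 by apply/bY.
by have [_ _ _ _] := Hs _ zx; rewrite -{1}wx pt_coord.
Qed.

(* The plaques of [F] through points of [Y] are contained in [Y], hence tangent
   to it, so the derivative of [wcoord a] along [Y] vanishes. *)
Lemma wcoord_der_along b a x : adapted_chart Y b -> fol_atlas F a -> dom b x ->
  dom a x -> Y x -> exists2 v, cdiff b (wcoord a) x 0 v & v != 0.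
Proof.
move=> [bh bY] aF bx ax Yx.
have ah := fol_holomorphic aF.
have [[u' [v' Hz]] [u [v Hw]]] := cdiff_holomorphic bh ah bx ax.
have [[al [be Kz]] [ga [de Kw]]] := cdiff_holomorphic ah bh ax bx.
have wx : wcoord b x = 0 by apply/bY.
have ga0 : ga = 0.
  apply: cder_uniq (cdiff_cder_z ax Kw) _.
  have [s s0 Hs] := plaque_in_leaf Y_leaf Yx aF ax.
  have /(near_chart _ ax)[r r0 Hr] := near_dom bx.
  have m0 : 0 < Num.min s r by rewrite lt_min s0.
  apply: (@gder_near _ _ _ (fun=> 0) _ _ _ _ m0) (gder_cst _ _ _) => z /=.
  rewrite lt_min => /andP[zs zr]; apply/esym/bY.
    by have [|] := Hr z (wcoord a x) zr; rewrite ?subrr ?md0.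
  by have := Hs (z - zcoord a x); rewrite [zcoord a x + _]addrC subrK; apply.
have [E1 E2] := cdiff_uniq ax (cdiff_chart ax bx Hw Kz Kw) (cdiff_w a x).
have [E3 _] := cdiff_uniq ax (cdiff_chart ax bx Hz Kz Kw) (cdiff_z a x).
rewrite ga0 !mulr0 !addr0 in E1 E3.
have al0 : al != 0.
  by apply/eqP => al0; move: E3; rewrite al0 mulr0 => /esym/eqP; rewrite oner_eq0.
have u0 : u = 0 by apply/eqP; move/eqP: E1; rewrite mulf_eq0 (negbTE al0) orbF.
rewrite u0 mul0r add0r in E2 Hw.
exists v => //; apply/eqP => v0; move: E2.
by rewrite v0 mul0r => /esym/eqP; rewrite oner_eq0.
Qed.

Lemma wcoord_const_on_Y a p : fol_atlas F a -> dom a p -> Y p ->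
  \forall x \near p, Y x -> wcoord a x = wcoord a p.
Proof.
move=> aF ap Yp; have [b bad bp] := embY Yp.
have nd : \forall x \near p, Y x -> dom a x.
  by apply: filterS (near_dom ap) => x ? _.
have /(near_adapted _ bad bp Yp)[s s0 Hs] := nd.
apply/(near_adapted _ bad bp Yp); exists s => // z zs.
have [d1 d2 d3 d4 d5] := Hs z zs; split => //.
have wp : wcoord b p = 0 by case: bad => _ bY; apply/bY.
have D t : md t < s -> cder (fun t => wcoord a (pt b (zcoord b p + t) 0)) t 0.
  move=> ts; have [|e1 e2 e3 e4 e5] := Hs (zcoord b p + t).
    by rewrite addrC addKr.
  have [v Hv _] := wcoord_der_along bad aF e1 e5 e4.
  have := cdiff_cder_z e1 Hv; rewrite e2 e3.
  exact: (cder_shift (fun z => wcoord a (pt b z 0)) _ _ _).1.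
have := holD_const D zs; rewrite [zcoord b p + (z - _)]addrC subrK addr0 => ->.
by rewrite -wp pt_coord.
Qed.

(** The transverse coordinate is constant on [Y] near [p], so the same germ [phi] serves at the
    nearby points of [Y]. *)
Lemma good_on_Y v p : good v p -> Y p -> \forall x \near p, Y x -> good v x.
Proof.
move=> [a [phi [d [aF ap pd E]]]] Yp.
have := near_near E; have := wcoord_const_on_Y aF ap Yp.
apply: filterS3 (near_dom ap) => x ax wx Ex Yx.
exists a, phi, d; split => //; apply: filterS Ex => y ->.
by rewrite wx.
Qed.

Lemma good_exists p : Y p -> exists v, good v p.
Proof.
move=> Yp; have [a aF ap] := Y_in_F Yp.
exists (fun x => wcoord a x - wcoord a p), a, id, 1.
by split => //; [exact: germ_id|exact: nearW].
Qed.

Lemma good_foliated_chart W p : foliated_chart F W -> adapted_chart Y W ->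
  dom W p -> Y p -> good (wcoord W) p.
Proof.
move=> [Wh WF Wt] [_ WY] Wp Yp; have [a aF ap] := WF p Wp.
have [t1 t2] := Wt a p aF ap Wp.
have [g [d [gd gE]]] := transverse_germ ap t1 t2.
exists a, g, d; split => //; apply: filterS gE => x <-.
by rewrite (WY p Wp).1// subr0.
Qed.

(** The identity principle of the continuation: v' is phi after v for a single germ [phi] around
    [p], and agreement at [p] or at [x] means in both cases that [phi] is the germ of the
    identity. *)
Lemma good_agree v v' p : good v p -> good v' p -> Y p -> \forall x \near p,
  Y x -> ((\forall y \near x, v y = v' y) <-> (\forall y \near p, v y = v' y)).
Proof.
move=> gv gv' Yp; have [phi [d [pd E]]] := good_trans gv gv'.
have := near_near E; apply: filterS2 (good_on_Y gv Yp) => x gx Ex Yx.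
have key q : good v q -> (\forall y \near q, v' y = phi (v y)) ->
    (\forall y \near q, v y = v' y) <-> near0 (fun t => t = phi t).
  move=> gq Eq; split => [H|H].
    by apply: (good_near_inv gq); apply: filterS2 H Eq => y h <-.
  by have := good_near gq H; apply: filterS2 Eq => y ->.
by rewrite (key x (gx Yx) Ex) (key p gv E).
Qed.

Lemma good_adapted_der v b p : good v p -> adapted_chart Y b -> dom b p -> Y p ->
  exists2 e, cdiff b v p 0 e & e != 0.
Proof.
move=> [a [phi [d [aF ap [p0 _ pd d0] E]]]] bad bp Yp.
have [e He e0] := wcoord_der_along bad aF bp ap Yp.
exists (d * e); last by rewrite mulf_neq0.
apply: (@cdiff_near _ _ _ (fun x => phi (wcoord a x - wcoord a p))).
  by apply: filterS E => x ->.
rewrite -(mulr0 d).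
apply: (@cdiff_comp _ _ _ (fun x => wcoord a x - wcoord a p)) => //.
  move=> k k0; have := He k k0; apply: filterS => x.
  by rewrite subrr subr0.
by rewrite subrr.
Qed.

Lemma good_cdiff v b p : good v p -> holomorphic_chart b -> dom b p ->
  \forall x \near p, exists u w, cdiff b v x u w.
Proof.
move=> [a [phi [d [aF ap [p0 [r r0 pr] _ _] E]]]] bh bp.
have := near_near E; apply: filterS3 (nearI (near_dom ap) (near_dom bp)) (near_zw ap r0).
move=> x [ax bx] [_ wx] Ex.
have [d' Hd'] := pr _ wx.
have [_ [u [w Hw]]] := cdiff_holomorphic bh (fol_holomorphic aF) bx ax.
exists (d' * u), (d' * w).
apply: (@cdiff_near _ _ _ (fun x => phi (wcoord a x - wcoord a p))).
  by apply: filterS Ex => y ->.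
apply: (@cdiff_comp _ _ _ (fun x => wcoord a x - wcoord a p)) => //.
move=> k k0; have := Hw k k0; apply: filterS => y.
by rewrite opprB addrA subrK.
Qed.

End leaf.

(** * The circle and the plane *)

Section plane.
Variable R : realType.
Local Notation C := R[i].
Local Notation PL := (R * R)%type.

(** Connectedness of [0, 1]: the supremum [m] of the times up to which [Q] persists satisfies [Q],
    and cannot be less than 1. *)
Lemma locally_constant_01 (Q : R -> Prop) :
  (forall t : R, 0 <= t <= 1 -> exists2 s : R, 0 < s &
    forall t' : R, 0 <= t' <= 1 -> `|t' - t| < s -> (Q t' <-> Q t)) -> Q 0 -> Q 1.
Proof.
move=> H Q0.
pose E := [set t : R | 0 <= t <= 1 /\ forall t' : R, 0 <= t' <= t -> Q t'].
have E0 : E 0.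
  split; first by rewrite lexx ler01.
  by move=> t'; rewrite -eq_le => /eqP <-.
have Eub : has_sup E by split; [exists 0|exists 1 => t [/andP[]]].
set m := sup E.
have m0 : 0 <= m by exact: sup_upper_bound.
have m1 : m <= 1 by apply: sup_le_ub => [|t [/andP[]]//]; case: Eub.
have m01 : 0 <= m <= 1 by rewrite m0.
have [s s0 Hs] := H m m01.
have below t : 0 <= t -> t < m -> Q t.
  move=> t0 tm; have mt : 0 < m - t by rewrite subr_gt0.
  have [u [u01 Hu]] := sup_adherent mt Eub.
  by rewrite -/m opprB addrC subrK => /ltW tu; apply: Hu; rewrite t0.
have Qm : Q m.
  have [->|mn0] := eqVneq m 0; first exact: Q0.
  have mp : 0 < m by rewrite lt_def mn0.
  pose t : R := Num.max 0 (m - s / 2).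
  have t0 : 0 <= t by rewrite le_max lexx.
  have tm : t < m by rewrite gt_max mp/=; lra.
  have ts : m - s / 2 <= t by rewrite le_max lexx orbT.
  have t01 : 0 <= t <= 1 by rewrite t0/=; lra.
  apply: (Hs t t01 _).1; last exact: below.
  by rewrite ltr0_norm ?subr_lt0//; lra.
have [<-//|mn1] := eqVneq m 1.
have mlt : m < 1 by rewrite lt_neqAle mn1.
pose t : R := Num.min 1 (m + s / 2).
have tm : m < t by rewrite lt_min mlt/=; lra.
have t1 : t <= 1 by rewrite ge_min lexx.
have ts : t <= m + s / 2 by rewrite ge_min lexx orbT.
suff : E t by move=> /(sup_upper_bound Eub); rewrite -/m => h; lra.
split; first by apply/andP; split => //; lra.
move=> t' /andP[t'0 t't].
have [|h] := ltP t' m; first exact: below.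
have t'01 : 0 <= t' <= 1 by rewrite t'0/=; lra.
by apply: (Hs t' t'01 _).2 => //; rewrite ger0_norm ?subr_ge0//; lra.
Qed.

Lemma ceN (t : R) : ce (- t) = (ce t)^-1.
Proof.
apply: (mulfI (ce_neq0 t)); rewrite divff ?ce_neq0// -ceD subrr; exact: ce0.
Qed.

Lemma ce_nat n : ce (n%:R : R) = 1.
Proof. by elim: n => [|n IH]; rewrite ?ce0// -natr1 ceD IH ce1 mul1r. Qed.

Lemma ce_int (m : int) : ce (m%:~R : R) = 1.
Proof.
case: m => n; first exact: ce_nat.
by rewrite NegzE rmorphN ceN [X in ce X]pmulrn ce_nat invr1.
Qed.

Lemma unit_circle (z : C) : md z = 1 ->
  -1 <= complex.Re z <= 1 /\ complex.Re z ^+ 2 + complex.Im z ^+ 2 = 1.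
Proof.
move=> z1; split; first by rewrite -ler_norml -z1 Re_md.
have : md z ^+ 2 = 1 by rewrite z1 expr1n.
by case: z {z1} => a b; rewrite /md /= sqr_sqrtr ?addr_ge0 ?sqr_ge0.
Qed.

Lemma two_pi_neq0 : 2 * pi != 0 :> R.
Proof. by rewrite mulf_neq0 ?pnatr_eq0// lt0r_neq0 ?pi_gt0. Qed.

Lemma ce_surj (z : C) : md z = 1 -> exists t, ce t = z.
Proof.
move=> /unit_circle[]; case: z => x y /= x1 xy.
have y2 : Num.sqrt (1 - x ^+ 2) = `|y| by rewrite -xy addrC addKr sqrtr_sqr.
have E (t : R) : 2 * pi * (t / (2 * pi)) = t by rewrite mulrC divfK// two_pi_neq0.
have [y0|y0] := lerP 0 y.
  exists (acos x / (2 * pi)); rewrite /ce E sin_acos// y2 ger0_norm//.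
  by rewrite acosK.
exists (- (acos x / (2 * pi))).
rewrite /ce mulrN cosN sinN E sin_acos// y2 ltr0_norm// opprK.
by rewrite acosK.
Qed.

(** A point of the unit circle at distance less than 1 from 1 has positive real part, so its
    argument is [asin] of its imaginary part, and [asin] is continuous at 0. *)
Lemma ce_local_inverse (r : R) : 0 < r -> exists2 s : R, 0 < s &
  forall z : C, md z = 1 -> md (z - 1) < s -> exists2 t, `|t| < r & ce t = z.
Proof.
move=> r0.
have h0 : (-1 : R) < 0 < (1 : R) by rewrite ltrN10 ltr01.
have asin0 : asin 0 = 0 :> R.
  rewrite -{1}sin0 sinK// in_itv /=; have := @pi_ge0 R; lra.
have rp : 0 < r * (2 * pi) by rewrite !mulr_gt0// pi_gt0.
have /cvgrPdist_lt/(_ _ rp)/near_R[s s0 Hs] := continuous_asin h0.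
exists (Num.min s 1); first by rewrite lt_min s0 ltr01.
move=> z z1; rewrite lt_min => /andP[zs zo].
have [x1 xy] := unit_circle z1.
have y1 : -1 <= complex.Im z <= 1 by rewrite -ler_norml -z1 Im_md.
have yE : complex.Im (z - 1) = complex.Im z by case: z {z1 zs zo x1 xy y1} => a b /=; ring.
have xE : complex.Re (z - 1) = complex.Re z - 1 by case: z {z1 zs zo x1 xy y1 yE} => a b.
have ys : `|complex.Im z - 0| < s.
  by rewrite subr0 -yE; apply: le_lt_trans zs; exact: Im_md.
have xp : 0 < complex.Re z.
  have : `|complex.Re z - 1| < 1 by rewrite -xE; apply: le_lt_trans zo; exact: Re_md.
  by rewrite ltr_norml => /andP[]; lra.
exists (asin (complex.Im z) / (2 * pi)).
  have tp : 0 < 2 * pi :> R by rewrite mulr_gt0// pi_gt0.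
  rewrite normrM normfV (gtr0_norm tp) ltr_pdivrMr//.
  by have := Hs _ ys; rewrite /= asin0 sub0r normrN.
rewrite /ce mulrC divfK ?two_pi_neq0// cos_asin// asinK//.
have -> : Num.sqrt (1 - complex.Im z ^+ 2) = complex.Re z.
  by rewrite -xy addrK sqrtr_sqr gtr0_norm.
by case: (z).
Qed.

Definition box (u : PL) (r : R) (u' : PL) :=
  `|u'.1 - u.1| < r /\ `|u'.2 - u.2| < r.

Definition seg (u u' : PL) (t : R) : PL :=
  (u.1 + t * (u'.1 - u.1), u.2 + t * (u'.2 - u.2)).

Definition convexP (A : PL -> Prop) := forall u u' (t : R), A u -> A u' ->
  0 <= t <= 1 -> A (seg u u' t).

Lemma norm_conv (a b c r t : R) : `|a - c| < r -> `|b - c| < r -> 0 <= t <= 1 ->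
  `|a + t * (b - a) - c| < r.
Proof.
move=> ha hb /andP[t0 t1].
have -> : a + t * (b - a) - c = (1 - t) * (a - c) + t * (b - c) by ring.
apply: le_lt_trans (ler_normD _ _) _.
rewrite !normrM ger0_norm ?subr_ge0// (ger0_norm t0).
have [->|tn0] := eqVneq t 0; first by rewrite mul0r addr0 subr0 mul1r.
have tp : 0 < t by rewrite lt_def tn0.
have h1 : (1 - t) * `|a - c| <= (1 - t) * r by rewrite ler_wpM2l ?subr_ge0// ltW.
have h2 : t * `|b - c| < t * r by rewrite ltr_pM2l.
lra.
Qed.

Lemma box_convex u r : convexP (box u r).
Proof. by move=> a b t [a1 a2] [b1 b2] t01; split; exact: norm_conv. Qed.

Lemma boxI_convex A B : convexP A -> convexP B -> convexP (fun u => A u /\ B u).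
Proof. by move=> cA cB u u' t [? ?] [? ?] t01; split; [exact: cA|exact: cB]. Qed.

Lemma box_self u r : 0 < r -> box u r u.
Proof. by move=> r0; split; rewrite subrr normr0. Qed.

Lemma box_le u r r' u' : r <= r' -> box u r u' -> box u r' u'.
Proof. by move=> rr [h1 h2]; split; exact: lt_le_trans rr. Qed.

Lemma box_trans u u' u'' r r' : box u r u' -> box u' r' u'' -> box u (r + r') u''.
Proof.
move=> [h1 h2] [h3 h4]; split.
  by have := ler_normD (u''.1 - u'.1) (u'.1 - u.1); rewrite addrA subrK; lra.
by have := ler_normD (u''.2 - u'.2) (u'.2 - u.2); rewrite addrA subrK; lra.
Qed.

Lemma box_open u r u' : box u r u' -> exists2 s : R, 0 < s &
  forall u'', box u' s u'' -> box u r u''.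
Proof.
move=> [h1 h2]; exists (Num.min (r - `|u'.1 - u.1|) (r - `|u'.2 - u.2|)).
  by rewrite lt_min !subr_gt0 h1.
move=> u'' [h3 h4]; split.
  have := ler_normD (u''.1 - u'.1) (u'.1 - u.1); rewrite addrA subrK.
  by move: h3; rewrite lt_min => /andP[]; lra.
have := ler_normD (u''.2 - u'.2) (u'.2 - u.2); rewrite addrA subrK.
by move: h4; rewrite lt_min => /andP[_]; lra.
Qed.

Lemma near_box (u : PL) (P : PL -> Prop) :
  (\forall u' \near u, P u') <-> exists2 r : R, 0 < r & forall u', box u r u' -> P u'.
Proof.
split=> [[[A B] /= [/near_R[s s0 Hs] /near_R[t t0 Ht]] AB]|[s s0 Hs]].
  exists (Num.min s t); first by rewrite lt_min s0.
  move=> u' [h1 h2]; apply: AB; split.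
    by apply: Hs; move: h1; rewrite lt_min => /andP[].
  by apply: Ht; move: h2; rewrite lt_min => /andP[].
exists ([set x | `|x - u.1| < s], [set x | `|x - u.2| < s]).
  by split; apply/near_R; exists s.
by move=> u' [/= ? ?]; exact: Hs.
Qed.

Definition unit_square : set PL := `[(0 : R), 1]%classic `*` `[(0 : R), 1]%classic.

Lemma unit_square_compact : compact unit_square.
Proof. by apply: compact_setX; exact: segment_compact. Qed.

(** The Lebesgue number of the compact square. The hypothesis concerns all [s] below the local
    radius, so that compactness can be used with the filter of small positive reals. *)
Lemma lebesgue_square (P : R -> PL -> Prop) :
  (forall u, unit_square u -> exists2 r : R, 0 < r & forall s u', s < r ->
     box u r u' -> P s u') ->
  exists2 r : R, 0 < r & forall u, unit_square u -> P r u.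
Proof.
move=> H.
have /compact_near_coveringP/(_ R (nbhs (0 : R)^'+) P) := unit_square_compact.
case.
  move=> u /H[r r0 Hr].
  exists ([set u' | box u r u'], [set s | s < r]) => /=.
    split; first by apply/near_box; exists r.
    exact: nbhs_right_lt.
  by move=> [u' s] [/= h1 h2]; exact: Hr.
move=> r /= r0 Hr; exists (r / 2); first by rewrite divr_gt0.
move=> u; apply: Hr => /=; last by rewrite divr_gt0.
by rewrite sub0r normrN gtr0_norm ?divr_gt0//; move: r0 => /=; lra.
Qed.

Lemma frac_square (u : PL) : exists m n : int,
  unit_square (u - (m%:~R, n%:~R)).
Proof.
exists (Num.floor u.1), (Num.floor u.2).
have := Num.Theory.floor_itv u.1; have := Num.Theory.floor_itv u.2.
rewrite !rmorphD /= => /andP[h1 h2] /andP[h3 h4].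
by split; rewrite /= in_itv /=; apply/andP; split; lra.
Qed.

Lemma box_shift u e r u' : box (u + e) r u' <-> box u r (u' - e).
Proof.
have E1 : (u' - e).1 - u.1 = u'.1 - (u + e).1 by rewrite /=; ring.
have E2 : (u' - e).2 - u.2 = u'.2 - (u + e).2 by rewrite /=; ring.
by rewrite /box E1 E2.
Qed.

End plane.

(** * Expansions in the defining functions *)

Section expansion.
Variable R : realType.
Local Notation C := R[i].
Variables (X : complexSurface R) (Y : set X).
Implicit Types (a b : chart R X) (p x y : X) (V r f g : X -> C) (c t : C).

Lemma cdiff_sub a f g p c u v u' v' : cdiff a f p u v -> cdiff a g p u' v' ->
  cdiff a (fun x => f x - c * g x) p (u - c * u') (v - c * v').
Proof.
move=> Hf Hg e e0; have c1 : 0 < md c + 1 by have := md_ge0 c; lra.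
have e2 : 0 < e / 2 by lra.
apply: filterS2 (Hf _ e2) (Hg _ (divr_gt0 e2 c1)) => x.
set A := md (zcoord a x - _) + _ => h1 h2.
set dz := zcoord a x - zcoord a p in h1 h2 *; set dw := wcoord a x - wcoord a p in h1 h2 *.
have -> : f x - c * g x - (f p - c * g p) - (u - c * u') * dz - (v - c * v') * dw =
  (f x - f p - u * dz - v * dw) - c * (g x - g p - u' * dz - v' * dw) by ring.
apply: le_trans (mdB _ _) _; rewrite mdM.
have A0 : 0 <= A by rewrite addr_ge0 ?md_ge0.
have h3 : md c * md (g x - g p - u' * dz - v' * dw) <= (md c + 1) * (e / 2 / (md c + 1) * A).
  by apply: ler_pM; rewrite ?md_ge0//; have := md_ge0 c; lra.
have E : (md c + 1) * (e / 2 / (md c + 1) * A) = e / 2 * A by field; lra.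
rewrite E in h3; have -> : e * A = e / 2 * A + e / 2 * A by field.
exact: lerD h1 h3.
Qed.

Definition holo V b p := \forall x \near p, exists u w, cdiff b V x u w.

Lemma holo_sub V W b p c : holo V b p -> holo W b p ->
  holo (fun x => V x - c * W x) b p.
Proof.
apply: filterS2 => x [u [v H]] [u' [v' H']].
by exists (u - c * u'), (v - c * v'); exact: cdiff_sub.
Qed.

Lemma holo_w b p : holo (wcoord b) b p.
Proof. by apply: nearW => x; exists 0, 1; exact: cdiff_w. Qed.

Definition holo1 (B : C -> C) z0 :=
  exists2 s : R, 0 < s & forall z, md (z - z0) < s -> exists d, cder B z d.

(** [r] is o(w^i) at [p]. This order, weaker than O(w^(i+1)), allows a coefficient B(z) of w^i to be
    frozen at its value at [p]. *)
Definition lo b p i r := forall e : R, 0 < e ->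
  \forall x \near p, md (r x) <= e * md (wcoord b x) ^+ i.

Lemma lo_near b p i r r' : (\forall x \near p, r x = r' x) -> lo b p i r ->
  lo b p i r'.
Proof. by move=> E H e e0; apply: filterS2 E (H _ e0) => x ->. Qed.

Lemma loD b p i r r' : lo b p i r -> lo b p i r' -> lo b p i (fun x => r x + r' x).
Proof.
move=> H H' e e0; have e2 : 0 < e / 2 by lra.
apply: filterS2 (H _ e2) (H' _ e2) => x h h'; apply: le_trans (mdD _ _) _.
apply: le_trans (lerD h h') _; rewrite -mulrDl; have -> // : e / 2 + e / 2 = e by field.
Qed.

Lemma lo_mul b p i j r g (L : R) : 0 <= L ->
  (\forall x \near p, md (g x) <= L * md (wcoord b x) ^+ j) ->
  lo b p i r -> lo b p (i + j) (fun x => r x * g x).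
Proof.
move=> L0 HL H e e0; have L1 : 0 < L + 1 by lra.
apply: filterS2 HL (H _ (divr_gt0 e0 L1)) => x h h'.
rewrite mdM; apply: le_trans (ler_pM (md_ge0 _) (md_ge0 _) h' h) _.
set w := md (wcoord b x); have w0 : 0 <= w ^+ (i + j) by rewrite exprn_ge0// md_ge0.
have -> : e / (L + 1) * w ^+ i * (L * w ^+ j) = L / (L + 1) * (e * w ^+ (i + j)).
  by rewrite exprD; field; lra.
rewrite ler_piMl//; first by rewrite mulr_ge0// ltW.
by rewrite ler_pdivrMr// mul1r; lra.
Qed.

Lemma loZ b p i r c : lo b p i r -> lo b p i (fun x => c * r x).
Proof.
move=> H; have := @lo_mul b p i 0 r (fun=> c) (md c) (md_ge0 c) _ H.
rewrite addn0 => G; apply: lo_near (G _); first by apply: nearW => x; rewrite mulrC.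
by apply: nearW => x; rewrite expr0 mulr1.
Qed.

Lemma lo_le a b p i r (L : R) : 0 <= L ->
  (\forall x \near p, md (wcoord b x) <= L * md (wcoord a x)) ->
  lo b p i r -> lo a p i r.
Proof.
move=> L0 HL H e e0; have L1 : 0 < (L + 1) ^+ i by rewrite exprn_gt0//; lra.
apply: filterS2 HL (H _ (divr_gt0 e0 L1)) => x h h'; apply: le_trans h' _.
rewrite -mulrA ler_wpM2l ?(ltW e0)// mulrC ler_pdivrMr// mulrC -exprMn.
have w0 := md_ge0 (wcoord a x).
rewrite lerXn2r ?nnegrE ?md_ge0//; first by rewrite mulr_ge0//; lra.
by apply: le_trans h _; rewrite ler_wpM2r//; lra.
Qed.

Lemma lo_bound b p i r (K : R) : dom b p -> wcoord b p = 0 -> 0 <= K ->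
  (\forall x \near p, md (r x) <= K * md (wcoord b x) ^+ i.+1) -> lo b p i r.
Proof.
move=> bp w0 K0 HK e e0; have K1 : 0 < K + 1 by lra.
apply: filterS2 HK (near_zw bp (divr_gt0 e0 K1)) => x h [_ h'].
rewrite w0 subr0 ltr_pdivlMr// in h'.
apply: le_trans h _; rewrite exprS mulrA ler_wpM2r// ?exprn_ge0 ?md_ge0//.
by have := md_ge0 (wcoord b x) => ?; have : K * md (wcoord b x) <= (K + 1) * md (wcoord b x); nra.
Qed.

Lemma lo_weak b p i j r : dom b p -> wcoord b p = 0 -> (i <= j)%N ->
  lo b p j r -> lo b p i r.
Proof.
move=> bp w0 ij H e e0.
apply: filterS2 (H _ e0) (near_zw bp ltr01) => x h [_ h'].
rewrite w0 subr0 in h'; apply: le_trans h _; rewrite ler_wpM2l ?(ltW e0)//.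
by rewrite ler_wiXn2l ?md_ge0 ?(ltW h').
Qed.

Lemma lo_uniq b p i V c c' : dom b p -> wcoord b p = 0 ->
  lo b p i (fun x => V x - c * wcoord b x ^+ i) ->
  lo b p i (fun x => V x - c' * wcoord b x ^+ i) -> c = c'.
Proof.
move=> bp w0 H H'; apply/eqP; rewrite -subr_eq0; apply/eqP/eqP/negPn/negP => n0.
have d0 : 0 < md (c - c') by rewrite md_gt0.
have d2 : 0 < md (c - c') / 2 by lra.
have D := loD H' (loZ (-1) H).
have /(near_chart _ bp)[s s0 Hs] := D _ d2; rewrite w0 in Hs.
have s2 : 0 < s / 2 by lra.
have [||_ _ wE] := Hs (zcoord b p) (s / 2)%:C%C.
- by rewrite subrr md0.
- by rewrite subr0 mdR gtr0_norm//; lra.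
set x := pt _ _ _ in wE *.
have -> : V x - c' * wcoord b x ^+ i + -1 * (V x - c * wcoord b x ^+ i) =
  (c - c') * wcoord b x ^+ i by ring.
rewrite wE mdM mdX mdR gtr0_norm// ler_pM2r ?exprn_gt0//; lra.
Qed.

Lemma loX a p A i : lo a p 1 (fun x => A x - wcoord a x) ->
  lo a p i (fun x => A x ^+ i - wcoord a x ^+ i).
Proof.
move=> H; have HA : \forall x \near p, md (A x) <= 2 * md (wcoord a x) ^+ 1.
  apply: filterS (H _ ltr01) => x; rewrite expr1 mul1r => h.
  have := md_tri 0 (A x) (wcoord a x); have := mdD (A x - wcoord a x) (wcoord a x).
  by rewrite subrK => ? _; lra.
elim: i => [|i IH].
  by move=> e e0; apply: nearW => x; rewrite !expr0 subrr md0 mulr1 ltW.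
have h1 := lo_mul (ler0n R 2) HA IH; rewrite addn1 in h1.
have h2 := @lo_mul a p 1 i _ (fun x => wcoord a x ^+ i) 1 ler01 _ H.
apply: lo_near (loD h1 (h2 _)).
  by apply: nearW => x; rewrite !exprS; ring.
by apply: nearW => x; rewrite mdX mul1r.
Qed.

(** The relation w_b = (w_a + phi w_a^i) / t, up to o(w_a^i), is substituted in the expansion of [V]
    in the chart [b]; [phi] enters the coefficient of order i through the linear term. *)
Lemma lo_change a b p V i (t phi be c : C) : t != 0 ->
  lo a p 1 (fun x => t * wcoord b x - wcoord a x) ->
  lo a p i (fun x => t * wcoord b x - wcoord a x - phi * wcoord a x ^+ i) ->
  lo b p i (fun x => V x - be * wcoord b x - c * wcoord b x ^+ i) ->
  lo a p i (fun x => V x - be / t * wcoord a x -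
                     (be / t * phi + c / t ^+ i) * wcoord a x ^+ i).
Proof.
move=> t0 H1 Hi HV; have mt : 0 < md t by rewrite md_gt0.
have HL : \forall x \near p, md (wcoord b x) <= 2 / md t * md (wcoord a x).
  apply: filterS (H1 _ ltr01) => x; rewrite expr1 mul1r => h.
  have := mdD (t * wcoord b x - wcoord a x) (wcoord a x).
  rewrite subrK mdM => h'; rewrite mulrAC ler_pdivlMr// mulrC; lra.
have L0 : 0 <= 2 / md t by rewrite divr_ge0// ltW.
have HV' := lo_le L0 HL HV.
apply: lo_near (loD (loD HV' (loZ (be / t) Hi)) (loZ (c / t ^+ i) (loX i H1))).
apply: nearW => x /=; rewrite exprMn; have ti : t ^+ i != 0 by rewrite expf_neq0.
set w := wcoord a x ^+ i; set w' := wcoord b x ^+ i.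
by field; rewrite t0 ti.
Qed.

Lemma adapted_w b p : adapted_chart Y b -> dom b p -> Y p -> wcoord b p = 0.
Proof. by move=> [_ H] bp /(H p bp). Qed.

(** This is [two_variable_taylor] read in the chart; the coefficient is a holomorphic function of
    the coordinate of [Y]. *)
Lemma expansion b p V i (K : R) : adapted_chart Y b -> dom b p -> Y p ->
  holo V b p -> 0 <= K -> (\forall x \near p, md (V x) <= K * md (wcoord b x) ^+ i) ->
  exists2 B, holo1 B (zcoord b p) & exists2 K' : R, 0 <= K' & \forall x \near p,
    md (V x - B (zcoord b x) * wcoord b x ^+ i) <= K' * md (wcoord b x) ^+ i.+1.
Proof.
move=> ab bp Yp hV K0 HK; have w0 := adapted_w ab bp Yp.
have HM : \forall x \near p, md (V x) <= md (V p) + 1.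
  have [u [w D]] := near_self hV; apply: filterS (cdiff_cont bp D ltr01) => x h.
  by have := md_lB (V x) (V p); lra.
have /(near_chart _ bp)[s s0 Hs] := nearI hV (nearI HK HM); rewrite w0 in Hs.
set z0 := zcoord b p in Hs *.
have zs z : md z < s -> md (z0 + z - z0) < s by rewrite addrAC subrr add0r.
have ws z : md z < s -> md (z - 0) < s by rewrite subr0.
have [|w hw z hz|z hz w hw|z w hz hw|B hB [K' K'0 HB]] :=
    @two_variable_taylor R (fun z w => V (pt b (z0 + z) w)) s (md (V p) + 1) K i s0 K0.
- by move=> z w /zs hz /ws hw; have [_ _ _ [_ []]] := Hs _ _ hz hw.
- have [dx zx wx [[u [v D]] _]] := Hs _ _ (zs _ hz) (ws _ hw).
  by exists u; have := cdiff_cder_z dx D; rewrite wx zx => /cder_shift.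
- have [dx zx wx [[u [v D]] _]] := Hs _ _ (zs _ hz) (ws _ hw).
  by exists v; have := cdiff_cder_w dx D; rewrite wx zx.
- have [_ _ wx [_ []]] := Hs _ _ (zs _ hz) (ws _ hw).
  by rewrite wx.
exists (fun z => B (- z0 + z)).
  exists s => // z hz; have [|d D] := hB (- z0 + z); first by rewrite addrC.
  by exists d; apply/cder_shift.
exists K' => //; have s4 : 0 < s / 4 by lra.
apply: filterS2 (near_dom bp) (near_zw bp s4) => x dx [h1 h2].
have := HB (- z0 + zcoord b x) (wcoord b x).
rewrite [z0 + _]addrA subrr add0r pt_coord//; apply.
  by rewrite addrC; apply: lt_trans h1 _; lra.
by rewrite w0 subr0 in h2; exact: ltW.
Qed.

Lemma lo_frozen b p i B d : dom b p -> cder B (zcoord b p) d ->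
  lo b p i (fun x => (B (zcoord b x) - B (zcoord b p)) * wcoord b x ^+ i).
Proof.
move=> bp D e e0; have [t t0 Ht] := gder_cont D e0.
apply: filterS (near_zw bp t0) => x [h _].
by rewrite mdM mdX ler_wpM2r ?exprn_ge0 ?md_ge0// ltW// Ht.
Qed.

Lemma expansion_lo b p V i (B : C -> C) (K : R) : adapted_chart Y b -> dom b p ->
  Y p -> holo1 B (zcoord b p) -> 0 <= K ->
  (\forall x \near p,
    md (V x - B (zcoord b x) * wcoord b x ^+ i) <= K * md (wcoord b x) ^+ i.+1) ->
  \forall y \near p, Y y ->
    lo b y i (fun x => V x - B (zcoord b y) * wcoord b x ^+ i).
Proof.
move=> ab bp Yp [s s0 hB] K0 /near_near HK.
apply: filterS3 HK (near_dom bp) (near_zw bp s0) => y Hy dy [hz _] Yy.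
have w0 := adapted_w ab dy Yy; have [d D] := hB _ hz.
by apply: lo_near (loD (lo_bound dy w0 K0 Hy) (lo_frozen i dy D)); apply: nearW => x /=; ring.
Qed.

(** The coefficient of order 0 vanishes at the points of [Y], and these realize every value of z
    near that of [p], so it vanishes identically there. *)
Lemma lipschitz_w b p V : adapted_chart Y b -> dom b p -> Y p -> holo V b p ->
  (\forall x \near p, Y x -> V x = 0) ->
  exists2 K : R, 0 <= K & \forall x \near p, md (V x) <= K * md (wcoord b x).
Proof.
move=> ab bp Yp hV V0; have w0 := adapted_w ab bp Yp.
have HM : \forall x \near p, md (V x) <= (md (V p) + 1) * md (wcoord b x) ^+ 0.
  have [u [w D]] := near_self hV; apply: filterS (cdiff_cont bp D ltr01) => x h.
  by rewrite expr0 mulr1; have := md_lB (V x) (V p); lra.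
have M0 : 0 <= md (V p) + 1 by rewrite addr_ge0 ?md_ge0.
have [B [s s0 hB] [K' K'0 HK]] := expansion ab bp Yp hV M0 HM.
exists K' => //.
have n1 : \forall x \near p, Y x -> B (zcoord b x) = 0.
  apply: filterS3 (near_dom bp) V0 HK => x dx Vx h Yx.
  rewrite (adapted_w ab dx Yx) (Vx Yx) !expr0 mulr1 expr1 md0 mulr0 sub0r mdN in h.
  by apply/eqP; rewrite -md_eq0 eq_le h md_ge0.
have /(near_adapted _ ab bp Yp)[r r0 Hr] := n1.
apply: filterS2 HK (near_zw bp r0) => x h [hz _].
by have [_ zE _ _] := Hr _ hz; rewrite zE => E; rewrite E mul0r subr0 expr1 in h.
Qed.

(** The bound [K] of the definition lies in [R[i]]; being nonnegative, it is equal to its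
    modulus. *)
Lemma type_bound (S : flat_system Y) n
    (f : 'I_(fs_size S) -> 'I_(fs_size S) -> C -> C) : @system_of_type R X Y S n f ->
  forall (j k : 'I_(fs_size S)) p, fs_U j p -> fs_U k p -> exists2 K : R, 0 <= K & \forall x \near p,
    md (fs_trans j k * fs_w k x - (fs_w j x + f j k (fs_z j x) * fs_w j x ^+ n.+1))
    <= K * md (fs_w j x) ^+ n.+2.
Proof.
move=> H j k p pj pk; have [_ [K K0 HK]] := H j k p pj pk.
exists (md K); first exact: md_ge0.
have KE : K = (md K)%:C%C by rewrite -md_norm ger0_norm.
apply: filterS HK => x; rewrite -md_norm_lt rmorphM rmorphXn /= -KE.
by rewrite -md_norm.
Qed.

Lemma type_flat (S : flat_system Y) n
    (f : 'I_(fs_size S) -> 'I_(fs_size S) -> C -> C) : @system_of_type R X Y S n f ->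
  forall (j k : 'I_(fs_size S)) p, fs_U j p -> fs_U k p -> exists2 K : R, 0 <= K & \forall x \near p,
    md (fs_trans j k * fs_w k x - fs_w j x) <= K * md (fs_w j x) ^+ n.+1.
Proof.
move=> H j k p pj pk; have [K K0 HK] := type_bound H pj pk.
have [D _] := H j k p pj pk; have [d {}D] := derivable_cder D.
have [Yp bp] := pj; have w0 := adapted_w (fs_adapted j) bp Yp.
have [t t0 Ht] := gder_cont D ltr01.
set M := md (f j k (fs_z j p)) + 1; have M0 : 0 <= M by rewrite addr_ge0 ?md_ge0.
exists (K + M); first by rewrite addr_ge0.
apply: filterS3 HK (near_zw bp t0) (near_zw bp ltr01) => x h [hz _] [_ hw].
have {}hz : md (f j k (fs_z j x)) <= M.
  by have := Ht _ hz; have := md_lB (f j k (fs_z j x)) (f j k (fs_z j p)); rewrite /M; lra.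
rewrite w0 subr0 -/(fs_w j x) in hw.
have -> : fs_trans j k * fs_w k x - fs_w j x =
  (fs_trans j k * fs_w k x - (fs_w j x + f j k (fs_z j x) * fs_w j x ^+ n.+1)) +
  f j k (fs_z j x) * fs_w j x ^+ n.+1 by ring.
apply: le_trans (mdD _ _) _; rewrite mulrDl; apply: lerD.
  apply: le_trans h _; rewrite ler_wpM2l// exprS ler_piMl ?exprn_ge0 ?md_ge0//.
  exact: ltW.
by rewrite mdM mdX ler_wpM2r// exprn_ge0// md_ge0.
Qed.

End expansion.

(** * The universal cover of the leaf *)

Section cover.
Variable R : realType.
Local Notation C := R[i].
Local Notation PL := (R * R)%type.
Variables (X : complexSurface R) (F : foliation X) (Y : set X).
Hypotheses (embY : embedded_curve Y) (Y_in_F : Y `<=` fol_dom F)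
  (Y_leaf : is_leaf F Y).
Variables (tf : X -> Cplane R) (tg : Cplane R -> X).
Hypotheses (tfc : {within Y, continuous tf})
  (tgc : {within @torus R, continuous tg})
  (tf_torus : forall x, Y x -> @torus R (tf x))
  (tg_Y : forall y, @torus R y -> Y (tg y))
  (tfK : forall x, Y x -> tg (tf x) = x)
  (tgK : forall y, @torus R y -> tf (tg y) = y).
Implicit Types (u e : PL) (x p : X).

Definition expP u : Cplane R := (ce u.1, ce u.2).
(** The universal covering of [Y]: the exponential covering of the torus followed by the
    homeomorphism [tg]. *)
Definition cov u : X := tg (expP u).
(** The lattice of pairs of integers, acting on the plane by deck translations. *)
Definition period e := ce e.1 = 1 /\ ce e.2 = 1.

Lemma torusE (y : Cplane R) : @torus R y <-> md y.1 = 1 /\ md y.2 = 1.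
Proof.
have E (z : R[i]) : `|z| = 1 <-> md z = 1.
  rewrite md_norm; split=> [h|->//].
  by apply: (@complexI R); exact: h.
by rewrite /torus /= !E.
Qed.

Lemma expP_torus u : @torus R (expP u).
Proof. by apply/torusE; rewrite !md_ce. Qed.

Lemma cov_Y u : Y (cov u).
Proof. exact/tg_Y/expP_torus. Qed.

Lemma cov_surj x : Y x -> exists u, cov u = x.
Proof.
move=> Yx; have /torusE[/ce_surj[s s1] /ce_surj[t t2]] := tf_torus Yx.
by exists (s, t); rewrite /cov /expP /= s1 t2 -surjective_pairing tfK.
Qed.

Lemma cov_cont u (P : X -> Prop) : (\forall x \near cov u, P x) ->
  exists2 r : R, 0 < r & forall u', box u r u' -> P (cov u').
Proof.
move=> nP; have /subspace_continuousP H := tgc.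
have := H _ (expP_torus u) _ nP; rewrite /within => /near_pair[s s0 Hs].
have cec (t : R) : rcont (@ce R) t by exact: gder_cont (ce_der t).
have [r1 r10 H1] := cec u.1 _ s0; have [r2 r20 H2] := cec u.2 _ s0.
exists (Num.min r1 r2); first by rewrite lt_min r10.
move=> u' [h1 h2]; apply: Hs; last exact: expP_torus.
  by apply: H1; rewrite -rmorphB mdR; move: h1; rewrite lt_min => /andP[].
by apply: H2; rewrite -rmorphB mdR; move: h2; rewrite lt_min => /andP[].
Qed.

(** [cov] is an open map onto [Y], by the continuity of [tf] and the local inverse of [ce]. *)
Lemma cov_open u (r : R) : 0 < r -> \forall x \near cov u, Y x ->
  exists2 u', box u r u' & cov u' = x.
Proof.
move=> r0; have [s s0 Hs] := ce_local_inverse r0.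
have /subspace_continuousP H := tfc.
have n : \forall y \near tf (cov u), md (y.1 - ce u.1) < s /\ md (y.2 - ce u.2) < s.
  by rewrite /cov tgK; [apply/near_pair; exists s|exact: expP_torus].
have W : \forall x \near cov u, Y x ->
    md ((tf x).1 - ce u.1) < s /\ md ((tf x).2 - ce u.2) < s.
  exact: (H _ (cov_Y u) _ n).
apply: filterS W => x W Yx; have [h1 h2] := W Yx.
have /torusE[m1 m2] := tf_torus Yx.
have q (z : C) (t : R) : md z = 1 -> md (z - ce t) < s ->
    exists2 t', `|t'| < r & ce (t + t') = z.
  move=> z1 zs; have [||t' t'r t'E] := Hs (z / ce t).
  - by rewrite mdM mdV md_ce z1 divr1.
  - rewrite -(divff (ce_neq0 t)) -mulrBl mdM mdV md_ce invr1 mulr1//.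
  by exists t' => //; rewrite ceD t'E mulrC divfK// ce_neq0.
have [t1 t1r E1] := q _ _ m1 h1; have [t2 t2r E2] := q _ _ m2 h2.
exists (u.1 + t1, u.2 + t2).
  by split; rewrite /= addrC addKr.
by rewrite /cov /expP /= E1 E2 -surjective_pairing tfK.
Qed.

Lemma cov_period u e : period e -> cov (u + e) = cov u.
Proof. by move=> [e1 e2]; rewrite /cov /expP /= !ceD e1 e2 !mulr1. Qed.

Lemma period_eq u u' : cov u = cov u' -> period (u' - u).
Proof.
move=> E; have : expP u = expP u'.
  by rewrite -(tgK (expP_torus u)) -(tgK (expP_torus u')) -!/(cov _) E.
move=> h; have E1 : ce u.1 = ce u'.1 := congr1 fst h.
have E2 : ce u.2 = ce u'.2 := congr1 snd h.
rewrite /period /= !ceD !ceN E1 E2; by rewrite !divff ?ce_neq0.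
Qed.

Lemma periodD e e' : period e -> period e' -> period (e + e').
Proof. by move=> [h1 h2] [h3 h4]; rewrite /period /= !ceD h1 h2 h3 h4 mulr1. Qed.

Lemma periodN e : period e -> period (- e).
Proof. by move=> [h1 h2]; rewrite /period /= !ceN h1 h2 invr1. Qed.

Lemma period_int (m n : int) : period (m%:~R, n%:~R).
Proof. by split; exact: ce_int. Qed.

(* A section over [A]: first integrals of [F] vanishing on [Y], given near each
   point of the universal cover and locally consistent as germs. *)
Definition sect (v : PL -> X -> C) (A : PL -> Prop) := forall u, A u ->
  good F (v u) (cov u) /\ exists2 r : R, 0 < r & forall u', A u' -> box u r u' ->
    \forall x \near cov u', v u' x = v u x.

Lemma sect_sub v A B : (forall u, B u -> A u) -> sect v A -> sect v B.
Proof.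
move=> BA H u Bu; have [g [r r0 Hr]] := H u (BA u Bu).
by split => //; exists r => // u' /BA; exact: Hr.
Qed.

Lemma sect_const V A : (forall u, A u -> good F V (cov u)) -> sect (fun=> V) A.
Proof.
by move=> H u Au; split; [exact: H|exists 1 => // u' _ _; exact: nearW].
Qed.

Lemma near_eq_trans p (f g h : X -> C) : (\forall x \near p, f x = g x) ->
  (\forall x \near p, g x = h x) -> \forall x \near p, f x = h x.
Proof. by apply: filterS2 => x -> ->. Qed.

Lemma near_eq_sym p (f g : X -> C) : (\forall x \near p, f x = g x) ->
  \forall x \near p, g x = f x.
Proof. by apply: filterS => x ->. Qed.

(** Analytic continuation along the segment from [u0] to [u], which stays in [A] by convexity: by
    [good_agree] the agreement of the two germs is locally constant along it. *)
Lemma sect_uniq v v' A u0 u : convexP A -> sect v A -> sect v' A -> A u0 -> A u ->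
  (\forall x \near cov u0, v u0 x = v' u0 x) ->
  \forall x \near cov u, v u x = v' u x.
Proof.
move=> cA sv sv' Au0 Au E0.
pose w t := seg u0 u t.
pose Q (t : R) := \forall x \near cov (w t), v (w t) x = v' (w t) x.
have w0 : w 0 = u0 by rewrite /w /seg !mul0r !addr0 -surjective_pairing.
have w1 : w 1 = u.
  by rewrite /w /seg !mul1r ![_ + (_ - _)]addrC !subrK -surjective_pairing.
suff : Q 1 by rewrite /Q w1.
apply: locally_constant_01; last by rewrite /Q w0.
move=> t t01; have At := cA _ _ _ Au0 Au t01.
have [g1 [r1 r10 H1]] := sv _ At; have [g2 [r2 r20 H2]] := sv' _ At.
have [r3 r30 H3] := cov_cont (good_agree embY Y_leaf g1 g2 (cov_Y _)).
set M := `|u.1 - u0.1| + `|u.2 - u0.2| + 1.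
have [M1 M2] : `|u.1 - u0.1| < M /\ `|u.2 - u0.2| < M.
  by have := normr_ge0 (u.1 - u0.1); have := normr_ge0 (u.2 - u0.2); rewrite /M; split; lra.
have M0 : 0 < M by exact: le_lt_trans M1.
set r := Num.min r1 (Num.min r2 r3).
have r0 : 0 < r by rewrite !lt_min r10 r20.
exists (r / M); first by rewrite divr_gt0.
move=> t' t'01; rewrite ltr_pdivlMr// => tt.
have At' := cA _ _ _ Au0 Au t'01.
have bx : box (w t) r (w t').
  have key (a b : R) : `|b - a| < M -> `|a + t' * (b - a) - (a + t * (b - a))| < r.
    move=> hab; rewrite opprD addrACA subrr add0r -mulrBl normrM.
    by apply: le_lt_trans tt; rewrite ler_wpM2l// ltW.
  by split; exact: key.
have bx' r' : r <= r' -> box (w t) r' (w t') by move=> /box_le; apply.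
have [rr1 rr2 rr3] : [/\ r <= r1, r <= r2 & r <= r3].
  by rewrite !ge_min !lexx !orbT.
have E1 := H1 _ At' (bx' _ rr1); have E2 := H2 _ At' (bx' _ rr2).
have E3 := H3 _ (bx' _ rr3) (cov_Y _).
rewrite /Q -E3; split=> h.
  exact: near_eq_trans (near_eq_sym E1) (near_eq_trans h E2).
exact: near_eq_trans E1 (near_eq_trans h (near_eq_sym E2)).
Qed.

Definition extendable (r : R) u := forall v, good F v (cov u) ->
  exists2 V, (\forall x \near cov u, V x = v x) &
    forall u', box u r u' -> good F V (cov u').

(** Near a point all first integrals are germs of a fixed one [v0], so they extend as far as [v0]
    does. Compactness makes the radius uniform on the unit square, and periods carry it to the whole
    plane. *)
Lemma extendable_uniform : exists2 r : R, 0 < r & forall u, extendable r u.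
Proof.
have [|r r0 Hr] := @lebesgue_square R extendable.
  move=> u0 _; have [v0 g0] := good_exists Y_in_F (cov_Y u0).
  have [r r0 Hr] := cov_cont (good_on_Y embY Y_leaf g0 (cov_Y u0)).
  exists (r / 2); first by rewrite divr_gt0.
  move=> s u sr hu v gv.
  have gV u' : box u0 r u' -> good F v0 (cov u') by move=> /Hr; apply; exact: cov_Y.
  have gu : good F v0 (cov u) by apply: gV; apply: box_le hu; lra.
  have [phi [d [pd E]]] := good_trans gu gv.
  exists (fun x => phi (v0 x)); first exact: near_eq_sym E.
  move=> u' hu'; apply: good_germ pd; apply: gV.
  by apply: box_le (box_trans hu hu'); lra.
exists r => // u v gv.
have [m [n sq]] := frac_square u.
have pe := period_int m n.
have cE : cov (u - (m%:~R, n%:~R)) = cov u by rewrite cov_period//; exact: periodN.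
have := Hr _ sq v; rewrite cE => /(_ gv)[V E HV].
exists V => // u' hu'.
have -> : cov u' = cov (u' - (m%:~R, n%:~R)) by rewrite cov_period//; exact: periodN.
by apply: HV; apply/box_shift; rewrite opprK subrK.
Qed.

(** The monodromy theorem for the plane. The germ is continued over boxes of radii [T n], each
    reached from the preceding one by extensions of radius [r]; their convexity provides the
    uniqueness. *)
Lemma sect_exists v0 : good F v0 (cov 0) -> exists2 v, sect v setT &
  \forall x \near cov 0, v 0 x = v0 x.
Proof.
move=> g0; have [r r0 Hr] := extendable_uniform.
have exE (uw : PL * (X -> C)) : exists V, good F uw.2 (cov uw.1) ->
    (\forall x \near cov uw.1, V x = uw.2 x) /\
    forall u', box uw.1 r u' -> good F V (cov u').
  have [g|ng] := pselect (good F uw.2 (cov uw.1)); last by exists uw.2.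
  by have [V E HV] := Hr _ _ g; exists V.
have [Ext HExt] := choice exE.
have ext u w : good F w (cov u) -> (\forall x \near cov u, Ext (u, w) x = w x) /\
    forall u', box u r u' -> good F (Ext (u, w)) (cov u').
  exact: HExt (u, w).
pose T n : R := r + n%:R * (r / 2).
have T0 n : 0 < T n by rewrite ltr_wpDr// mulr_ge0// divr_ge0// ltW.
have TS n : T n.+1 = T n + r / 2 by rewrite /T -natr1; ring.
have S n : exists2 v, sect v (box 0 (T n)) & \forall x \near cov 0, v 0 x = v0 x.
  elim: n => [|n [v sv Ev]].
    have [E HV] := ext _ _ g0; exists (fun=> Ext (0, v0)) => //.
    by apply: sect_const => u; rewrite /T mul0r addr0; exact: HV.
  (* The homothety of ratio [lam] maps the box of radius [T n.+1] into that of radius [T n] and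
     moves its points by less than r / 2, so [u] is within reach of the extension from [sc u]. *)
  set lam := T n / T n.+1.
  have l01 : 0 < lam < 1.
    by rewrite divr_gt0//= ltr_pdivrMr// mul1r TS ltrDl divr_gt0.
  have [l0 l1] := andP l01.
  pose sc u : PL := (lam * u.1, lam * u.2).
  have sc_in u : box 0 (T n.+1) u -> box 0 (T n) (sc u).
    have lE : lam * T n.+1 = T n by rewrite divfK// lt0r_neq0.
    move=> [h1 h2]; split; rewrite /= subr0 normrM (gtr0_norm l0) -lE ltr_pM2l//.
      by move: h1; rewrite /= subr0.
    by move: h2; rewrite /= subr0.
  have sc_near u : box 0 (T n.+1) u -> box (sc u) (r / 2) u.
    have lE : (1 - lam) * T n.+1 = r / 2.
      by rewrite mulrBl mul1r divfK ?lt0r_neq0// TS addrC addKr.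
    have key (a : R) : `|a - 0| < T n.+1 -> `|a - lam * a| < r / 2.
      rewrite subr0 => h; rewrite -{1}[a]mul1r -mulrBl normrM ger0_norm; last by lra.
      by rewrite -lE ltr_pM2l//; lra.
    by move=> [h1 h2]; split; exact: key.
  have sc_box u u' s : box u s u' -> box (sc u) s (sc u').
    have key (a b : R) : `|b - a| < s -> `|lam * b - lam * a| < s.
      move=> h; rewrite -mulrBr normrM (gtr0_norm l0); apply: le_lt_trans h.
      by rewrite ler_piMl// ltW.
    by move=> [h1 h2]; split; exact: key.
  pose v' u := Ext (sc u, v (sc u)).
  have gsc u : box 0 (T n.+1) u -> good F (v (sc u)) (cov (sc u)).
    by move=> /sc_in/sv[].
  have s00 : sc 0 = 0 by rewrite /sc /= !mulr0.
  exists v'.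
    move=> u hu; have [E HV] := ext _ _ (gsc u hu); split.
      by apply: HV; apply: box_le (sc_near u hu); lra.
    have [_ [r1 r10 H1]] := sv _ (sc_in u hu).
    have [r2 r20 H2] := cov_cont (near_near E).
    exists (Num.min (r / 4) (Num.min r1 r2)); first by rewrite !lt_min r10 r20 divr_gt0.
    move=> u' hu' bu.
    have [b1 b2 b3] : [/\ box u (r / 4) u', box u r1 u' & box u r2 u'].
      by split; apply: box_le bu; rewrite !ge_min lexx ?orbT.
    have [E' HV'] := ext _ _ (gsc u' hu').
    have Ev' := H1 _ (sc_in u' hu') (sc_box _ _ _ b2).
    have EV := H2 _ (sc_box _ _ _ b3).
    (* The extensions from [sc u] and from [sc u'] are first integrals over the convex set [B] and
       agree at [sc u']; so they agree at [u'], which lies in [B]. *)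
    pose B w := box (sc u) r w /\ box (sc u') r w.
    have cB : convexP B by apply: boxI_convex; exact: box_convex.
    have sV : sect (fun=> v' u) B by apply: sect_const => w [h _]; exact: HV.
    have sV' : sect (fun=> v' u') B by apply: sect_const => w [_ h]; exact: HV'.
    apply: (sect_uniq cB sV' sV (u0 := sc u')).
    - split; last exact: box_self.
      by apply: box_le (sc_box _ _ _ b1); lra.
    - split; last by apply: box_le (sc_near u' hu'); lra.
      by apply: box_le (box_trans (sc_near u hu) b1); lra.
    - apply: near_eq_trans E' _; apply: near_eq_trans Ev' _; exact: near_eq_sym EV.
  have [E _] := ext _ _ (gsc 0 (box_self _ (T0 _))).
  by rewrite /v'; move: E; rewrite s00 => E; exact: near_eq_trans E Ev.
(* The sections over the boxes agree where they overlap, since all of them start from [v0] at 0, and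
   the boxes exhaust the plane. *)
have [sg Hsg] : {sg : nat -> PL -> X -> C | forall n, sect (sg n) (box 0 (T n)) /\
    \forall x \near cov 0, sg n 0 x = v0 x}.
  have S' n : exists w, sect w (box 0 (T n)) /\ \forall x \near cov 0, w 0 x = v0 x.
    by have [w ? ?] := S n; exists w.
  by apply: cid; have [sg Hsg] := choice S'; exists sg.
have cv u : exists n, box 0 (T n) u.
  pose a := `|u.1| + `|u.2|.
  have a0 : 0 <= a by rewrite addr_ge0.
  exists (Num.bound (a / (r / 2))).
  have h : a < T (Num.bound (a / (r / 2))).
    have q0 : 0 <= a / (r / 2) by rewrite divr_ge0// divr_ge0// ltW.
    have := archi_boundP q0; rewrite ltr_pdivrMr ?divr_gt0// => h.
    by apply: lt_le_trans h _; rewrite /T lerDr ltW.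
  by split; rewrite /= subr0; apply: le_lt_trans h; rewrite /a ?lerDl ?lerDr.
have [nn Hnn] := choice cv.
have TT m n : (m <= n)%N -> T m <= T n.
  by move=> mn; rewrite lerD2l ler_wpM2r ?ler_nat// divr_ge0// ltW.
have agree m n u : box 0 (T m) u -> box 0 (T n) u ->
    \forall x \near cov u, sg m u x = sg n u x.
  wlog mn : m n / (m <= n)%N.
    move=> W hm hn; have [mn|nm] := leqP m n; first exact: W.
    by apply: near_eq_sym; apply: W => //; exact: ltnW.
  move=> hm hn; apply: (@sect_uniq _ _ (box 0 (T m)) 0) => //.
  - exact: box_convex.
  - by case: (Hsg m).
  - by apply: sect_sub (Hsg n).1 => w; exact: box_le (TT _ _ mn).
  - exact: box_self.
  - exact: near_eq_trans (Hsg m).2 (near_eq_sym (Hsg n).2).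
exists (fun u => sg (nn u) u); last by case: (Hsg (nn 0)).
move=> u _; have [gu [r1 r10 H1]] := (Hsg (nn u)).1 u (Hnn u); split => //.
have [r2 r20 H2] := box_open (Hnn u).
exists (Num.min r1 r2); first by rewrite lt_min r10.
move=> u' _ bu.
have [b1 b2] : box u r1 u' /\ box u r2 u'.
  by split; apply: box_le bu; rewrite ge_min lexx ?orbT.
apply: near_eq_trans (H1 u' (H2 u' b2) b1).
exact: agree (Hnn u') (H2 u' b2).
Qed.

Lemma sect_shift v e : period e -> sect v setT ->
  sect (fun u => v (u + e)) setT.
Proof.
move=> pe sv u _; have [g [r r0 Hr]] := sv (u + e) I.
rewrite cov_period// in g; split => //; exists r => // u' _ bu.
have := Hr (u' + e) I; rewrite cov_period//; apply.
by apply/box_shift; rewrite addrK.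
Qed.

Lemma sect_germ v phi d : germ phi d -> sect v setT ->
  sect (fun u x => phi (v u x)) setT.
Proof.
move=> pd sv u _; have [g [r r0 Hr]] := sv u I.
split; first exact: good_germ g pd.
by exists r => // u' _ bu; have := Hr u' I bu; apply: filterS => x ->.
Qed.

Lemma all_convex : convexP (@setT PL).
Proof. by []. Qed.

Lemma sect_trans v v' : sect v setT -> sect v' setT ->
  exists phi d, germ phi d /\ forall u, \forall x \near cov u, v' u x = phi (v u x).
Proof.
move=> sv sv'; have [phi [d [pd E]]] := good_trans (sv 0 I).1 (sv' 0 I).1.
exists phi, d; split => // u.
exact: (sect_uniq (u0 := 0) all_convex sv' (sect_germ pd sv)).
Qed.

Lemma holonomy_germs v : sect v setT -> exists (h : PL -> C -> C) (m : PL -> C),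
  forall e, period e -> germ (h e) (m e) /\
    forall u, \forall x \near cov u, v (u + e) x = h e (v u x).
Proof.
move=> sv; have ex e : exists hm : (C -> C) * C, period e -> germ hm.1 hm.2 /\
    forall u, \forall x \near cov u, v (u + e) x = hm.1 (v u x).
  have [pe|npe] := pselect (period e); last by exists (id, 1).
  have [phi [d H]] := sect_trans sv (sect_shift pe sv).
  by exists (phi, d).
have [hm Hhm] := choice ex.
by exists (fun e => (hm e).1), (fun e => (hm e).2).
Qed.


(** * Holonomy of the sections *)

Lemma diff0_germ (f : C -> C) : diff0 f -> germ f ('D_1 (f : R[i]^o -> R[i]^o) 0).
Proof.
move=> [f0 /near_md[s s0 Hs] d0]; split => //.
  by exists s => // z zs; apply: derivable_cder; apply: Hs; rewrite subr0.
by apply/cderP/derivableP/Hs; rewrite subrr md0.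
Qed.

Lemma germ_diff0 (f : C -> C) d : germ f d ->
  diff0 f /\ 'D_1 (f : R[i]^o -> R[i]^o) 0 = d.
Proof.
move=> [f0 [r r0 fr] fd d0].
have E : 'D_1 (f : R[i]^o -> R[i]^o) 0 = d by case: (cderP f 0 d).2.
split => //; split => //; last by rewrite E.
apply/near_md; exists r => // z; rewrite subr0 => /fr[e]; exact: cder_derivable.
Qed.

(** The factor [lam] is arbitrary in the hypothesis; comparing derivatives at 0 shows that it is the
    multiplier of [f]. *)
Lemma linearizable_conj (f chi : C -> C) (d d' lam : C) : germ f d -> germ chi d' ->
  near0 (fun z => chi (f z) = lam * chi z) -> linearizable f.
Proof.
move=> fd gc E; have [k [kg E1 E2]] := germ_inv gc.
have [cd _] := germ_diff0 gc; have [kd _] := germ_diff0 kg.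
have lamE : lam = 'D_1 (f : R[i]^o -> R[i]^o) 0.
  have [_ ->] := germ_diff0 fd.
  have [_ _ cf e0] := gc; have [f0 _ ff _] := fd.
  have D1 : cder (fun z => chi (f z)) 0 (d' * d) by apply: (gder_comp ff); rewrite f0.
  have D2 : cder (fun z => chi (f z)) 0 (lam * d').
    case: E => s s0 Hs; apply: (gder_near s0) (gderZ lam cf) => y /=.
    by rewrite subr0 => /Hs.
  by apply: (mulIf e0); rewrite -(cder_uniq D1 D2) mulrC.
have tonear (P : C -> Prop) : near0 P -> \forall z \near (0 : R[i]^o), P z.
  by move=> [s s0 Hs]; apply/near_md; exists s => // y; rewrite subr0; exact: Hs.
exists chi, k; split => //; apply: tonear => //.
apply: near0_sub (near0_and (germ_near kg E) E1) _ => z [-> ->].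
by rewrite lamE.
Qed.

Lemma sect_exists_any : exists v, sect v setT.
Proof.
have [v0 g0] := good_exists Y_in_F (cov_Y 0).
by have [v sv _] := sect_exists g0; exists v.
Qed.

Section holonomy.
Variables (v : PL -> X -> C) (h : PL -> C -> C) (m : PL -> C).
Hypotheses (sv : sect v setT)
  (hol : forall e, period e -> germ (h e) (m e) /\
    forall u, \forall x \near cov u, v (u + e) x = h e (v u x)).

Lemma good_v u : good F (v u) (cov u).
Proof. by case: (@sv u I). Qed.

(** Both sides express the continuation of [v] to the translate by e + e' in terms of [v 0];
    [good_near_inv] turns this into an equality of germs. *)
Lemma holD_add e e' : period e -> period e' ->
  near0 (fun z => h (e + e') z = h e (h e' z)).
Proof.
move=> pe pe'; have [_ H1] := hol pe; have [_ H2] := hol pe'.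
have [_ H3] := hol (periodD pe pe').
apply: (good_near_inv (good_v 0)).
have := H1 (0 + e'); rewrite cov_period// => H1'.
apply: filterS3 H1' (H2 0) (H3 0) => x E1 E2 <-.
by rewrite -E2 -E1; congr (v _ x); ring.
Qed.

(** The addition of periods is commutative: this is the commutativity of the fundamental group of
    the torus. *)
Lemma hol_comm e e' : period e -> period e' ->
  near0 (fun z => h e (h e' z) = h e' (h e z)).
Proof.
move=> pe pe'; apply: near0_sub (near0_and (holD_add pe pe') (holD_add pe' pe)) _.
by move=> z [<- <-]; rewrite addrC.
Qed.

Lemma hol_0 : near0 (fun z => h 0 z = z).
Proof.
have p0 : period 0 by rewrite /period ce0.
have [_ H] := hol p0; apply: (good_near_inv (good_v 0)).
by have := H 0; apply: filterS => x <-; rewrite addr0.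
Qed.

Lemma mult_add e e' : period e -> period e' -> m (e + e') = m e * m e'.
Proof.
move=> pe pe'; have [g1 _] := hol pe; have [g2 _] := hol pe'.
have [g3 _] := hol (periodD pe pe').
exact: germ_deriv_eq g3 (germ_comp g1 g2) (holD_add pe pe').
Qed.

Lemma multN e : period e -> m (- e) * m e = 1.
Proof.
move=> pe; rewrite -mult_add//; last exact: periodN.
have p0 : period 0 by rewrite /period ce0.
rewrite addNr; exact: germ_deriv_eq (hol p0).1 (germ_id R) hol_0.
Qed.

(* Along a lift of the curve the germ of [v] stays equal to the analytic
   continuation of its initial value; at the end it has changed by a period. *)
Lemma path_step (gam : R -> X) (a b : R) W k d u :
  {within `[(0 : R), 1], continuous gam} ->
  (forall s, s \in `[(0 : R), 1] -> Y (gam s)) -> 0 <= a -> a <= b -> b <= 1 ->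
  foliated_chart F W -> adapted_chart Y W ->
  (forall s, s \in `[a, b] -> dom W (gam s)) -> germ k d -> cov u = gam a ->
  (\forall x \near gam a, v u x = k (wcoord W x)) ->
  exists2 u', cov u' = gam b & \forall x \near gam b, v u' x = k (wcoord W x).
Proof.
move=> gc gY a0 ab b1 Wf Wa Wd kd ua Ea.
pose w (t : R) := a + t * (b - a).
have wab t : 0 <= t <= 1 -> a <= w t <= b.
  move=> /andP[t0 t1]; have := mulr_ge0 t0 (ltac:(lra) : 0 <= b - a).
  have : t * (b - a) <= 1 * (b - a) by rewrite ler_wpM2r//; lra.
  by rewrite /w => ? ?; apply/andP; split; lra.
have w01 t : 0 <= t <= 1 -> 0 <= w t <= 1.
  by move=> /wab/andP[? ?]; apply/andP; split; lra.
pose Q t := exists2 u', cov u' = gam (w t) & \forall x \near gam (w t), v u' x = k (wcoord W x).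
have wE0 : w 0 = a by rewrite /w mul0r addr0.
have wE1 : w 1 = b by rewrite /w mul1r addrC subrK.
suff : Q 1 by rewrite /Q wE1.
apply: locally_constant_01; last by rewrite /Q wE0; exists u.
move=> t t01; set p := gam (w t).
have Yp s : 0 <= s <= 1 -> Y (gam (w s)) by move=> /w01 s01; apply: gY; rewrite in_itv.
have dp s : 0 <= s <= 1 -> dom W (gam (w s)) by move=> /wab s01; apply: Wd; rewrite in_itv.
have [u0 u0p] := cov_surj (Yp t t01).
have gk : good F (fun x => k (wcoord W x)) p.
  exact: good_germ (good_foliated_chart Wf Wa (dp t t01) (Yp t t01)) kd.
have gv : good F (v u0) p by rewrite /p -u0p; exact: good_v.
have [phi [d' [pd E]]] := good_trans gv gk.
have [_ [r r0 Hr]] := @sv u0 I.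
have n1 := cov_open u0 r0; rewrite u0p in n1.
have n2 := nearI (near_near E) (good_on_Y embY Y_leaf gv (Yp t t01)).
have gcc := within_clamp gc.
have cE s : 0 <= s <= 1 -> clamp (w s) = w s by move=> /w01; exact: clamp_id.
have N : \forall s \near w t,
    (Y (gam (clamp s)) -> exists2 u', box u0 r u' & cov u' = gam (clamp s)) /\
    ((\forall x \near gam (clamp s), k (wcoord W x) = phi (v u0 x)) /\
     (Y (gam (clamp s)) -> good F (v u0) (gam (clamp s)))).
  have N' : nbhs (gam (clamp (w t))) (fun x => (Y x -> exists2 u', box u0 r u' & cov u' = x) /\
     ((\forall y \near x, k (wcoord W y) = phi (v u0 y)) /\ (Y x -> good F (v u0) x))).
    by rewrite cE//; exact: nearI n1 n2.
  exact: (gcc (w t) _ N').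
have /near_R[s s0 Hs] := N.
exists (s / (b - a + 1)); first by rewrite divr_gt0//; lra.
move=> t' t'01; rewrite ltr_pdivlMr; last by lra.
move=> tt.
have ws : `|w t' - w t| < s.
  apply: le_lt_trans tt; rewrite /w opprD addrACA subrr add0r -mulrBl normrM.
  by rewrite ler_wpM2l// ger0_norm; lra.
have := Hs _ ws; rewrite cE// => -[H1 [H2 H3]].
have [u1 bu1 u1p] := H1 (Yp t' t'01).
have {}H3 := H3 (Yp t' t'01).
have Eu1 := Hr u1 I bu1; rewrite u1p in Eu1.
(* [u1] is the lift of the new point that is close to [u0]. If the germ is realized at another lift
   [u2], then it is realized at [t] at the translate of [u0] by the period u2 - u1; the converse is
   symmetric. *)
split=> [[u2 u2p E2]|[u2 u2p E2]].
  have pe : period (u2 - u1) by apply: period_eq; rewrite u1p.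
  have [he _] := hol pe.
  have Ee : near0 (fun z => h (u2 - u1) z = phi z).
    apply: (good_near_inv H3).
    have := (hol pe).2 u1; rewrite addrC subrK u1p => E3.
    by have := nearI Eu1 E2; apply: filterS3 E3 H2 => x e1 e2 [e3 e4];
       rewrite -e2 -e4 e1 e3.
  exists (u0 + (u2 - u1)); first by rewrite cov_period.
  have := (hol pe).2 u0; rewrite u0p => E3.
  have := good_near gv Ee; apply: filterS3 E E3 => x -> ->.
  by move=> ->.
have pe : period (u2 - u0) by apply: period_eq; rewrite u0p.
have Ee : near0 (fun z => h (u2 - u0) z = phi z).
  apply: (good_near_inv gv).
  have := (hol pe).2 u0; rewrite addrC subrK u0p => E3.
  by apply: filterS3 E E2 E3 => x <- <- <-.
exists (u1 + (u2 - u0)); first by rewrite cov_period.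
have := (hol pe).2 u1; rewrite u1p => E3.
have := good_near H3 Ee.
by have := nearI Eu1 E3; apply: filterS3 H2 => x -> [e1 ->] ; rewrite e1 => ->.
Qed.

(** Around the loop the lift moves by a period [e], while the coordinate of the transversal is
    transformed by the holonomy. The two resulting expressions of the continued first integral give
    the conjugacy of [hh] with the inverse of [h e]. *)
Lemma path_lift (gam : R -> X) hh : closed_curve Y gam ->
  holonomy_along F Y gam hh -> exists e k d d',
  [/\ period e, germ k d, germ hh d' & near0 (fun z => h e (k (hh z)) = k z)].
Proof.
move=> [gc gY g01] [n [s [W [g [[n0 s0 sn Wn] HW Hs Hg Hh]]]]].
have mono i : (i <= n)%N -> 0 <= s i.
  elim: i => [|i IH] ile; first by rewrite s0.
  by have [h1 _] := Hs i ile; apply: le_trans h1; exact/IH/ltnW.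
have mono1 i : (i <= n)%N -> s (n - i)%N <= 1.
  elim: i => [|i IH] ile; first by rewrite subn0 sn.
  apply: le_trans (IH (ltnW ile)).
  by have [|h1 _] := Hs (n - i.+1)%N; [rewrite ltn_subrL|rewrite -subSn// subSS in h1].
have s1 i : (i <= n)%N -> s i <= 1.
  by move=> ile; have := mono1 (n - i)%N (leq_subr _ _); rewrite subKn.
have Ysi i : (i <= n)%N -> Y (gam (s i)).
  by move=> ile; apply: gY; rewrite in_itv /= mono// s1.
have [f0 a0] := HW 0%N n0.
have d0 i : (i < n)%N -> dom (W i) (gam (s i)).
  by move=> ile; have [h1 h2] := Hs i ile; apply: h2; rewrite in_itv /= lexx.
have [u0 u0E] := cov_surj (Ysi 0%N isT).
have g0 : good F (v u0) (gam (s 0%N)) by rewrite -u0E; exact: good_v.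
have [k0 [dk0 [k0g Ek0]]] := good_trans
  (good_foliated_chart f0 a0 (d0 _ n0) (Ysi 0%N isT)) g0.
(* Passing to the next chart replaces [k] by its composite with the inverse of [g i], so [k] after
   the product of the first i transitions remains the initial germ [k0]. *)
have claim i : (i <= n)%N -> exists u k d d', [/\ cov u = gam (s i), germ k d,
    germ (fun z => iteri i g z) d',
    (\forall x \near gam (s i), v u x = k (wcoord (W i) x)) &
    near0 (fun z => k (iteri i g z) = k0 z)].
  elim: i => [|i IH] ile.
    exists u0, k0, dk0, 1; split => //; first exact: germ_id.
    exact: near0_true.
  have [u [k [d [d' [uE kd itd Ev Ek]]]]] := IH (ltnW ile).
  have [fi ai] := HW i ile; have [hi di] := Hs i ile.
  have [u' u'E Ev'] := path_step gc gY (mono i (ltnW ile)) hi (s1 _ ile) fi ai di kd uE Ev.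
  have [/diff0_germ gd [_ wE]] := Hg i ile.
  have [g' [g'd E1 E2]] := germ_inv gd.
  exists u', (fun z => k (g' z)); do 2 eexists; split => //.
  - exact: germ_comp kd g'd.
  - exact: (germ_comp gd itd).
  - have dW : dom (W i) (gam (s i.+1)) by apply: di; rewrite in_itv /= hi lexx.
    have w0 : wcoord (W i) (gam (s i.+1)) = 0 by apply/ai.2 => //; exact: Ysi.
    have := near_w dW E2; apply: filterS3 Ev' wE => x -> -> /=.
    by rewrite w0 subr0 => ->.
  - apply: near0_sub (near0_and Ek (germ_near itd E2)) _ => z [<- e2] /=.
    by rewrite e2.
have [u [k [d [d' [uE kd itd Ev Ek]]]]] := claim n (leqnn n).
have E0 : gam (s n) = gam (s 0%N) by rewrite sn s0 g01.
have hg : germ hh d'.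
  apply: germ_eq itd _; move: Hh => /near_md[r r0 Hr]; exists r => // z zr.
  by rewrite Hr// subr0.
have pe : period (u - u0) by apply: period_eq; rewrite u0E uE.
exists (u - u0), k0, dk0, d'; split => //.
have dW : dom (W 0%N) (gam (s 0%N)) by exact: d0.
have w0 : wcoord (W 0%N) (gam (s 0%N)) = 0 by apply/a0.2 => //; exact: Ysi.
have Ehk : near0 (fun z => h (u - u0) (k0 z) = k z).
  apply: (near_w_inv dW); rewrite w0.
  have := (hol pe).2 u0; rewrite addrC subrK u0E => E3.
  rewrite E0 Wn in Ev.
  by apply: filterS3 Ev E3 Ek0 => x h1 h2 h3; rewrite subr0 -h3 -h2 -h1.
have Eh : near0 (fun z => hh z = iteri n g z).
  by move: Hh => /near_md[r r0 Hr]; exists r => // z zr; rewrite Hr// subr0.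
apply: near0_sub (near0_and (near0_and Eh Ek) (germ_near hg Ehk)) _.
by move=> z [[e1 e2] ->]; rewrite e1.
Qed.

Lemma multiplier_modulus (gam : R -> X) (hh : C -> C) : closed_curve Y gam ->
  holonomy_along F Y gam hh -> irrationally_indifferent hh -> ~ linearizable hh ->
  (forall e, period e -> md (m e) = 1) /\
  exists e0, [/\ period e0, forall n, (0 < n)%N -> m e0 ^+ n != 1 &
    ~ exists psi d, germ psi d /\
      exists lam, near0 (fun z => psi (h e0 z) = lam * psi z)].
Proof.
move=> gc gh [_ irr] nlin.
have [e0 [k [d [d' [p0 kd hd E]]]]] := path_lift gc gh.
have [hg0 _] := hol p0.
have d'E : m e0 * d' = 1.
  have D := germ_comp hg0 (germ_comp kd hd).
  have := germ_deriv_eq D kd E => h1; have [_ _ _ dn0] := kd.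
  by apply: (mulfI dn0); rewrite mulr1 -[RHS]h1; ring.
(* [hh] is conjugate by [k] to the inverse of [h e0], so a linearization of [h e0] gives one of
   [hh], with the inverse factor. *)
have nl : ~ exists psi d, germ psi d /\
      exists lam, near0 (fun z => psi (h e0 z) = lam * psi z).
  move=> [psi [dp [pg [lam Ep]]]]; apply: nlin.
  have l0 : lam != 0.
    apply/eqP => l0; have [_ _ pd pn0] := pg.
    have := germ_comp pg hg0 => -[_ _ D /negP]; apply; apply/eqP.
    apply: cder_uniq D _; case: Ep => s s0 Hs.
    apply: (@gder_near _ _ _ (fun=> 0) _ _ _ _ s0) (gder_cst _ _ _) => y /=.
    by rewrite subr0 => /Hs ->; rewrite l0 mul0r.
  apply: (linearizable_conj (lam := lam^-1) hd (germ_comp pg kd)).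
  apply: near0_sub (near0_and E (germ_near (germ_comp kd hd) Ep)) _ => z [<- ->].
  by rewrite mulKf.
split; last first.
  exists e0; split => // n n0; apply/eqP => mn.
  have [_ DE] := germ_diff0 hd.
  have := irr n n0; rewrite DE => /eqP; apply.
  by rewrite -[LHS]mul1r -mn -exprMn d'E expr1n.
(* Koenigs' coordinate of a contracting [h e'] also linearizes [h e0], which commutes with it. An
   expanding [h e] is treated through [h (- e)], whose multiplier is inverse. *)
move=> e pe; have small e' : period e' -> md (m e') < 1 -> False.
  move=> pe' lt1; apply: nl; have [hg' _] := hol pe'.
  have [psi pg Ep] := koenigs hg' hg0 (hol_comm pe' p0) lt1.
  by exists psi, 1; split => //; exists (m e0).
have [lt1|gt1|//] := ltgtP (md (m e)) 1; first by have := small e pe lt1.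
exfalso; apply: (small (- e) (periodN pe)).
have := multN pe => /(congr1 (@md R)); rewrite mdM md1 => h1.
have m0 : 0 < md (m e) by exact: lt_trans gt1.
by rewrite -(ltr_pM2r m0) h1 mul1r.
Qed.

End holonomy.

(** * Ueda coefficients *)

Lemma locally_constant_plane (Q : PL -> Prop) :
  (forall u, exists2 r : R, 0 < r & forall u', box u r u' -> (Q u' <-> Q u)) ->
  forall u u', Q u -> Q u'.
Proof.
move=> HQ u u' Qu; pose w t := seg u u' t.
have w0 : w 0 = u by rewrite /w /seg !mul0r !addr0 -surjective_pairing.
have w1 : w 1 = u'.
  by rewrite /w /seg !mul1r ![_ + (_ - _)]addrC !subrK -surjective_pairing.
suff : Q (w 1) by rewrite w1.
apply: (@locally_constant_01 R (fun t => Q (w t))); last by rewrite w0.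
move=> t _; have [r r0 Hr] := HQ (w t).
set M := `|u'.1 - u.1| + `|u'.2 - u.2| + 1.
have [M1 M2] : `|u'.1 - u.1| <= M /\ `|u'.2 - u.2| <= M.
  by have := normr_ge0 (u'.1 - u.1); have := normr_ge0 (u'.2 - u.2); rewrite /M; split; lra.
have M0 : 0 < M by rewrite /M ltr_wpDl// addr_ge0.
exists (r / M); first by rewrite divr_gt0.
move=> t' _; rewrite ltr_pdivlMr// => tt; apply: Hr.
have key (x y : R) : `|y - x| <= M -> `|x + t' * (y - x) - (x + t * (y - x))| < r.
  move=> hxy; rewrite opprD addrACA subrr add0r -mulrBl normrM.
  by apply: le_lt_trans tt; rewrite ler_wpM2l.
by split; exact: key.
Qed.

(** Near [u], [M] is the modulus of a holomorphic function of the coordinate of [Y] in the chart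
    [b]: this lets the maximum principle act on functions defined on the plane. *)
Definition locmod (M : PL -> R) u (b : chart R X) (B : C -> C) :=
  [/\ adapted_chart Y b, dom b (cov u), holo1 B (zcoord b (cov u)) &
  exists2 r : R, 0 < r & forall u', box u r u' -> M u' = md (B (zcoord b (cov u')))].

Lemma locmod_cont M u b B (e : R) : locmod M u b B -> 0 < e ->
  exists2 r : R, 0 < r & forall u', box u r u' -> `|M u' - M u| < e.
Proof.
move=> [ab bu [s s0 hB] [r r0 Hr]] e0.
have [|d D] := hB (zcoord b (cov u)); first by rewrite subrr md0.
have [t t0 Ht] := gder_cont D e0.
have [r' r'0 Hr'] := cov_cont (near_zw bu t0).
exists (Num.min r r'); first by rewrite lt_min r0.
move=> u' bu'; have [b1 b2] : box u r u' /\ box u r' u'.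
  by split; apply: box_le bu'; rewrite ge_min lexx ?orbT.
have [h _] := Hr' _ b2; have {}h := Ht _ h.
rewrite (Hr _ b1) (Hr u (box_self _ r0)) ltr_norml.
have h1 := md_lB (B (zcoord b (cov u'))) (B (zcoord b (cov u))).
have h2 := md_lB (B (zcoord b (cov u))) (B (zcoord b (cov u'))).
rewrite mdBC in h2; apply/andP; split; lra.
Qed.

(** [cov_open] turns a maximum over a box of the plane into one over a neighborhood in [Y], hence
    over a disc of the coordinate of the chart. *)
Lemma locmod_max M u b B : locmod M u b B -> (forall u', M u' <= M u) ->
  exists2 s : R, 0 < s & forall z, md (z - zcoord b (cov u)) < s ->
    B z = B (zcoord b (cov u)).
Proof.
move=> [ab bu [s s0 hB] [r r0 Hr]] mx; set z0 := zcoord b (cov u) in hB *.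
have H : \forall x \near cov u, Y x -> md (B (zcoord b x)) <= md (B z0).
  apply: filterS (cov_open u r0) => x Hx Yx; have [u' bu' <-] := Hx Yx.
  by rewrite -(Hr _ bu') -(Hr u (box_self _ r0)).
have [t t0 Ht] := (near_adapted _ ab bu (cov_Y u)).1 H.
set rho := Num.min s t; have rho0 : 0 < rho by rewrite lt_min s0.
exists rho => // z hz.
have := @max_principle R (fun y => B (z0 + y)) rho _ _ (z - z0) hz.
rewrite addr0 addrC subrK; apply=> y hy.
- have [|d D] := hB (z0 + y).
    by rewrite addrAC subrr add0r; apply: lt_le_trans hy _; rewrite ge_min lexx.
  by exists d; apply/cder_shift.
- have [|_ zE _ _] := Ht (z0 + y).
    rewrite addrAC subrr add0r; apply: lt_le_trans hy _.
    by rewrite ge_min lexx orbT.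
  by rewrite zE.
Qed.

Lemma periodic_max M : (forall u, exists b B, locmod M u b B) ->
  (forall u e, period e -> M (u + e) = M u) -> exists u0, forall u, M u <= M u0.
Proof.
move=> HM perM.
have cM : {within @unit_square R, continuous M}.
  apply: continuous_subspaceT => u; apply/cvgrPdist_lt => e e0.
  have [b [B HB]] := HM u; have [r r0 Hr] := locmod_cont HB e0.
  by apply/near_box; exists r => // u' /Hr; rewrite distrC.
have ne : @unit_square R !=set0 by exists 0; split; rewrite /= in_itv /= lexx ler01.
have [u0 _ H0] := compact_EVT_max ne (@unit_square_compact R) cM.
exists u0 => u; have [k [l sq]] := frac_square u.
rewrite -(perM u _ (periodN (period_int k l))).
by apply: H0; rewrite inE.
Qed.

(** The points where [M] is maximal form a set that is nonempty by compactness and periodicity, open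
    by the maximum principle and closed by continuity; so every point is one of them. *)
Lemma locmod_const M : (forall u, exists b B, locmod M u b B) ->
  (forall u e, period e -> M (u + e) = M u) -> forall u b B, locmod M u b B ->
  exists2 s : R, 0 < s & forall z, md (z - zcoord b (cov u)) < s ->
    B z = B (zcoord b (cov u)).
Proof.
move=> HM perM; have [u0 H0] := periodic_max HM perM.
have E : forall u, M u = M u0.
  move=> u1; apply: (@locally_constant_plane (fun u => M u = M u0) _ u0) => // u.
  have [b [B HB]] := HM u.
  have [e|/eqP ne] := eqVneq (M u) (M u0).
    have mx u' : M u' <= M u by rewrite e.
    have [s s0 Hs] := locmod_max HB mx; case: HB => _ bu _ [r r0 Hr].
    have [r' r'0 Hr'] := cov_cont (near_zw bu s0).
    exists (Num.min r r'); first by rewrite lt_min r0.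
    move=> u' bu'; have [b1 b2] : box u r u' /\ box u r' u'.
      by split; apply: box_le bu'; rewrite ge_min lexx ?orbT.
    have [h _] := Hr' _ b2.
    by rewrite (Hr _ b1) (Hs _ h) -(Hr u (box_self _ r0)).
  have d0 : 0 < `|M u0 - M u| by rewrite normr_gt0 subr_eq0 eq_sym; apply/eqP.
  have [r r0 Hr] := locmod_cont HB d0; exists r => // u' /Hr h.
  by split => [e|//]; rewrite e ltxx in h.
by move=> u b B HB; apply: locmod_max HB _ => u'; rewrite !E.
Qed.

Section ueda.
Variables (S : flat_system Y) (v : PL -> X -> C) (m : PL -> C) (e0 : PL) (n : nat).
Hypotheses (sv : sect v setT) (m1 : forall e, period e -> md (m e) = 1)
  (p0 : period e0) (irr : forall k, (0 < k)%N -> m e0 ^+ k != 1)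
  (quasi : forall u e, period e -> exists2 K : R, 0 <= K &
    \forall x \near cov u, md (v (u + e) x - m e * v u x) <= K * md (v u x) ^+ n.+2).
Local Notation J := ('I_(fs_size S)).
Local Notation b := (@fs_chart _ _ _ S).
Local Notation w j := (wcoord (b j)).
Local Notation tr := (@fs_trans _ _ _ S).
Implicit Types (j k : J) (be ga : J -> PL -> C) (i : nat).

Hypotheses (n1 : (0 < n)%N)
  (flatn : forall j k p, fs_U j p -> fs_U k p -> exists2 K : R, 0 <= K &
    \forall x \near p, md (tr j k * w k x - w j x) <= K * md (w j x) ^+ n.+1).

(** The coefficients are functions on the plane and not on [Y], because [v] is multivalued on [Y].
    Their values at points that do not lie over the chart are junk. *)
Definition lconst be := forall u j, dom (b j) (cov u) ->
  exists2 r : R, 0 < r & forall u', box u r u' -> be j u' = be j u.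
Definition cocycle_rel i be := forall u j k, dom (b j) (cov u) -> dom (b k) (cov u) ->
  be j u = be k u / tr j k ^+ i.
Definition equivar be := forall u e j, period e -> dom (b j) (cov u) ->
  be j (u + e) = m e * be j u.
Definition approx i (be : J -> PL -> C) := forall u j, dom (b j) (cov u) ->
  exists2 K : R, 0 <= K & \forall x \near cov u,
    md (v u x - be j u * w j x) <= K * md (w j x) ^+ i.+1.
Definition linear_upto i be :=
  [/\ lconst be, cocycle_rel 1 be, equivar be & approx i be].

Lemma tr_neq0 j k : tr j k != 0.
Proof. by rewrite -normr_eq0 fs_unitary oner_eq0. Qed.

Lemma md_tr j k : md (tr j k) = 1.
Proof. by apply: (@complexI R); rewrite -md_norm; exact: fs_unitary. Qed.

Lemma cov_U u j : dom (b j) (cov u) -> fs_U j (cov u).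
Proof. by move=> bj; split => //; exact: cov_Y. Qed.

Lemma w_cov u j : dom (b j) (cov u) -> w j (cov u) = 0.
Proof. by move=> bj; apply: adapted_w (fs_adapted j) bj (cov_Y u). Qed.

Lemma holo_v u j : dom (b j) (cov u) -> holo (v u) (b j) (cov u).
Proof.
move=> bj; have [bh _] := fs_adapted j.
exact: good_cdiff (@sv u I).1 bh bj.
Qed.

Lemma v_lipschitz u j : dom (b j) (cov u) -> exists2 K : R, 0 <= K &
  \forall x \near cov u, md (v u x) <= K * md (w j x).
Proof.
move=> bj; apply: lipschitz_w (fs_adapted j) bj (cov_Y u) (holo_v bj) _.
have := good_on_Y embY Y_leaf (@sv u I).1 (cov_Y u).
by apply: filterS => x Hx /Hx; exact: good0.
Qed.

(** The coefficient of order i + 1 at each point of the plane, unique by [lo_uniq];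
    [local_coefficients] says that these values come from holomorphic functions of the coordinates
    of [Y]. *)
Definition coefficients i be ga := forall u j, dom (b j) (cov u) ->
  lo (b j) (cov u) i.+1
    (fun x => v u x - be j u * w j x - ga j u * w j x ^+ i.+1).
Definition local_coefficients i be ga := forall u j, dom (b j) (cov u) ->
  exists2 B : C -> C, holo1 B (zcoord (b j) (cov u)) &
  (exists2 r : R, 0 < r & forall u', box u r u' ->
    dom (b j) (cov u') /\ ga j u' = B (zcoord (b j) (cov u'))) /\
  exists2 K : R, 0 <= K & \forall x \near cov u,
    md (v u x - be j u * w j x - B (zcoord (b j) x) * w j x ^+ i.+1)
    <= K * md (w j x) ^+ i.+2.

Lemma coefficients_exist i be : linear_upto i be ->
  exists2 ga, coefficients i be ga & local_coefficients i be ga.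
Proof.
move=> [lc _ _ ap].
have ex u j : dom (b j) (cov u) -> exists2 B : C -> C, holo1 B (zcoord (b j) (cov u)) &
    exists2 K : R, 0 <= K & \forall x \near cov u,
    md (v u x - be j u * w j x - B (zcoord (b j) x) * w j x ^+ i.+1)
    <= K * md (w j x) ^+ i.+2.
  move=> bj; have [K K0 HK] := ap u j bj.
  have hV := holo_sub (be j u) (holo_v bj) (holo_w (b j) (cov u)).
  by apply: (expansion (fs_adapted j) bj (cov_Y u) hV K0).
have lo_of u j B K : dom (b j) (cov u) -> holo1 B (zcoord (b j) (cov u)) -> 0 <= K ->
    (\forall x \near cov u, md (v u x - be j u * w j x - B (zcoord (b j) x) * w j x ^+ i.+1)
    <= K * md (w j x) ^+ i.+2) ->
    \forall y \near cov u, Y y -> lo (b j) y i.+1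
     (fun x => v u x - be j u * w j x - B (zcoord (b j) y) * w j x ^+ i.+1).
  by move=> bj hB K0 HK; apply: expansion_lo HK => //; [exact: fs_adapted|exact: cov_Y].
have exc (ju : J * PL) : exists c : C, dom (b ju.1) (cov ju.2) ->
    lo (b ju.1) (cov ju.2) i.+1
    (fun x => v ju.2 x - be ju.1 ju.2 * w ju.1 x - c * w ju.1 x ^+ i.+1).
  case: ju => j u /=; have [bj|nb] := pselect (dom (b j) (cov u)); last by exists 0.
  have [B hB [K K0 HK]] := ex u j bj; exists (B (zcoord (b j) (cov u))) => _.
  exact: (near_self (lo_of _ _ _ _ bj hB K0 HK) (cov_Y u)).
have [g Hg] := choice exc.
exists (fun j u => g (j, u)); first by move=> u j; exact: Hg (j, u).
move=> u j bj; have [B hB [K K0 HK]] := ex u j bj; exists B => //; split; last by exists K.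
have [r1 r10 H1] := cov_cont (near_dom bj).
have [r2 r20 H2] := cov_cont (lo_of _ _ _ _ bj hB K0 HK).
have [_ [r3 r30 H3]] := @sv u I; have [r4 r40 H4] := lc u j bj.
exists (Num.min r1 (Num.min r2 (Num.min r3 r4))); first by rewrite !lt_min r10 r20 r30.
move=> u' bu; have [b1 b2 b3 b4] : [/\ box u r1 u', box u r2 u', box u r3 u' & box u r4 u'].
  by split; apply: box_le bu; rewrite !ge_min lexx ?orbT.
have dj := H1 _ b1; split=> //.
(* Uniqueness identifies the coefficient chosen at [u'] with the value there of the function [B]
   found at [u]. *)
apply: lo_uniq dj (w_cov dj) (Hg (j, u') dj) _.
apply: lo_near (H2 _ b2 (cov_Y u')).
by apply: filterS (H3 _ I b3) => x ->; rewrite (H4 _ b4).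
Qed.

Lemma flat_lo i j k u : (i <= n)%N -> dom (b j) (cov u) -> dom (b k) (cov u) ->
  lo (b j) (cov u) i (fun x => tr j k * w k x - w j x).
Proof.
move=> ile bj bk; have [K K0 HK] := flatn (cov_U bj) (cov_U bk).
by apply: lo_weak (bj) (w_cov bj) ile _; exact: lo_bound bj (w_cov bj) K0 HK.
Qed.

(** Up to order n it is used with [phi] equal to 0: the coefficients transform like local sections
    of a power of the conormal bundle. At order n + 1 [phi] is the cocycle of the system, and the
    relation, divided by the first coefficient, splits it. *)
Lemma coefficients_change i be ga j k u (phi : C) : linear_upto i be ->
  coefficients i be ga -> dom (b j) (cov u) -> dom (b k) (cov u) ->
  lo (b j) (cov u) i.+1 (fun x => tr j k * w k x - w j x - phi * w j x ^+ i.+1) ->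
  ga j u = be j u * phi + ga k u / tr j k ^+ i.+1.
Proof.
move=> [_ co _ _] Hc bj bk Hphi.
have h1 := lo_change (tr_neq0 j k) (flat_lo n1 bj bk) Hphi (Hc u k bk).
have E := co u j k bj bk; rewrite expr1 in E; rewrite -E in h1.
exact: lo_uniq bj (w_cov bj) (Hc u j bj) h1.
Qed.

(** By [quasi] the translate of [v] by [e] is m(e) times [v] up to O(w^(n+2)), beyond the orders
    considered, so uniqueness of coefficients applies. *)
Lemma coefficients_equivar i be ga : (i <= n)%N -> linear_upto i be ->
  coefficients i be ga -> equivar ga.
Proof.
move=> ile [_ _ eq _] Hc u e j pe bj.
have bj' : dom (b j) (cov (u + e)) by rewrite cov_period.
have h1 := Hc (u + e) j bj'; rewrite cov_period// in h1.
apply: (lo_uniq (bj) (w_cov bj) h1).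
have [K K0 HK] := quasi u pe; have [L L0 HL] := v_lipschitz bj.
have h2 : lo (b j) (cov u) i.+1 (fun x => v (u + e) x - m e * v u x).
  apply: (lo_weak bj (w_cov bj) (ile : (i.+1 <= n.+1)%N)).
  have KL : 0 <= K * L ^+ n.+2 by rewrite mulr_ge0// exprn_ge0.
  apply: lo_bound bj (w_cov bj) KL _.
  apply: filterS2 HK HL => x h h'; apply: le_trans h _.
  rewrite -mulrA -exprMn ler_wpM2l// lerXn2r ?nnegrE ?md_ge0//.
  by rewrite mulr_ge0 ?md_ge0.
apply: lo_near (loD h2 (loZ (m e) (Hc u j bj))).
by apply: nearW => x /=; rewrite eq//; ring.
Qed.

Lemma chart_at u : exists j, dom (b j) (cov u).
Proof. by have [j bj] := fs_cover S (cov_Y u); exists j. Qed.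

(* The moduli of the coefficients agree in all the charts and are periodic, so the
   maximum principle on the compact curve makes the coefficients constant. *)
Lemma coefficients_lconst i be : (i < n)%N -> linear_upto i be ->
  exists ga, [/\ lconst ga, cocycle_rel i.+1 ga, equivar ga & forall u j,
    dom (b j) (cov u) -> exists2 K : R, 0 <= K & \forall x \near cov u,
    md (v u x - be j u * w j x - ga j u * w j x ^+ i.+1) <= K * md (w j x) ^+ i.+2].
Proof.
move=> ilt Hb; have [ga Hc Hl] := coefficients_exist Hb.
have eqv := coefficients_equivar (ltnW ilt) Hb Hc.
have rel : cocycle_rel i.+1 ga.
  move=> u j k bj bk; rewrite (coefficients_change (phi := 0) Hb Hc bj bk).
    by rewrite mulr0 add0r.
  apply: lo_near (flat_lo ilt bj bk); apply: nearW => x.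
  by rewrite mul0r subr0.
have mdga u j k : dom (b j) (cov u) -> dom (b k) (cov u) -> md (ga j u) = md (ga k u).
  by move=> bj bk; rewrite (rel u j k)// mdM mdV mdX md_tr expr1n invr1 mulr1.
have [jj Hjj] := choice chart_at.
pose M u := md (ga (jj u) u).
have lm u j : dom (b j) (cov u) -> exists B, [/\ locmod M u (b j) B,
    exists2 r : R, 0 < r & (forall u', box u r u' -> ga j u' = B (zcoord (b j) (cov u'))) &
    exists2 K : R, 0 <= K & \forall x \near cov u,
    md (v u x - be j u * w j x - B (zcoord (b j) x) * w j x ^+ i.+1)
    <= K * md (w j x) ^+ i.+2].
  move=> bj; have [B hB [[r r0 Hr] HK]] := Hl u j bj; exists B; split => //.
    split=> //; [exact: fs_adapted|exists r => // u' /Hr[dj <-]].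
    exact: mdga.
  by exists r => // u' /Hr[].
have perM u e : period e -> M (u + e) = M u.
  move=> pe; have bj := Hjj u; have bj' := Hjj (u + e); rewrite cov_period// in bj'.
  by rewrite /M eqv// mdM m1// mul1r (mdga u _ (jj u)).
have exM u : exists (c : chart R X) B, locmod M u c B.
  by have [B [HB _ _]] := lm u _ (Hjj u); exists (b (jj u)), B.
have cst u j : dom (b j) (cov u) -> exists B, [/\
    exists2 s : R, 0 < s & forall z, md (z - zcoord (b j) (cov u)) < s -> B z = ga j u,
    exists2 r : R, 0 < r & (forall u', box u r u' -> ga j u' = B (zcoord (b j) (cov u'))) &
    exists2 K : R, 0 <= K & \forall x \near cov u,
    md (v u x - be j u * w j x - B (zcoord (b j) x) * w j x ^+ i.+1)
    <= K * md (w j x) ^+ i.+2].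
  move=> bj; have [B [HB [r r0 Hr] HK]] := lm u j bj; exists B; split => //; last by exists r.
  have [s s0 Hs] := locmod_const exM perM HB; exists s => // z /Hs ->.
  by rewrite (Hr u (box_self _ r0)).
exists ga; split => //.
- move=> u j bj; have [B [[s s0 Hs] [r r0 Hr] _]] := cst u j bj.
  have [r' r'0 Hr'] := cov_cont (near_zw bj s0).
  exists (Num.min r r'); first by rewrite lt_min r0.
  move=> u' bu'; have [b1 b2] : box u r u' /\ box u r' u'.
    by split; apply: box_le bu'; rewrite ge_min lexx ?orbT.
  by rewrite Hr//; apply: Hs; case: (Hr' _ b2).
- move=> u j bj; have [B [[s s0 Hs] _ [K K0 HK]]] := cst u j bj; exists K => //.
  apply: filterS2 HK (near_zw bj s0) => x h [hz _].
  by rewrite Hs// in h.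
Qed.

(** The general step is started from the zero coefficient at order 0, [v] being O(w). The
    coefficient obtained is nonzero because [v] has nonzero derivative transversally to [Y]. *)
Lemma linear_upto_1 : exists2 be, linear_upto 1 be &
  forall u j, dom (b j) (cov u) -> be j u != 0.
Proof.
have H0 : linear_upto 0 (fun _ _ => 0).
  split.
  - by move=> u j _; exists 1.
  - by move=> u j k _ _; rewrite mul0r.
  - by move=> u e j _ _; rewrite mulr0.
  - move=> u j bj; have [K K0 HK] := v_lipschitz bj; exists K => //.
    by apply: filterS HK => x; rewrite mul0r subr0 expr1.
have [be [lc co eq ap]] := coefficients_lconst n1 H0.
have ap1 : approx 1 be.
  move=> u j bj; have [K K0 HK] := ap u j bj; exists K => //.
  by apply: filterS HK => x; rewrite mul0r subr0 expr1.
exists be => // u j bj; apply/eqP => be0.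
have [d D dn0] := good_adapted_der Y_leaf (@sv u I).1 (fs_adapted j) bj (cov_Y u).
move/eqP: dn0; apply; have w0 := w_cov bj.
have D1 := cdiff_cder_w bj D; rewrite w0 in D1.
apply: cder_uniq D1 _ => e ee.
have [K K0 HK] := ap1 u j bj.
have /(near_chart _ bj)[s s0 Hs] := lo_bound bj w0 K0 HK ee; rewrite w0 in Hs.
exists s => // y hy; have [|_ _ wE] := Hs (zcoord (b j) (cov u)) y _ hy.
  by rewrite subrr md0.
have v0 : v u (pt (b j) (zcoord (b j) (cov u)) 0) = 0.
  by rewrite -w0 pt_coord// (good0 (@sv u I).1).
by rewrite wE v0 be0 !mul0r !subr0 expr1.
Qed.

Lemma linear_upto_n : exists2 be, linear_upto n be &
  forall u j, dom (b j) (cov u) -> be j u != 0.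
Proof.
suff H i : (0 < i <= n)%N -> exists2 be, linear_upto i be &
    forall u j, dom (b j) (cov u) -> be j u != 0 by apply: H; rewrite n1 leqnn.
elim: i => // -[_ _|i IH /andP[_ ile]]; first exact: linear_upto_1.
have [be Hb bn0] := IH (ltnW ile); have [lc co eq ap] := Hb.
have [ga [lc' co' eq' ap']] := coefficients_lconst ile Hb.
exists be => //; split => // u j bj.
suff g0 : ga j u = 0.
  have [K K0 HK] := ap' u j bj; exists K => //.
  by apply: filterS HK => x; rewrite g0 mul0r subr0.
have [jj Hjj] := choice chart_at.
(* [ga] is the coefficient of order i + 2 and [be] that of order 1, so the powers of [tr] cancel and
   [q] does not depend on the chart. *)
pose q u := ga (jj u) u / be (jj u) u ^+ i.+2.
have qE u1 k : dom (b k) (cov u1) -> q u1 = ga k u1 / be k u1 ^+ i.+2.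
  move=> bk; rewrite /q (co' u1 _ k (Hjj u1) bk) (co u1 _ k (Hjj u1) bk).
  rewrite expr1 expr_div_n.
  have t0 : tr (jj u1) k ^+ i.+2 != 0 by rewrite expf_neq0 ?tr_neq0.
  have be0 : be k u1 ^+ i.+2 != 0 by rewrite expf_neq0 ?bn0.
  by field; rewrite t0 be0.
have qc u1 u2 : q u1 = q u2.
  apply: (@locally_constant_plane (fun u => q u = q u2) _ u2) => // u3.
  have bk := Hjj u3; set k := jj u3 in bk.
  have [r1 r10 H1] := lc u3 k bk; have [r2 r20 H2] := lc' u3 k bk.
  have [r3 r30 H3] := cov_cont (near_dom bk).
  exists (Num.min r1 (Num.min r2 r3)); first by rewrite !lt_min r10 r20.
  move=> u' bu'; have [b1 b2 b3] : [/\ box u3 r1 u', box u3 r2 u' & box u3 r3 u'].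
    by split; apply: box_le bu'; rewrite !ge_min lexx ?orbT.
  by rewrite (qE u' k (H3 _ b3)) (qE u3 k bk) H1// H2.
have bj' : dom (b j) (cov (u + e0)) by rewrite cov_period.
have me0 : m e0 != 0 by rewrite -md_gt0 m1.
have be0 := bn0 u j bj.
have E := qc (u + e0) u; rewrite (qE _ j bj') (qE _ j bj) eq// eq'// exprMn in E.
have {}E : ga j u = m e0 ^+ i.+1 * ga j u.
  have M0 : m e0 ^+ i.+1 != 0 by rewrite expf_neq0.
  have B0 : be j u ^+ i.+2 != 0 by rewrite expf_neq0.
  move: E; rewrite exprS; set P := m e0 ^+ i.+1 in M0 *; set Q := be j u ^+ i.+2 in B0 *.
  move=> E; have L : m e0 * ga j u / (m e0 * P * Q) * (P * Q) = ga j u.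
    by field; rewrite me0 M0 B0.
  have L' : ga j u / Q * (P * Q) = P * ga j u by field; rewrite B0.
  by rewrite -L' -E L.
have /eqP : (m e0 ^+ i.+1 - 1) * ga j u = 0 by rewrite mulrBl mul1r -E subrr.
by rewrite mulf_eq0 subr_eq0 (negPf (irr _))//= => /eqP.
Qed.

(** The cochain is - ga / be: a period multiplies both coefficients by the same number, so their
    quotient is single-valued on [Y] although neither of them need be. *)
Lemma type_coboundary f : @system_of_type R X Y S n f -> coboundary n f.
Proof.
move=> Hf; have [be Hb bn0] := linear_upto_n.
have [lc co eq _] := Hb; have [ga Hc Hl] := coefficients_exist Hb.
have eqv := coefficients_equivar (leqnn n) Hb Hc.
have exU x : exists u, Y x -> cov u = x.
  by have [/cov_surj[u]|nY] := pselect (Y x); [exists u|exists 0].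
(* [U] picks a lift of each point of [Y]; by [qE] another lift gives the same cochain. *)
have [U HU] := choice exU.
pose q u j := - ga j u / be j u.
have qE u u' j : dom (b j) (cov u) -> cov u = cov u' -> q u j = q u' j.
  move=> bj /period_eq pe; have -> : u' = u + (u' - u) by rewrite addrC subrK.
  rewrite /q eq// eqv//; have me0 : m (u' - u) != 0 by rewrite -md_gt0 m1.
  by have be0 := bn0 u j bj; field; rewrite be0.
exists (fun j z => q (U (pt (b j) z 0)) j).
have gE j p : fs_U j p -> q (U (pt (b j) (fs_z j p) 0)) j = q (U p) j.
  by move=> [Yp bp]; rewrite -(adapted_w (fs_adapted j) bp Yp) pt_coord.
split=> [j p [Yp bp]|j k p pj pk].
  have uE := HU p Yp; set u := U p in uE.
  have bj : dom (b j) (cov u) by rewrite uE.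
  have [B [s s0 hB] [[r r0 Hr] _]] := Hl u j bj; have [r' r'0 Hr'] := lc u j bj.
  have rr0 : 0 < Num.min r r' by rewrite lt_min r0.
  have H := cov_open u rr0; rewrite uE in H.
  have [t t0 Ht] := (near_adapted _ (fs_adapted j) bp Yp).1 H.
  have [|d D] := hB (fs_z j p); first by rewrite uE subrr md0.
  apply: cder_derivable; apply: (gder_near t0) (gderZ (- (be j u)^-1) D) => z hz /=.
  have [_ zE _ _ [u' bu' u'E]] := Ht z hz.
  have [b1 b2] : box u r u' /\ box u r' u'.
    by split; apply: box_le bu'; rewrite ge_min lexx ?orbT.
  have [dj gaE] := Hr _ b1.
  rewrite -u'E -(qE u' _ j dj); last by rewrite HU//; exact: cov_Y.
  by rewrite /q gaE Hr'// u'E zE mulNr mulrC mulNr.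
have uE := HU p pj.1; set u := U p in uE.
have bj : dom (b j) (cov u) by rewrite uE; case: pj.
have bk : dom (b k) (cov u) by rewrite uE; case: pk.
rewrite !gE//.
have [D _] := Hf j k p pj pk; have [d {}D] := derivable_cder D.
have [K K0 HK] := type_bound Hf pj pk.
(* The cocycle is frozen at its value at [p], at the cost of o(w^(n+1)), which gives
   [coefficients_change] the constant that it takes. *)
have h : lo (b j) (cov u) n.+1 (fun x => tr j k * w k x - w j x
    - f j k (fs_z j p) * w j x ^+ n.+1).
  rewrite uE; have w0 := adapted_w (fs_adapted j) pj.2 pj.1.
  have := loD (lo_bound pj.2 w0 K0 HK) (lo_frozen n.+1 pj.2 D).
  by apply: lo_near; apply: nearW => x /=; rewrite /fs_w /fs_z; ring.
have E := coefficients_change Hb Hc bj bk h.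
rewrite /q -/u E (co u j k bj bk) expr1 exprS.
have t0 := tr_neq0 j k; have be0 := bn0 u k bk.
have tn0 : tr j k ^+ n != 0 by rewrite expf_neq0.
set T := tr j k ^+ n in tn0 *.
by field; rewrite t0 be0 tn0.
Qed.

End ueda.

(** * The two excluded types *)

Section gamma.
Variables (v : PL -> X -> C) (h : PL -> C -> C) (m : PL -> C) (e0 : PL).
Hypotheses (sv : sect v setT)
  (hol : forall e, period e -> germ (h e) (m e) /\
    forall u, \forall x \near cov u, v (u + e) x = h e (v u x))
  (m1 : forall e, period e -> md (m e) = 1)
  (p0 : period e0) (irr : forall k, (0 < k)%N -> m e0 ^+ k != 1).

(** [commuting_jets] is applied to the family of all periods, with [e0] as the irrational index.
    Composition with the inverse of [psi] then bounds the error by a power of the new first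
    integral. *)
Lemma linearizing_jets n : exists2 psi, germ psi 1 & forall u e, period e ->
  exists2 K : R, 0 <= K & \forall x \near cov u,
    md (psi (v (u + e) x) - m e * psi (v u x)) <= K * md (psi (v u x)) ^+ n.+2.
Proof.
pose T := {e : PL | period e}.
have hg (i : T) : germ (h (sval i)) (m (sval i)) by case: (hol (svalP i)).
have hc (i j : T) := hol_comm sv hol (svalP i) (svalP j).
have [psi pg Hpsi] := commuting_jets (c := exist _ e0 p0 : T) hg hc irr n.
exists psi => // u e pe; have [g [gg _ gpsi]] := germ_inv pg.
have [K K0 HK] := bigO_pos (bigO_comp gg (Hpsi (exist _ e pe))).
exists K => //; have [_ He] := hol pe.
have gv := (@sv u I).1.
have n1 := good_near gv (near0_and gpsi (germ_near pg HK)).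
by apply: filterS2 n1 (He u) => x [E H] ->; rewrite E in H.
Qed.

(** The nonzero class of order n is carried by some system, and [type_coboundary] applies to that
    very system, with a first integral linearized to the matching order. *)
Lemma not_type_alpha : ~ type_alpha Y.
Proof.
move=> [n [n1 _ _ [S [f [Hf nf]]]]]; apply: nf.
have [psi pg Hpsi] := linearizing_jets n.
exact: (type_coboundary (sect_germ pg sv) m1 p0 irr Hpsi n1 (type_flat Hf) Hf).
Qed.

(** * Systems with exactly linear transitions *)

Section beta.
Variable S : flat_system Y.
Hypothesis flat : forall j k x, dom (fs_chart j) x -> dom (fs_chart k) x ->
  @fs_trans _ _ _ S j k * fs_w k x = fs_w j x.
Local Notation J := ('I_(fs_size S)).
Local Notation b := (@fs_chart _ _ _ S).
Local Notation w j := (wcoord (b j)).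

Lemma flat_germ n (j k : J) p : fs_U j p -> fs_U k p -> exists2 K : R, 0 <= K &
  \forall x \near p, md (fs_trans j k * w k x - w j x) <= K * md (w j x) ^+ n.+1.
Proof.
move=> [_ bj] [_ bk]; exists 0 => //.
apply: filterS2 (near_dom bj) (near_dom bk) => x hj hk.
have := flat hj hk; rewrite /fs_w => ->.
by rewrite subrr md0 mul0r.
Qed.

(* The coefficient of [w_j] in [v] does not depend on the order of the expansion,
   since the linearizing jets are tangent to the identity. *)
Lemma linear_jets : exists2 be : J -> PL -> C, lconst be &
  forall n, exists2 psi, germ psi 1 &
  forall u (j : J), dom (b j) (cov u) -> exists2 K : R, 0 <= K & \forall x \near cov u,
    md (psi (v u x) - be j u * w j x) <= K * md (w j x) ^+ n.+2.
Proof.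
(* The order is shifted by one because [linear_upto_n] asks for a positive one. *)
have ex n : exists psi, germ psi 1 /\
    exists be : J -> PL -> C, linear_upto (fun u x => psi (v u x)) m n.+1 be.
  have [psi pg Hpsi] := linearizing_jets n.+1; exists psi; split=> //.
  have [be Hbe _] := linear_upto_n (sect_germ pg sv) m1 p0 irr Hpsi isT (@flat_germ n.+1).
  by exists be.
have [psi Hpsi] := choice ex.
have exb n : exists be : J -> PL -> C, linear_upto (fun u x => psi n (v u x)) m n.+1 be by case: (Hpsi n).
have [be Hbe] := choice exb.
have pg n : germ (psi n) 1 by case: (Hpsi n).
exists (be 0%N); first by case: (Hbe 0%N).
move=> n; exists (psi n) => // u j bj.
suff -> : be 0%N j u = be n j u by have [_ _ _ ap] := Hbe n; exact: ap.
have w0 := w_cov bj.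
have key k : lo (b j) (cov u) 1 (fun x => v u x - be k j u * w j x ^+ 1).
  have [_ _ _ ap] := Hbe k; have [K K0 HK] := ap u j bj.
  have h1 := lo_weak bj w0 (isT : (1 <= k.+1)%N) (lo_bound bj w0 K0 HK).
  have [L L0 HL] := v_lipschitz sv bj.
  have [M M0 HM] := bigO_pos (germ_bigO2 (pg k)).
  have h2 : lo (b j) (cov u) 1 (fun x => psi k (v u x) - 1 * v u x).
    have ML : 0 <= M * L ^+ 2 by rewrite mulr_ge0 ?sqr_ge0.
    apply: lo_bound bj w0 ML _.
    apply: filterS2 (good_near (@sv u I).1 HM) HL => x hM hL.
    apply: le_trans hM _; rewrite -mulrA -exprMn ler_wpM2l// lerXn2r ?nnegrE ?md_ge0//.
    by rewrite mulr_ge0 ?md_ge0.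
  apply: lo_near (loD h1 (loZ (-1) h2)); apply: nearW => x /=.
  by rewrite expr1; ring.
exact: lo_uniq bj w0 (key 0%N) (key n).
Qed.

(* In the chart [b j] all the jets of [v] along the transversals agree, so [v] is a
   function of [w_j] alone. *)
Lemma flat_good u (j : J) : dom (b j) (cov u) -> good F (w j) (cov u).
Proof.
move=> bj; have [be lc Hbe] := linear_jets.
have w0 := w_cov bj; have gv := (@sv u I).1.
have [_ [r r0 Hr]] := @sv u I; have [r' r'0 Hr'] := lc u j bj.
have rr0 : 0 < Num.min r r' by rewrite lt_min r0.
have v0 : \forall x \near cov u, Y x -> v u x = 0.
  apply: filterS (good_on_Y embY Y_leaf gv (cov_Y u)) => x Hx /Hx; exact: good0.
have n1 := nearI (nearI (holo_v sv bj) v0) (cov_open u rr0).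
have /(near_chart _ bj)[s s0 Hs] := n1; rewrite w0 in Hs.
set z0 := zcoord (b j) (cov u) in Hs *.
pose V z y := v u (pt (b j) z y).
have VH z : md (z - z0) < s -> holD (V z) s.
  move=> hz y hy; have [||dx zx wx [[[a [c D]] _] _]] := Hs z y; rewrite ?subr0//.
  by exists c; have := cdiff_cder_w dx D; rewrite wx zx.
have zz0 : md (z0 - z0) < s by rewrite subrr md0.
have YV z : md (z - z0) < s -> Y (pt (b j) z 0) /\ V z 0 = 0.
  move=> hz; have [||dx zx wx [[_ vx] _]] := Hs z 0; rewrite ?subr0 ?md0//.
  by have Yx : Y (pt (b j) z 0) by [apply/((fs_adapted j).2 _ dx)]; split => //; exact: vx.
(* The constant [be j u] serves for all the transversals near that of [z0]: each of them meets [Y]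
   at a point with a lift near [u], where [be j] has the same value. *)
have jets n : exists2 psi, germ psi 1 & forall z, md (z - z0) < s ->
    exists2 K : R, 0 <= K & near0 (fun y => md (psi (V z y) - be j u * y) <= K * md y ^+ n.+2).
  have [psi pg Hpsi] := Hbe n; exists psi => // z hz.
  have [Yx _] := YV z hz.
  have [||dx zx wx [_ Hu]] := Hs z 0; rewrite ?subr0 ?md0//.
  have [u' bu' u'E] := Hu Yx.
  have [b1 b2] : box u r u' /\ box u r' u'.
    by split; apply: box_le bu'; rewrite ge_min lexx ?orbT.
  have bj' : dom (b j) (cov u') by rewrite u'E.
  have [K K0 HK] := Hpsi u' j bj'; exists K => //.
  have n2 := nearI HK (Hr _ I b1).
  have /(near_chart _ bj')[t t0 Ht] := n2; rewrite u'E zx wx in Ht.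
  exists t => // y hy; have [||_ _ wy [h1 h2]] := Ht z y; rewrite ?subrr ?md0 ?subr0//.
  by rewrite h2 wy (Hr' _ b2) in h1.
(* Two transversals are compared through [psi]: its strict derivative at 0 is 1, so |A - B| is at
   most 2 |psi A - psi B|. The difference is then flat to every order, and [holD_flat] applies
   although [psi] changes with the order. *)
have VE z y : md (z - z0) < s -> md y < s -> V z y = V z0 y.
  move=> hz hy; apply/eqP; rewrite -subr_eq0; apply/eqP.
  apply: (@holD_flat R (fun y => V z y - V z0 y) s y _ _ hy).
    by apply: holD_sub; exact: VH.
  move=> n; apply: (bigO_le (leq_trans (leqnSn n) (leqnSn n.+1))).
  have [psi [_ [rho rho0 hpsi] psid _] Hpsi] := jets n.
  have half : 0 < 1 / 2 :> R by lra.
  have [t t0 [_ Ht]] := strict_der rho0 hpsi psid half.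
  have [K K0 [t1 t10 H1]] := Hpsi z hz; have [L L0 [t2 t20 H2]] := Hpsi z0 zz0.
  have small z' : md (z' - z0) < s -> near0 (fun y => md (V z' y) < t).
    move=> hz'; have [|d D] := VH z' hz' 0; first by rewrite md0.
    have [t3 t30 H3] := gder_cont D t0; exists t3 => // y' hy'.
    by have := H3 y'; rewrite subr0 (YV _ hz').2 subr0; exact.
  have [t3 t30 H3] := small z hz; have [t4 t40 H4] := small z0 zz0.
  exists (2 * (K + L)), (Num.min (Num.min t1 t2) (Num.min t3 t4)).
    by rewrite !lt_min t10 t20 t30.
  move=> y'; rewrite !lt_min => /andP[/andP[h1 h2] /andP[h3 h4]].
  have := Ht _ _ (H3 _ h3) (H4 _ h4); rewrite mul1r.
  set A := V z y'; set B := V z0 y'; move=> hAB.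
  have hp : md (psi A - psi B) <= K * md y' ^+ n.+2 + L * md y' ^+ n.+2.
    have -> : psi A - psi B = (psi A - be j u * y') - (psi B - be j u * y') by ring.
    by apply: le_trans (mdB _ _) _; exact: lerD (H1 _ h1) (H2 _ h2).
  have := md_lB (A - B) (psi A - psi B).
  by rewrite (mdBC (A - B)) => ?; lra.
have [d D dn0] := good_adapted_der Y_leaf gv (fs_adapted j) bj (cov_Y u).
have D1 := cdiff_cder_w bj D; rewrite w0 -/z0 in D1.
(* On the transversal at [z0] the derivative of [v] is nonzero, so inverting [V z0] expresses [w j]
   as a germ of [v]. *)
have tg' : germ (V z0) d.
  by split => //; [exact: (YV _ zz0).2|exists s => //; exact: VH].
have [g [gg _ gV]] := germ_inv tg'.
apply: good_eq (good_germ gv gg) _.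
have n3 := near_w bj gV; rewrite w0 in n3.
apply: filterS3 n3 (near_dom bj) (near_zw bj s0) => x hx dx [hz hw].
rewrite w0 subr0 in hx hw.
have -> : v u x = V (zcoord (b j) x) (wcoord (b j) x) by rewrite /V pt_coord.
by rewrite VE.
Qed.

Lemma flat_linear : exists psi d lam, germ psi d /\
  near0 (fun z => psi (h e0 z) = lam * psi z).
Proof.
have [j0 bj0] := chart_at S 0.
have [psi [d [pg E0]]] := good_trans (@sv 0 I).1 (flat_good bj0).
exists psi, d.
pose P u := exists (j : J) (be : C), dom (b j) (cov u) /\
  \forall x \near cov u, psi (v u x) = be * w j x.
have P0 : P 0.
  by exists j0, 1; split => //; apply: filterS E0 => x ->; rewrite mul1r.
suff [j [be [bj Ej]]] : P e0.
  have c0 : cov e0 = cov 0 by rewrite -[e0]add0r cov_period.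
  (* [e0] and 0 lie over the same point of [Y], so the multiple of [w j] reached at [e0] converts
     into one of [w j0], which is [psi] of the initial germ. *)
  exists (be * fs_trans j j0); split => //.
  apply: (good_near_inv (@sv 0 I).1).
  have [_ He] := hol p0; have {He} := He 0; rewrite add0r => He.
  rewrite c0 in bj Ej.
  have n1 := nearI (near_dom bj) (near_dom bj0).
  apply: filterS3 (nearI Ej E0) He n1 => x [e1 e2] e3 [h1 h2].
  by rewrite -e3 e1 -e2 -mulrA; congr (_ * _); exact: esym (flat h1 h2).
apply: locally_constant_plane P0 => u.
have [j bj] := chart_at S u.
have gw := flat_good bj; have gv := (@sv u I).1.
(* Around [u], psi after v is a single germ [chi] of [w j]. To be a multiple of some [w k] at a
   point means that [chi] is linear, and this condition is the same at all the nearby points. *)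
have [chi [d' [cg Ec]]] := good_trans gw (good_germ gv pg).
have [_ [r1 r10 H1]] := @sv u I.
have n1 := nearI (near_near Ec) (nearI (near_dom bj) (good_on_Y embY Y_leaf gw (cov_Y u))).
have [r2 r20 H2] := cov_cont n1.
exists (Num.min r1 r2); first by rewrite lt_min r10.
move=> u' bu'; have [b1 b2] : box u r1 u' /\ box u r2 u'.
  by split; apply: box_le bu'; rewrite ge_min lexx ?orbT.
have [E' [bj' gw']] := H2 _ b2; have {}gw' := gw' (cov_Y u').
have Ev := H1 u' I b1.
have lin q (k : J) be : dom (b j) q -> dom (b k) q -> good F (w j) q ->
    (\forall x \near q, psi (v u x) = chi (w j x)) ->
    (\forall x \near q, psi (v u x) = be * w k x) ->
    near0 (fun z => chi z = be / fs_trans j k * z).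
  move=> hj hk gq e1 e2; apply: (good_near_inv gq).
  apply: filterS3 (nearI e1 e2) (near_dom hj) (near_dom hk) => x [<- ->] dj dk.
  have := flat dj dk; rewrite /fs_w => <-; rewrite mulrA divfK//.
  exact: tr_neq0.
have unlin q be : good F (w j) q -> (\forall x \near q, psi (v u x) = chi (w j x)) ->
    near0 (fun z => chi z = be * z) -> \forall x \near q, psi (v u x) = be * w j x.
  by move=> gq e1 /(good_near gq); apply: filterS2 e1 => x ->.
split=> [[k [be [bk Ek]]]|[k [be [bk Ek]]]].
  exists j, (be / fs_trans j k); split => //; apply: (unlin _ _ gw Ec).
  apply: (lin _ _ _ bj' bk gw' E').
  by apply: filterS2 Ev Ek => x ->.
exists j, (be / fs_trans j k); split => //.
have := unlin _ _ gw' E' (lin _ _ _ bj bk gw Ec Ek).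
by apply: filterS2 Ev => x ->.
Qed.

End beta.

Lemma not_type_beta : ~ (exists psi d, germ psi d /\
    exists lam, near0 (fun z => psi (h e0 z) = lam * psi z)) -> ~ type_beta Y.
Proof.
move=> nl [S flat]; apply: nl; have [psi [d [lam [pg E]]]] := flat_linear flat.
by exists psi, d; split => //; exists lam.
Qed.

End gamma.
End cover.

Theorem theorem1p1 (R : realType) (X : complexSurface R) (Y : set X)
    (Y_elliptic : elliptic_curve Y)
    (F : foliation X) (Y_in_F : Y `<=` fol_dom F) (Y_leaf : is_leaf F Y)
    (c : R -> X) (c_closed : closed_curve Y c)
    (h : R[i]^o -> R[i]^o) (h_holonomy : holonomy_along F Y c h)
    (h_irrational : irrationally_indifferent h)
    (h_nonlin : ~ linearizable h) :
  type_gamma Y.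
Proof.
case: Y_elliptic => embY _ [tf [tg [tfc tgc tfT tgT [tfK tgK]]]].
have [v sv] := sect_exists_any embY Y_in_F Y_leaf tgc tgT.
have [hl [m hol]] := holonomy_germs embY Y_leaf tgc tgT sv.
have [m1 [e0 [p0 irr nl]]] := multiplier_modulus embY Y_leaf tfc tfT tgT tfK tgK
  sv hol c_closed h_holonomy h_irrational h_nonlin.
split.
  exact (not_type_alpha embY Y_leaf tfc tgc tfT tgT tfK tgK sv hol m1 p0 irr).
exact (not_type_beta embY Y_leaf tfc tgc tfT tgT tfK tgK sv hol m1 p0 irr nl).
Qed.
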